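(* Let $n\ge1$, $1<p<\infty$, $0<q<\infty$, and $0\le\nu<\frac nq$ be such that $\frac{nq}{n-\nu q}\ge p$ (equivalently, $\frac1p\ge\frac1q-\frac\nu n$). Let $\delta,\gamma\in\mathbb R$. Then there is a constant $C$ such that the inequality $$\big\||x|^{-\delta}\widehat f\,\big\|_{M_q^\nu}\le C\,\big\||x|^\gamma f\big\|_{L_p(\mathbb R^n)}$$ holds for all $f\in L_1(\mathbb R^n)$ if and only if $$\max\Big\{0,\,n\Big(\frac1q-\frac1{p'}\Big)-\nu\Big\}\le\delta<\frac nq-\nu\qquad\text{and}\qquad \gamma=\delta+n\Big(\frac1{p'}-\frac1q\Big)+\nu .$$
   Context: The Fourier transform of $f\in L_1(\mathbb R^n)$ is $\widehat f(y)=\int_{\mathbb R^n}f(x)e^{-2\pi i(x,y)}\,dx$; $p'=\frac p{p-1}$. The Morrey quasi-norm is $\|g\|_{M_q^\nu}=\sup_{r>0}r^{-\nu}\sup_{x\in\mathbb R^n}\|g\|_{L_q(B_r(x))}$, where $B_r(x)$ is the ball of radius $r$ centered at $x\in\mathbb R^n$. The inequality is trivially true for those $f$ for which the right-hand side is infinite. *)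

(* Defs.v *)
From HB Require Import structures.
From mathcomp Require Import all_boot all_order all_algebra.
From mathcomp Require Import complex.
From mathcomp Require Import all_classical all_reals all_analysis.

Set Implicit Arguments.
Unset Strict Implicit.
Unset Printing Implicit Defensive.

Import Order.TTheory GRing.Theory Num.Theory.
Import numFieldNormedType.Exports.

Local Open Scope classical_set_scope.
Local Open Scope ring_scope.

Section tuple_product.
Local Open Scope ereal_scope.
Context d (T : measurableType d) (R : realType) (n : nat).

Definition tuple_cons (xt : T * n.-tuple T) : n.+1.-tuple T :=
  [the n.+1.-tuple T of xt.1 :: xt.2].

Lemma measurable_tuple_cons : measurable_fun [set: T * n.-tuple T] tuple_cons.
Proof. exact: measurable_cons. Qed.

Lemma preimage_tuple_cons (A : 'I_n.+1 -> set T) :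
  tuple_cons @^-1` [set t | forall i, A i (tnth t i)] =
  A ord0 `*` [set t | forall i, A (lift ord0 i) (tnth t i)].
Proof.
apply/seteqP; split => -[x t] /=.
  move=> At; split; first exact: (At ord0).
  by move=> i; have := At (lift ord0 i); rewrite tnthS.
by move=> [Ax At] i; case: (unliftP ord0 i) => [j ->|->//]; rewrite tnthS.
Qed.

Variable m1 : {sigma_finite_measure set T -> \bar R}.
Variable m2 : {sigma_finite_measure set (n.-tuple T) -> \bar R}.

Definition tuple_product : set (n.+1.-tuple T) -> \bar R :=
  pushforward (m1 \x m2) tuple_cons.

Let tuple_product0 : tuple_product set0 = 0.
Proof. by rewrite /tuple_product /pushforward preimage_set0 measure0. Qed.

Let tuple_product_ge0 A : 0 <= tuple_product A.
Proof. by rewrite /tuple_product /pushforward measure_ge0. Qed.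

Let tuple_product_sigma_additive : semi_sigma_additive tuple_product.
Proof.
have mcons := measurable_tuple_cons.
exact: (@measure_semi_sigma_additive _ _ _ (pushforward (m1 \x m2) tuple_cons)).
Qed.

HB.instance Definition _ := isMeasure.Build _ _ _ tuple_product
  tuple_product0 tuple_product_ge0 tuple_product_sigma_additive.

Let tuple_product_sigma_finite : sigma_finite setT tuple_product.
Proof.
have /sigma_finiteP[F [FT ndF Foo]] := sigma_finiteT m1.
have /sigma_finiteP[G [GT ndG Goo]] := sigma_finiteT m2.
exists (fun k => (fun t => tnth t ord0) @^-1` F k `&`
                 (fun t : n.+1.-tuple T => [tuple of behead t]) @^-1` G k).
  apply/esym; rewrite -subTset => t _.
  have [k _ Fk] : (\bigcup_k F k) (tnth t ord0) by rewrite -FT.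
  have [l _ Gl] : (\bigcup_k G k) [tuple of behead t] by rewrite -GT.
  exists (maxn k l) => //; split => /=.
    by move: (tnth t ord0) Fk; exact/subsetPset/ndF/leq_maxl.
  by move: [tuple of behead t] Gl; exact/subsetPset/ndG/leq_maxr.
move=> k; have [mF Fk] := Foo k; have [mG Gk] := Goo k; split.
  apply: measurableI; rewrite -[X in measurable X]setTI.
    exact: (measurable_tnth ord0).
  exact: measurable_behead.
rewrite /tuple_product /pushforward (_ : _ @^-1` _ = F k `*` G k).
  by rewrite product_measure1E// lte_mul_pinfty// ge0_fin_numE.
apply/seteqP; split => -[x t] /=.
all: by rewrite (_ : [tuple of _] = t)//; exact: val_inj.
Qed.

HB.instance Definition _ := Measure_isSigmaFinite.Build _ _ _ tuple_product
  tuple_product_sigma_finite.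

End tuple_product.

Section lebesgue_tuple.
Context {R : realType}.

(* Lebesgue measure on R^n, as the n-fold product of the one on R; the elements
   of [measurableTypeR R] are those of [R]. *)
Fixpoint lebesgue_tuple (n : nat) :
    {sigma_finite_measure set (n.-tuple (measurableTypeR R)) -> \bar R} :=
  if n is n'.+1 then tuple_product lebesgue_measure (lebesgue_tuple n')
  else \d_ [tuple].

Lemma lebesgue_tuple_box n (A : 'I_n -> set (measurableTypeR R)) :
  (forall i, measurable (A i)) ->
  lebesgue_tuple n [set t | forall i, A i (tnth t i)] =
  (\prod_(i < n) lebesgue_measure (A i))%E.
Proof.
elim: n A => [|n ih] A mA.
  rewrite big_ord0 /= diracE mem_set//= => -[].
  by [].
rewrite big_ord_recl /= /tuple_product /pushforward preimage_tuple_cons.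
have mB : measurable [set t : n.-tuple (measurableTypeR R) |
    forall i, A (lift ord0 i) (tnth t i)].
  rewrite (_ : [set _ | _] = \bigcap_(i in [set: 'I_n])
    ((fun t : n.-tuple (measurableTypeR R) => tnth t i) @^-1` A (lift ord0 i))).
    apply: fin_bigcap_measurable => [|i _]; first exact: finite_finset.
    by rewrite -[X in measurable X]setTI; exact: measurable_tnth.
  by apply/seteqP; split => t /= At i; [move=> _; exact: At|exact: At].
rewrite [LHS]product_measure1E//; congr (_ * _)%E.
exact: ih.
Qed.

End lebesgue_tuple.

Section euclidean_space.
Context {R : realType} {n : nat}.
Local Notation Rn := (n.-tuple (measurableTypeR R)).

Definition dotp (x y : Rn) : R :=
  \sum_(i < n) (tnth x i : R) * (tnth y i : R).

Definition enorm (x : Rn) : R := Num.sqrt (dotp x x).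

Definition eball (x : Rn) (r : R) : set Rn :=
  [set y | Num.sqrt (\sum_(i < n) ((tnth y i : R) - (tnth x i : R)) ^+ 2) < r].

End euclidean_space.

Section complex_valued.
Local Open Scope complex_scope.
Context {R : realType} {n : nat}.
Local Notation Rn := (n.-tuple (measurableTypeR R)).
Local Notation mu := (@lebesgue_tuple R n).
Implicit Types f g : Rn -> R[i].

Definition L1 f : Prop :=
  mu.-integrable setT (fun x => (complex.Re (f x))%:E) /\
  mu.-integrable setT (fun x => (complex.Im (f x))%:E).

Definition Cintegral f : R[i] :=
  (\int[mu]_x complex.Re (f x)) +i* (\int[mu]_x complex.Im (f x)).

Definition Cexpi (t : R) : R[i] := cos t +i* sin t.

Definition fourier f (y : Rn) : R[i] :=
  Cintegral (fun x => f x * Cexpi (- (2 * pi * dotp x y))).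

(* For a < 0 the library sets 0 `^ a = 0, so the value at the origin is
   arbitrary; this only concerns a null set, as 0 < n in the theorem. *)
Definition weighted (a : R) f (x : Rn) : R[i] := (enorm x `^ a)%:C * f x.

(* [\_ D] extends g by 0 outside D, so that this is
   (\int_D |g|^p)^(1/p) for 0 < p. *)
Definition Lp_norm (p : R) (D : set Rn) g : \bar R :=
  'N[mu]_(p%:E) [(fun x => (ComplexField.Normc.normc (g x))%:E) \_ D].

Definition morrey_norm (q nu : R) g : \bar R :=
  ereal_sup [set ((r `^ (- nu))%:E *
                  ereal_sup [set Lp_norm q (eball x r) g | x in [set: Rn]])%E
            | r in [set r : R | 0 < r]].

End complex_valued.

(* Main.v *)
Require Import Defs.
From mathcomp Require Import all_boot all_order all_algebra.
From mathcomp Require Import complex.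
From mathcomp Require Import all_classical all_reals all_analysis.
From mathcomp Require Import measurable_realfun ring lra.

Set Implicit Arguments.
Unset Strict Implicit.
Unset Printing Implicit Defensive.

Import Order.TTheory GRing.Theory Num.Theory.
Import numFieldNormedType.Exports.

Local Open Scope classical_set_scope.
Local Open Scope ring_scope.

(** The idea of the proof.

Put [s = n q / (n - nu q)], so that [n / s = n / q - nu], [q <= s] and [p <= s].

Sufficiency.  On a ball of radius [r] the [L_q] norm is at most a constant times
[r^(n/q - n/s) = r^nu] times the global [L_s] norm ([Lp_norm_ball]), so the
Morrey norm can be replaced by the [L_s] norm, and the claim becomes Pitt's
inequality: the [L_s] norm of [|y|^-delta fhat] is bounded by the [L_p] norm of
[|x|^gamma f].  It is proved for every operator [T u y = int u(x) K(x,y) dx]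
whose kernel is symmetric, bounded by 1 and bounded on [L_2], the weight being
any [w >= 0] with [mu {w < r} <= V r] ([pitt_inequality]); the Fourier transform
is made of the kernels [cos (2 pi x.y)] and [sin (2 pi x.y)], with [w = |x|^n].
- Without a weight on [u], the two extreme cases [s = p'] (Hausdorff-Young) and
  [s = p] (Paley) come from cutting [u] at a level, using the trivial bound
  [|T u| <= ||u||_1] on one part and the [L_2] bound on the other; the cases in
  between follow pointwise ([hausdorff_young], [paley], [pitt_diag]).
- A weight [w^g] on [u] is handled by cutting [u] into dyadic shells of [w].  On
  one shell the weight is a constant, and the estimate has room to spare at both
  ends of the range of [w y], so that the shells can be summed
  ([pitt_annulus], [pitt_shells], [pitt_dyadic]).
- The cases [s > p'] follow by duality, [T] being symmetric ([pitt_dual]).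
- The [L_2] bound is Plancherel's inequality up to a constant.  On the line it
  comes from damping by a triangle function, whose Fourier transform is the
  integrable Fejer kernel, and Schur's test ([plancherel_line]); the addition
  formulas and Tonelli's theorem pass it on to [R^n] ([L2_bounded_dot]).

Necessity.  If [f] is a non-negative step function times a character, then
[|fhat|] is at least half the integral of [f] on the dual scale around the
frequency of that character ([morrey_fourier_ge]).  Four families of such [f]
give the four conditions: dilations of a cube determine [gamma]
([scaling_exponent]); modulations give [delta >= 0] ([modulation_exponent]);
translations give [gamma >= 0], which is the other lower bound for [delta]
([translation_exponent]); and the superposition of [N] bumps of integral 1 at
[N] dyadic scales, which has [|fhat| >= N/2] near the origin but a norm
[O(N^(1/p))] as soon as [delta >= n/q - nu], gives the upper bound for [delta]
([dyadic_exponent]). *)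

(** * Integration of non-negative functions *)

Section integral_tools.
Local Open Scope ereal_scope.
Context d (T : measurableType d) (R : realType) (mu : {measure set T -> \bar R}).

Import HBNNSimple.

Lemma le_integral_ge0 (f g : T -> \bar R) :
  (forall x, 0 <= f x) -> (forall x, f x <= g x) ->
  \int[mu]_x f x <= \int[mu]_x g x.
Proof.
move=> f0 fg; rewrite !ge0_integralTE//; last first.
  by move=> x; exact: le_trans (fg x).
apply: le_ereal_sup => _ [h hf <-].
by exists h => // x; exact: le_trans (fg x).
Qed.

Lemma measurable_natmulb (b : T -> bool) : measurable_fun setT b ->
  measurable_fun setT (fun x => (b x)%:R : R).
Proof.
move=> mb; rewrite (_ : (fun _ => _) = (fun x => if b x then 1%R else 0%R)).
  by apply: measurable_fun_ifT.
by apply/funext => x; case: (b x).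
Qed.

Lemma integral_natmulb (b : T -> bool) : measurable_fun setT b ->
  \int[mu]_x ((b x)%:R)%:E = mu [set x | b x].
Proof.
move=> mb; have mB : measurable [set x | b x].
  by rewrite -[X in measurable X]setTI; apply: mb => //.
transitivity (\int[mu]_x (\1_[set x | b x] x)%:E).
  apply: eq_integral => x _; congr (_%:E); rewrite indicE.
  case: (boolP (b x)) => bx; first by rewrite mem_set.
  by rewrite memNset//=; exact/negP.
by rewrite integral_indic// setIT.
Qed.

Lemma integralZl_ge0 (k : R) (f : T -> R) : measurable_fun setT f ->
  (0 <= k)%R -> (forall x, 0 <= f x)%R ->
  \int[mu]_x (k * f x)%:E = k%:E * \int[mu]_x (f x)%:E.
Proof.
move=> mf k0 f0; under eq_integral do rewrite EFinM.
by rewrite ge0_integralZl_EFin// => [x _|]; [rewrite lee_fin|exact/measurable_EFinP].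
Qed.

Lemma integralD_ge0 (f g : T -> R) :
  measurable_fun setT f -> measurable_fun setT g ->
  (forall x, 0 <= f x)%R -> (forall x, 0 <= g x)%R ->
  \int[mu]_x (f x + g x)%:E = \int[mu]_x (f x)%:E + \int[mu]_x (g x)%:E.
Proof.
move=> mf mg f0 g0; under eq_integral do rewrite EFinD.
by rewrite ge0_integralD//; do ?[by move=> x _; rewrite lee_fin|exact/measurable_EFinP].
Qed.

End integral_tools.

Ltac mble :=
  repeat first
  [ assumption
  | exact: measurable_cst | exact: measurable_id
  | exact: measurable_fst | exact: measurable_snd
  | match goal with
    | |- measurable_fun _ (fun p => EFin _) => apply/measurable_EFinP
    | |- measurable_fun _ (EFin \o _) => apply/measurable_EFinP
    | H : measurable_fun setT ?u |- measurable_fun setT (fun p => ?u (@?g p)) =>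
        apply: (measurableT_comp H)
    | |- measurable_fun _ (fun p => (@?b p)%:R) => apply: measurable_natmulb
    | |- measurable_fun _ (fun p => powR (@?g p) ?a) =>
        apply: (measurableT_comp (measurable_powR a))
    | |- measurable_fun _ (fun p => @GRing.mul _ _ _) => apply: measurable_funM
    | |- measurable_fun _ (fun p => @GRing.add _ _ (- _)) => apply: measurable_funB
    | |- measurable_fun _ (fun p => @GRing.add _ _ _) => apply: measurable_funD
    | |- measurable_fun _ (fun p => @GRing.opp _ _) => apply: measurable_funN
    | |- measurable_fun _ (fun p => @GRing.exp _ _ _) => apply: measurable_funX
    | |- measurable_fun _ (fun p => Num.norm (@?g p)) =>
        apply: (measurableT_comp (@normr_measurable _ setT))
    | |- measurable_fun _ (fun p => (_ < _)%R) => apply: measurable_fun_ltr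
    | |- measurable_fun _ (fun p => (_ <= _)%R) => apply: measurable_fun_ler
    | |- measurable_fun _ (@Order.lt _ _ ?c) =>
        apply: (@measurable_fun_ltr _ _ _ _ (cst c) id)
    | |- measurable_fun _ (@Order.le _ _ ?c) =>
        apply: (@measurable_fun_ler _ _ _ _ (cst c) id)
    | |- measurable_fun _ (fun p => andb _ _) => apply: measurable_and
    | |- measurable_fun _ (fun p => negb _) => apply: measurable_neg
    | |- measurable_fun _ (fun p => pair _ _) => apply: measurable_fun_pair
    end ].

Ltac nng :=
  repeat first
  [ done | exact: ler01 | exact: powR_ge0 | exact: sqr_ge0 | exact: normr_ge0 | exact: ler0n
  | by apply: ltW | match goal with
    | |- is_true (Order.le _ (EFin _)) => rewrite lee_fin
    | |- is_true (Order.le _ (@GRing.mul _ _ _)) => apply: mulr_ge0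
    | |- is_true (Order.le _ (@GRing.add _ _ _)) => apply: addr_ge0
    | |- is_true (Order.le _ (@GRing.inv _ _)) => rewrite invr_ge0
    | |- is_true (Order.le _ (@GRing.exp _ _ _)) => apply: exprn_ge0
    end ].

(** * Power integrals and layer-cake formulas *)

Section power_integrals.
Context (R : realType).
Notation leb := (@lebesgue_measure R).
Implicit Types a h : R.

Let powR_cvgy a : 0 < a -> x `^ (- a) @[x --> +oo] --> (0 : R).
Proof.
move=> a0; apply/cvgrPdist_le => e e0; near=> x.
have x0 : 0 < x by near: x; exact: nbhs_pinfty_gt.
rewrite sub0r normrN ger0_norm ?powR_ge0// powRN.
rewrite -[leRHS]invrK lef_pV2 ?posrE ?powR_gt0 ?invr_gt0//.
have -> : e^-1 = (e^-1 `^ a^-1) `^ a.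
  by rewrite -powRrM mulVf ?gt_eqF// powRr1// invr_ge0 ltW.
apply: ge0_ler_powR; rewrite ?nnegrE ?powR_ge0 ?ltW//.
Unshelve. all: end_near. Qed.

Lemma integral_powR_ninfty a h : 0 < a -> 0 < h ->
  (\int[leb]_t ((h <= t)%R%:R * t `^ (- a - 1))%:E = (h `^ (- a) / a)%:E)%E.
Proof.
move=> a0 h0.
transitivity (\int[leb]_(t in `[h, +oo[) (t `^ (- a - 1))%:E)%E.
  rewrite [RHS]integral_mkcond; apply: eq_integral => t _.
  rewrite patchE /= mem_setE in_itv/= andbT; case: ifPn => ht; last by rewrite mul0r.
  by rewrite mul1r.
pose F : R -> R := (- a^-1) \*: (@powR R ^~ (- a)).
have dp x : 0 < x -> derivable (@powR R ^~ (- a)) x 1.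
  by move=> x0; apply: derivable_powR; rewrite in_itv/= andbT.
have dF x : 0 < x -> derivable F x 1 by move=> x0; exact/derivableZ/dp.
rewrite (@ge0_continuous_FTC2y _ _ F _ 0).
- by rewrite -EFinB /F/= sub0r /GRing.scale/= mulNr opprK mulrC.
- by move=> x _; exact: powR_ge0.
- apply: continuous_in_subspaceT => x; rewrite inE /= in_itv/= andbT => hx.
  apply: differentiable_continuous; apply/derivable1_diffP.
  by apply: derivable_powR; rewrite in_itv/= andbT (lt_le_trans h0).
- by rewrite -(mulr0 (- a^-1)); apply: cvgMr; exact: powR_cvgy.
- by move=> x hx; apply: dF; exact: lt_trans hx.
- apply: cvg_at_right_filter.
  by apply: differentiable_continuous; apply/derivable1_diffP; exact: dF.
- move=> x; rewrite in_itv/= andbT => hx.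
  have x0 : 0 < x by exact: lt_trans hx.
  rewrite derive1E /F deriveZ; last exact: dp.
  rewrite -derive1E powR_derive1 ?in_itv/= ?andbT// /GRing.scale/=.
  by rewrite mulrA mulrNN mulVf ?gt_eqF// mul1r.
Qed.

Lemma integral_powR_near0 a h : 0 < a -> 0 <= h ->
  (\int[leb]_t (((0 < t) && (t < h))%R%:R * t `^ (a - 1))%:E = (h `^ a / a)%:E)%E.
Proof.
move=> a0; rewrite le_eqVlt => /predU1P[<-|h0].
  rewrite powR0 ?gt_eqF// mul0r; apply: integral0_eq => t _.
  by case: (ltP 0 t) => t0; rewrite /= ?(lt_gtF t0) ?mul0r.
(* the integrand may be unbounded at 0, so the interval is exhausted *)
pose F k := `[h / k.+2%:R, h[%classic : set R.
have -> : (\int[leb]_t (((0 < t) && (t < h))%R%:R * t `^ (a - 1))%:E =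
    \int[leb]_(t in \bigcup_k F k) (t `^ (a - 1))%:E)%E.
  rewrite [RHS]integral_mkcond; apply: eq_integral => t _.
  rewrite patchE; case: ifPn => [/set_mem[k _]|].
    rewrite /F/= in_itv/= => /andP[ht ->]; rewrite andbT.
    by rewrite (lt_le_trans _ ht) ?divr_gt0// mul1r.
  move=> /negP nt; case: (ltP 0 t) => t0 /=; last by rewrite mul0r.
  case: (ltP t h) => th; last by rewrite mul0r.
  exfalso; apply: nt; rewrite inE; exists (Num.truncn (h / t)) => //.
  rewrite /F/= in_itv/= th andbT ler_pdivrMr// mulrC -ler_pdivrMr//.
  by rewrite (le_trans (ltW (truncnS_gt _)))// ler_nat.
have ndF : nondecreasing_seq F.
  move=> i j ij; rewrite subsetEset => x; rewrite /F/= !in_itv/= => /andP[hx ->].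
  by rewrite andbT (le_trans _ hx)// ler_pM2l// lef_pV2 ?posrE// ler_nat !ltnS.
have mF i : measurable (F i) by exact: measurable_itv.
have mf i : measurable_fun (F i) (fun t => (t `^ (a - 1))%:E).
  by apply: measurable_funTS; mble.
have f0 i x : F i x -> (0 <= (x `^ (a - 1))%:E)%E by rewrite lee_fin powR_ge0.
have cvgI : (\int[leb]_(x in F i) (x `^ (a - 1))%:E @[i --> \oo] -->
    \int[leb]_(x in \bigcup_i F i) (x `^ (a - 1))%:E)%E.
  exact: ge0_nondecreasing_set_cvg_integral.
rewrite -(cvg_lim _ cvgI)//; apply/cvg_lim => //.
pose G : R -> R := a^-1 \*: (@powR R ^~ a).
have dp x : 0 < x -> derivable (@powR R ^~ a) x 1.
  by move=> x0; apply: derivable_powR; rewrite in_itv/= andbT.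
have dG x : 0 < x -> derivable G x 1 by move=> x0; exact/derivableZ/dp.
have cG x : 0 < x -> {for x, continuous G}.
  by move=> x0; apply: differentiable_continuous; apply/derivable1_diffP; exact: dG.
have FE k : (\int[leb]_(x in F k) (x `^ (a - 1))%:E = (G h - G (h / k.+2%:R))%:E)%E.
  have hk0 : 0 < h / k.+2%:R by rewrite divr_gt0.
  have hkh : h / k.+2%:R < h by rewrite ltr_pdivrMr// ltr_pMr// ltr1n.
  rewrite /F integral_itv_bndo_bndc; last exact: mf.
  rewrite (@continuous_FTC2 _ _ G)//.
  - apply: continuous_in_subspaceT => x; rewrite inE /= in_itv/= => /andP[hx _].
    apply: differentiable_continuous; apply/derivable1_diffP.
    by apply: derivable_powR; rewrite in_itv/= andbT (lt_le_trans hk0).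
  - split.
    + by move=> x; rewrite in_itv/= => /andP[hx _]; apply: dG; exact: lt_trans hx.
    + by apply: cvg_at_right_filter; exact: cG.
    + by apply: cvg_at_left_filter; exact: cG.
  - move=> x; rewrite in_itv/= => /andP[hx _].
    have x0 : 0 < x by exact: lt_trans hx.
    rewrite derive1E /G deriveZ; last exact: dp.
    rewrite -derive1E powR_derive1 ?in_itv/= ?andbT// /GRing.scale/=.
    by rewrite mulrA mulVf ?gt_eqF// mul1r.
under eq_fun do rewrite FE.
apply: cvg_EFin; first by near=> k.
rewrite -[X in _ --> X]subr0 {1}(_ : h `^ a / a = G h); last by rewrite /G/= mulrC.
apply: cvgB; first exact: cvg_cst.
rewrite -(mulr0 a^-1); apply: cvgMr.
have /cvg_at_rightP := powR_cvg0 a0; apply; split => [k|]; first by rewrite divr_gt0.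
rewrite -(mulr0 h); apply: cvgMr.
by have := @cvg_harmonic R; rewrite -cvg_shiftS.
Unshelve. all: end_near. Qed.

End power_integrals.

Section layer_cake.
Context d (T : measurableType d) (R : realType).
Variable mu : {sigma_finite_measure set T -> \bar R}.
Notation leb := (@lebesgue_measure R).

(** Integrating [r t^(r-1)] over [0 < t < F y] gives [F y ^ r]; Tonelli does the rest. *)
Lemma layer_cake (w F : T -> R) (r : R) : 0 < r ->
  measurable_fun setT w -> measurable_fun setT F ->
  (forall y, 0 <= w y) -> (forall y, 0 <= F y) ->
  (\int[mu]_y (w y * F y `^ r)%:E =
   \int[leb]_t (((0 < t)%R%:R * (r * t `^ (r - 1)))%:E *
      \int[mu]_y (w y * (t < F y)%R%:R)%:E))%E.
Proof.
move=> r0 mw mF w0 F0.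
pose g (z : T * measurableTypeR R) : R :=
  w z.1 * (r * (((0 < z.2) && (z.2 < F z.1))%:R * z.2 `^ (r - 1))).
have mg : measurable_fun setT (EFin \o g) by rewrite /g; mble.
have g0 z : (0 <= (g z)%:E)%E.
  by rewrite lee_fin !mulr_ge0 ?powR_ge0// ltW.
transitivity (\int[mu]_y \int[leb]_t (g (y, t))%:E)%E.
  apply: eq_integral => y _; rewrite /g/=.
  rewrite integralZl_ge0//; first last.
  - by move=> t; rewrite !mulr_ge0 ?powR_ge0// ltW.
  - by mble.
  rewrite integralZl_ge0//; first last.
  - by move=> t; rewrite !mulr_ge0 ?powR_ge0// ltW.
  - exact: ltW.
  - by mble.
  by rewrite integral_powR_near0// -!EFinM; congr (_%:E); field; rewrite gt_eqF.
rewrite (fubini_tonelli (EFin \o g) mg g0)/=; apply: eq_integral => t _.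
rewrite -integralZl_ge0//; first last.
- by move=> y; rewrite mulr_ge0.
- by rewrite !mulr_ge0 ?powR_ge0// ltW.
- by mble.
apply: eq_integral => y _; congr (_%:E); rewrite /g/=.
by rewrite -mulnb natrM; ring.
Qed.

(** As above with [r t^(-r-1)] over [t >= F y]; where [F] vanishes both sides
    contribute nothing, because [0 `^ (- r) = 0]. *)
Lemma layer_cakeN (w F : T -> R) (r : R) : 0 < r ->
  measurable_fun setT w -> measurable_fun setT F ->
  (forall y, 0 <= w y) -> (forall y, 0 <= F y) ->
  (\int[mu]_y (w y * F y `^ (- r))%:E =
   \int[leb]_t (((0 < t)%R%:R * (r * t `^ (- r - 1)))%:E *
      \int[mu]_y (w y * ((0 < F y) && (F y <= t))%R%:R)%:E))%E.
Proof.
move=> r0 mw mF w0 F0.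
pose g (z : T * measurableTypeR R) : R :=
  (w z.1 * (0 < F z.1)%R%:R) * (r * ((F z.1 <= z.2)%R%:R * z.2 `^ (- r - 1))).
have mg : measurable_fun setT (EFin \o g) by rewrite /g; mble.
have g0 z : (0 <= (g z)%:E)%E.
  by rewrite lee_fin !mulr_ge0 ?powR_ge0// ltW.
transitivity (\int[mu]_y \int[leb]_t (g (y, t))%:E)%E.
  apply: eq_integral => y _; rewrite /g/=.
  rewrite integralZl_ge0//; first last.
  - by move=> t; rewrite !mulr_ge0 ?powR_ge0// ltW.
  - by rewrite mulr_ge0.
  - by mble.
  have := F0 y; rewrite le_eqVlt => /predU1P[<-|Fy0].
    by rewrite powR0 ?oppr_eq0 ?gt_eqF// ltxx !mulr0 mul0e.
  rewrite integralZl_ge0//; first last.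
  - by move=> t; rewrite !mulr_ge0 ?powR_ge0// ltW.
  - exact: ltW.
  - by mble.
  rewrite integral_powR_ninfty// Fy0 mulr1 -!EFinM; congr (_%:E).
  by field; rewrite gt_eqF.
rewrite (fubini_tonelli (EFin \o g) mg g0)/=; apply: eq_integral => t _.
rewrite -integralZl_ge0//; first last.
- by move=> y; rewrite mulr_ge0.
- by rewrite !mulr_ge0 ?powR_ge0// ltW.
- by mble.
apply: eq_integral => y _; congr (_%:E); rewrite /g/=.
case: (ltP 0 (F y)) => Fy0 /=; last by rewrite !(mulr0, mul0r).
case: (leP (F y) t) => Ft /=; last by rewrite !(mulr0, mul0r).
by rewrite (lt_le_trans Fy0 Ft) !(mul1r, mulr1); ring.
Qed.

End layer_cake.

(** * Integral operators with a bounded kernel *)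

Definition kernel_op d (X : measurableType d) (R : realType)
    (mu : {measure set X -> \bar R}) (K : X -> X -> R) (u : X -> R) (y : X) : R :=
  (\int[mu]_x (u x * K x y))%R.

Section kernel_op.
Context d (X : measurableType d) (R : realType).
Variable mu : {measure set X -> \bar R}.
Variable K : X -> X -> R.
Hypothesis mK : measurable_fun setT (fun z : X * X => K z.1 z.2).
Hypothesis K1 : forall x y, `|K x y| <= 1.
Local Notation T := (kernel_op mu K).
Local Notation L1r u := (mu.-integrable setT (EFin \o (u : X -> R))).

Lemma measurable_L1r (u : X -> R) : L1r u -> measurable_fun setT u.
Proof. by move=> /measurable_int/measurable_EFinP. Qed.

Lemma integrable_dominated (u v : X -> R) : L1r u -> measurable_fun setT v ->
  (forall x, `|v x| <= `|u x|) -> L1r v.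
Proof.
move=> iu mv vu; apply: le_integrable iu => //; first exact/measurable_EFinP.
by move=> x _ /=; rewrite lee_fin.
Qed.

Lemma measurable_kernel1 y : measurable_fun setT (K ^~ y).
Proof. exact: (measurableT_comp mK (pair2_measurable y)). Qed.

Lemma measurable_kernel2 x : measurable_fun setT (K x).
Proof. exact: (measurableT_comp mK (pair1_measurable x)). Qed.

Lemma integrable_kernel_op u y : L1r u -> L1r (fun x => u x * K x y).
Proof.
move=> iu; have mu_ := measurable_L1r iu; have mKy := measurable_kernel1 y.
apply: (integrable_dominated iu) => [|x]; first by mble.
by rewrite normrM ler_piMr.
Qed.

Lemma kernel_opD u v y : L1r u -> L1r v ->
  T (fun x => u x + v x) y = T u y + T v y.
Proof.
move=> iu iv; rewrite /kernel_op -RintegralD//.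
- by apply: eq_Rintegral => x _; rewrite mulrDl.
- exact: integrable_kernel_op.
- exact: integrable_kernel_op.
Qed.

Lemma kernel_opZ c u y : L1r u -> T (fun x => c * u x) y = c * T u y.
Proof.
move=> iu; rewrite /kernel_op -RintegralZl//; last exact: integrable_kernel_op.
by apply: eq_Rintegral => x _; rewrite mulrA.
Qed.

Lemma kernel_op_le u y : L1r u -> (`|T u y|%:E <= \int[mu]_x `|u x|%:E)%E.
Proof.
move=> iu; have mu_ := measurable_L1r iu.
rewrite /kernel_op EFin_normr_Rintegral//; last exact: integrable_kernel_op.
apply: le_trans (le_abse_integral _ _ _) _ => //.
  by apply: measurable_int; exact: integrable_kernel_op.
apply: le_integral_ge0 => x; first by [].
by rewrite lee_fin normrM ler_piMr.
Qed.

End kernel_op.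

Lemma measurable_Rintegral_param d d' (Z : measurableType d) (Y : measurableType d')
    (R : realType) (m : {sigma_finite_measure set Y -> \bar R}) (f : Z * Y -> R) :
  measurable_fun setT f -> measurable_fun setT (fun z => \int[m]_y f (z, y)).
Proof.
move=> mf; pose F z := (f z)%:E.
have mF : measurable_fun setT F by rewrite /F; mble.
have -> : (fun z => \int[m]_y f (z, y)) =
    fine \o (fun z => \int[m]_y F^\+ (z, y) - \int[m]_y F^\- (z, y))%E.
  apply/funext => z; rewrite /Rintegral /=; congr fine.
  rewrite integralE; congr (_ - _)%E; apply: eq_integral => y _.
    by rewrite !funeposE.
  by rewrite !funenegE.
apply: measurableT_comp; first exact: fine_measurable.
apply: emeasurable_funB.
- by apply: (measurable_fun_fubini_tonelli_F _ (measurable_funepos mF)) => z.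
- by apply: (measurable_fun_fubini_tonelli_F _ (measurable_funeneg mF)) => z.
Qed.

Lemma measurable_kernel_op d (X : measurableType d) (R : realType)
    (mu : {sigma_finite_measure set X -> \bar R}) (K : X -> X -> R) (u : X -> R) :
  measurable_fun setT (fun z : X * X => K z.1 z.2) ->
  measurable_fun setT u -> measurable_fun setT (kernel_op mu K u).
Proof.
move=> mK mu_; pose f (z : X * X) := u z.2 * K z.2 z.1.
apply: (@measurable_Rintegral_param _ _ _ _ _ mu f); rewrite /f.
apply: measurable_funM; first by mble.
exact: (measurableT_comp mK (measurable_fun_pair measurable_snd measurable_fst)).
Qed.

Section pitt_def.
Context d (X : measurableType d) (R : realType).
Variable mu : {sigma_finite_measure set X -> \bar R}.
Variables (K : X -> X -> R) (w : X -> R).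

(** Normalising the right-hand side removes all roots from the inequality. *)
Definition pitt (p s a g C : R) := forall u : X -> R,
  mu.-integrable setT (EFin \o u) ->
  (\int[mu]_x ((w x `^ g * `|u x|) `^ p)%:E <= 1)%E ->
  (\int[mu]_y ((w y `^ (- a) * `|kernel_op mu K u y|) `^ s)%:E <= C%:E)%E.

End pitt_def.

(** * The Hausdorff-Young inequality *)

Section interpolation.
Context d (X : measurableType d) (R : realType).
Variable mu : {sigma_finite_measure set X -> \bar R}.
Variable K : X -> X -> R.
Hypothesis mK : measurable_fun setT (fun z : X * X => K z.1 z.2).
Hypothesis K1 : forall x y, `|K x y| <= 1.
Local Notation T := (kernel_op mu K).
Local Notation L1r u := (mu.-integrable setT (EFin \o (u : X -> R))).
Variable A : R.
Hypothesis A0 : 0 <= A.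
Hypothesis L2 : forall u, L1r u ->
  (\int[mu]_y (T u y ^+ 2)%:E <= A%:E * \int[mu]_x (u x ^+ 2)%:E)%E.

Lemma integrable_cut (e : X -> bool) (u : X -> R) : measurable_fun setT e ->
  L1r u -> L1r (fun x => u x * (e x)%:R).
Proof.
move=> me iu; have mu_ := measurable_L1r iu.
apply: (integrable_dominated iu) => [|x]; first by mble.
by case: (e x); rewrite ?mulr1// mulr0 normr0.
Qed.

Lemma kernel_op_cut (e : X -> bool) (u : X -> R) y : measurable_fun setT e ->
  L1r u ->
  T u y = T (fun x => u x * (e x)%:R) y + T (fun x => u x * (~~ e x)%:R) y.
Proof.
move=> me iu; rewrite -kernel_opD//; last 2 first.
- exact: integrable_cut.
- by apply: integrable_cut => //; exact: measurable_neg.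
congr kernel_op; apply/funext => x.
by case: (e x); rewrite /= !(mulr0, mulr1, addr0, add0r).
Qed.

(** Chebyshev's inequality after a splitting: if [b + g] exceeds [t] and [b] is at
    most [t / 2], then [g] exceeds [t / 2]. *)
Lemma indicator_le_sqr (t a b g : R) : 0 < t -> `|a| <= `|b| + `|g| ->
  `|b| <= t / 2 -> (t < `|a|)%R%:R <= 4 / t ^+ 2 * g ^+ 2.
Proof.
move=> t0 abg bt; have c0 : 0 <= 4 / t ^+ 2 * g ^+ 2.
  by rewrite mulr_ge0 ?sqr_ge0// divr_ge0 ?sqr_ge0.
case: ltP => // ta; have tg : t / 2 <= `|g| by lra.
have : t ^+ 2 <= 4 * `|g| ^+ 2 by nra.
by rewrite real_normK ?num_real// mulrAC ler_pdivlMr ?exprn_gt0// mul1r.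
Qed.

Lemma cut_L2 (e : X -> bool) (u : X -> R) : measurable_fun setT e -> L1r u ->
  (\int[mu]_y (T (fun x => u x * (e x)%:R) y ^+ 2)%:E <=
   A%:E * \int[mu]_x (u x ^+ 2 * (e x)%:R)%:E)%E.
Proof.
move=> me iu; apply: le_trans (L2 (integrable_cut me iu)) _.
rewrite le_eqVlt; apply/orP; left; apply/eqP; congr (_ * _)%E.
by apply: eq_integral => x _; case: (e x); rewrite !(mulr0, mulr1)// expr0n.
Qed.

(** At level [t], cut [u] according to [t < 2 |u|^(1-p)].  Where this fails,
    [|u| <= (t/2) |u|^p], so by the normalisation that part has [L_1] norm at most
    [t/2] and cannot bring [|T u|] above [t]; the other part is controlled by the
    [L_2] bound.  Integrating the resulting bound for the measure of [{|T u| > t}]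
    over [t] gives the [p']-th power integral. *)
Lemma hausdorff_young (p : R) : 1 < p -> p < 2 ->
  exists2 C : R, 0 <= C & forall u, L1r u -> (\int[mu]_x (`|u x| `^ p)%:E <= 1)%E ->
    (\int[mu]_y (`|T u y| `^ (p / (p - 1)))%:E <= C%:E)%E.
Proof.
move=> p1 p2; set p' := p / (p - 1).
have p10 : 0 < p - 1 by lra.
have p'2 : 0 < p' - 2.
  by rewrite /p' subr_gt0 ltr_pdivlMr//; lra.
have p'0 : 0 < p' by lra.
exists (4 * A * p' / (p' - 2) * 2 `^ (p' - 2)).
  by nng.
move=> u iu up; have mu_ := measurable_L1r iu.
have mTu : measurable_fun setT (T u) by exact: measurable_kernel_op.
pose F x := 2 * `|u x| `^ (1 - p).
have F0 x : 0 <= F x by rewrite mulr_ge0 ?powR_ge0.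
have mF : measurable_fun setT F by rewrite /F; mble.
have := @layer_cake _ _ _ mu (cst 1) (fun y => `|T u y|) p' p'0.
under eq_integral do rewrite mul1r.
move=> ->//; last by mble.
have key t : 0 < t -> (\int[mu]_y (1 * (t < `|T u y|)%R%:R)%:E <=
    (4 / t ^+ 2 * A)%:E * \int[mu]_x (u x ^+ 2 * (t < F x)%R%:R)%:E)%E.
  move=> t0; have me : measurable_fun setT (fun x => t < F x) by mble.
  have t40 : 0 <= 4 / t ^+ 2 by rewrite divr_ge0 ?sqr_ge0.
  have mTg : measurable_fun setT (T (fun x => u x * (t < F x)%R%:R)).
    by apply: measurable_kernel_op => //; mble.
  rewrite EFinM -muleA; apply: (le_trans _ (lee_wpmul2l _ (cut_L2 me iu))); last first.
    by rewrite lee_fin.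
  rewrite -integralZl_ge0; [|by mble|by nng|by move=> x; nng].
  apply: le_integral_ge0 => y; first by rewrite lee_fin mul1r.
  rewrite lee_fin mul1r.
  apply: (indicator_le_sqr (b := T (fun x => u x * (~~ (t < F x))%R%:R) y)) => //.
    by rewrite (kernel_op_cut y me iu) addrC ler_normD.
  rewrite -lee_fin; apply: (le_trans (kernel_op_le _ _ _ _)) => //.
    by apply: integrable_cut => //; exact: measurable_neg.
  apply: (@le_trans _ _ ((t / 2)%:E * \int[mu]_x (`|u x| `^ p)%:E)%E); last first.
    by rewrite -[leRHS]mule1 lee_wpmul2l// lee_fin divr_ge0// ltW.
  rewrite -integralZl_ge0; [|by mble|by nng|by move=> x; nng].
  apply: le_integral_ge0 => x; first by rewrite lee_fin.
  rewrite lee_fin -leNgt; case: (leP (F x) t) => Ft; last first.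
    by rewrite mulr0 normr0; nng.
  rewrite mulr1; have [->|u0] := eqVneq (u x) 0.
    by rewrite normr0 mulr_ge0 ?powR_ge0// divr_ge0// ltW.
  rewrite [leLHS](_ : _ = `|u x| `^ (1 - p) * `|u x| `^ p); last first.
    by rewrite -powRD ?subrK ?powRr1// normr_eq0 u0 implybT.
  by rewrite ler_wpM2r ?powR_ge0// ler_pdivlMr// mulrC.
pose c := 4 * A * p' / (p' - 2).
have c0 : 0 <= c by rewrite /c; nng.
apply: (@le_trans _ _ (\int[mu]_x (c * u x ^+ 2 * F x `^ (p' - 2))%:E)%E).
  have := @layer_cake _ _ _ mu (fun x => c * u x ^+ 2) F _ p'2.
  move=> ->; [|by mble|by []|by move=> x; nng|by []].
  apply: le_integral_ge0 => t.
    apply: mule_ge0; last by apply: integral_ge0 => y _; nng.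
    by nng.
  case: (ltP 0 t) => t0; last by rewrite !mul0r !mul0e.
  apply: (le_trans (lee_wpmul2l _ (key t t0))); first by nng.
  under [in leRHS]eq_integral do rewrite -mulrA.
  rewrite integralZl_ge0; [|by mble|by []|by move=> x; nng].
  rewrite !muleA -!EFinM le_eqVlt; apply/orP; left; apply/eqP.
  congr (_%:E * _)%E; rewrite !mul1r.
  have -> : t `^ (p' - 1) = t `^ (p' - 2 - 1) * t ^+ 2.
    rewrite -powR_mulrn; last exact: ltW.
    by rewrite -powRD; [congr powR; lra|rewrite (gt_eqF t0) implybT].
  by rewrite /c; field; rewrite !gt_eqF.
rewrite (_ : \int[mu]_x _ = (c * 2 `^ (p' - 2))%:E * \int[mu]_x (`|u x| `^ p)%:E)%E.
  by rewrite -[leRHS]mule1; apply: lee_wpmul2l => //; nng.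
rewrite -integralZl_ge0; [|by mble|by nng|by move=> x; nng].
apply: eq_integral => x _; congr (_%:E).
rewrite /F powRM; [|by []|by nng].
rewrite -powRrM.
rewrite [LHS](_ : _ = c * 2 `^ (p' - 2) * (u x ^+ 2 * `|u x| `^ ((1 - p) * (p' - 2)))); last by ring.
congr (_ * _).
have [->|u0] := eqVneq (u x) 0.
  by rewrite expr0n mul0r normr0 powR0// gt_eqF//; lra.
rewrite -real_normK ?num_real// -powR_mulrn// -powRD.
  by congr powR; rewrite /p'; field; rewrite gt_eqF.
by rewrite normr_eq0 u0 implybT.
Qed.

End interpolation.

(** * Power weights with a linear volume bound *)

Section weight.
Context d (X : measurableType d) (R : realType).
Variable mu : {sigma_finite_measure set X -> \bar R}.
Local Notation leb := (@lebesgue_measure R).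
Variables (w : X -> R) (V : R).
Hypothesis mw : measurable_fun setT w.
Hypothesis w0 : forall x, 0 <= w x.
Hypothesis V0 : 0 <= V.
Hypothesis wV : forall r, 0 < r -> (mu [set x | (w x < r)%R] <= (V * r)%:E)%E.

Lemma sublevel_le (b : X -> bool) (t : R) : 0 < t ->
  (forall y, b y -> w y <= t) -> (\int[mu]_y ((b y)%:R)%:E <= (2 * V * t)%:E)%E.
Proof.
move=> t0 bt; apply: (@le_trans _ _ (\int[mu]_y ((w y < 2 * t)%R%:R)%:E)%E).
  apply: le_integral_ge0 => y; first by nng.
  rewrite lee_fin; case: (boolP (b y)) => [/bt wt|_]; last by nng.
  by rewrite (_ : w y < 2 * t)//; lra.
rewrite integral_natmulb; last by mble.
by apply: (le_trans (wV _)); [lra|rewrite lee_fin; lra].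
Qed.

(** This estimate and the next are what polar coordinates would give for a power
    of [|x|]; here the volume bound alone yields them, through the layer cake. *)
Lemma weight_tail (b r : R) : 1 < b -> 0 < r ->
  (\int[mu]_y ((r <= w y)%R%:R * w y `^ (- b))%:E <=
   (2 * V * b / (b - 1) * r `^ (1 - b))%:E)%E.
Proof.
move=> b1 r0; have b0 : 0 < b by lra.
have b10 : 0 < b - 1 by lra.
have := @layer_cakeN _ _ _ mu (fun y => (r <= w y)%R%:R) w b b0.
move=> ->; [|by mble|by []|by move=> y; nng|by []].
apply: (@le_trans _ _ (\int[leb]_t
    (2 * V * b * ((r <= t)%R%:R * t `^ (- (b - 1) - 1)))%:E)%E); last first.
  rewrite integralZl_ge0; [|by mble|by nng|by move=> t; nng].
  rewrite integral_powR_ninfty// -EFinM lee_fin opprB le_eqVlt.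
  by apply/orP; left; apply/eqP; field; rewrite gt_eqF.
apply: le_integral_ge0 => t.
  by apply: mule_ge0; [nng|apply: integral_ge0 => y _; nng].
case: (ltP 0 t) => t0; last by rewrite !mul0r !mul0e; nng.
case: (leP r t) => rt; last first.
  rewrite integral0_eq ?mule0; first by nng.
  move=> y _; case: (leP r (w y)) => ry; last by rewrite mul0r.
  by rewrite [X in _ && X]leNgt (lt_le_trans rt ry) andbF mulr0.
rewrite !mul1r; apply: (@le_trans _ _ ((b * t `^ (- b - 1))%:E * (2 * V * t)%:E)%E).
  apply: lee_wpmul2l; first by nng.
  under eq_integral do rewrite -natrM mulnb.
  by apply: sublevel_le => // y /and3P[].
rewrite -EFinM lee_fin (_ : - (b - 1) - 1 = - b - 1 + 1); last by lra.
rewrite (@powRD _ t (- b - 1)) ?(gt_eqF t0) ?implybT// powRr1 ?(ltW t0)//.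
by rewrite le_eqVlt; apply/orP; left; apply/eqP; ring.
Qed.

Lemma weight_near0 (b r : R) : 0 < b -> b < 1 -> 0 < r ->
  (\int[mu]_y ((w y <= r)%R%:R * w y `^ (- b))%:E <=
   (2 * V * b * ((1 - b)^-1 + b^-1) * r `^ (1 - b))%:E)%E.
Proof.
move=> b0 b1 r0.
have b10 : 0 < 1 - b by lra.
have := @layer_cakeN _ _ _ mu (fun y => (w y <= r)%R%:R) w b b0.
move=> ->; [|by mble|by []|by move=> y; nng|by []].
apply: (@le_trans _ _ (\int[leb]_t
    (2 * V * b * (((0 < t) && (t < r))%R%:R * t `^ (1 - b - 1)) +
     2 * V * b * r * ((r <= t)%R%:R * t `^ (- b - 1)))%:E)%E); last first.
  rewrite integralD_ge0; [|by mble|by mble|by move=> t; nng|by move=> t; nng].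
  rewrite !integralZl_ge0; try by [mble|nng|move=> t; nng].
  rewrite integral_powR_ninfty// integral_powR_near0 ?(ltW r0)//.
  rewrite -!EFinM -EFinD lee_fin.
  rewrite (_ : 1 - b = - b + 1); last by lra.
  rewrite (@powRD _ r (- b)) ?(gt_eqF r0) ?implybT// powRr1 ?(ltW r0)//.
  rewrite le_eqVlt; apply/orP; left; apply/eqP; field.
  by rewrite !gt_eqF//; lra.
apply: le_integral_ge0 => t.
  by apply: mule_ge0; [nng|apply: integral_ge0 => y _; nng].
case: (ltP 0 t) => t0; last by rewrite !mul0r !mul0e; nng.
under eq_integral do rewrite -natrM mulnb.
case: (leP r t) => rt; rewrite !mul1r.
  rewrite andbF mul0r mulr0 add0r.
  apply: (@le_trans _ _ ((b * t `^ (- b - 1))%:E * (2 * V * r)%:E)%E).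
    apply: lee_wpmul2l; first by nng.
    by apply: sublevel_le => // y /and3P[].
  by rewrite -EFinM lee_fin le_eqVlt; apply/orP; left; apply/eqP; ring.
rewrite mul0r mulr0 addr0 ?mul1r.
apply: (@le_trans _ _ ((b * t `^ (- b - 1))%:E * (2 * V * t)%:E)%E).
  apply: lee_wpmul2l; first by nng.
  by apply: sublevel_le => // y /and3P[].
rewrite -EFinM lee_fin (_ : 1 - b - 1 = - b - 1 + 1); last by lra.
rewrite (@powRD _ t (- b - 1)) ?(gt_eqF t0) ?implybT// powRr1 ?(ltW t0)//.
by rewrite le_eqVlt; apply/orP; left; apply/eqP; ring.
Qed.

End weight.

(** * Elementary inequalities *)

Section real_inequalities.
Context (R : realType).

Lemma powR_interpolation (a b t : R) : 0 <= a -> 0 <= b -> 0 <= t -> t <= 1 ->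
  a `^ (1 - t) * b `^ t <= a + b.
Proof.
move=> a0 b0 t0 t1; have t10 : 0 <= 1 - t by lra.
apply: (@le_trans _ _ ((a + b) `^ (1 - t) * (a + b) `^ t)).
  have ab : a + b \is Num.nneg by rewrite nnegrE addr_ge0.
  by apply: ler_pM; rewrite ?powR_ge0//; apply: ge0_ler_powR;
    rewrite ?nnegrE ?lerDl ?lerDr.
rewrite -powRD; last by rewrite subrK oner_eq0.
by rewrite subrK powRr1// addr_ge0.
Qed.

(** A convexity inequality with the cheapest constant: every [a i] is at most
   [c i] times the [1/s]-th power of the right-hand side. *)
Lemma powR_sum_weights (M : nat) (a c : 'I_M -> R) (s : R) : 0 < s ->
  (forall i, 0 <= a i) -> (forall i, 0 < c i) -> \sum_(i < M) c i <= 1 ->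
  (\sum_(i < M) a i) `^ s <= \sum_(i < M) (a i / c i) `^ s.
Proof.
move=> s0 a0 c0 c1; set Q := \sum_(i < M) (a i / c i) `^ s.
have Q0 : 0 <= Q by apply: sumr_ge0 => i _; exact: powR_ge0.
have aQ i : a i <= Q `^ s^-1 * c i.
  rewrite -ler_pdivrMr//.
  rewrite -[leLHS]powRr1; last by rewrite divr_ge0// ltW.
  have s1 : s != 0 by rewrite gt_eqF.
  rewrite -[X in _ `^ X](mulfV s1) powRrM.
  apply: ge0_ler_powR; rewrite ?nnegrE ?powR_ge0 ?invr_ge0 ?(ltW s0)//.
  by rewrite /Q (bigD1 i)//= lerDl; apply: sumr_ge0 => j _; exact: powR_ge0.
have aS : \sum_(i < M) a i <= Q `^ s^-1.
  apply: (@le_trans _ _ (\sum_(i < M) Q `^ s^-1 * c i)); first exact: ler_sum.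
  by rewrite -mulr_sumr -[leRHS]mulr1; apply: ler_wpM2l => //; exact: powR_ge0.
have -> : Q = (Q `^ s^-1) `^ s by rewrite -powRrM mulVf ?gt_eqF// powRr1.
by apply: ge0_ler_powR; rewrite ?nnegrE ?powR_ge0 ?sumr_ge0 ?(ltW s0).
Qed.

Lemma powR_sum_le (M : nat) (a : 'I_M -> R) (t B : R) : 1 <= t -> 0 < B ->
  (forall i, 0 <= a i) -> \sum_(i < M) a i <= B ->
  \sum_(i < M) a i `^ t <= B `^ t.
Proof.
move=> t1 B0 a0 aB; have aiB i : a i <= B.
  by apply: le_trans aB; rewrite (bigD1 i)//= lerDl; exact: sumr_ge0.
apply: (@le_trans _ _ (\sum_(i < M) B `^ (t - 1) * a i)).
  apply: ler_sum => i _; have [->|ai] := eqVneq (a i) 0.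
    by rewrite powR0 ?mulr0//; apply/eqP; lra.
  have ai0 : 0 < a i by rewrite lt_def ai a0.
  rewrite -(mulr_powRB1 (a0 i)); last by lra.
  rewrite mulrC; apply: ler_wpM2r => //.
  by apply: ge0_ler_powR; rewrite ?nnegrE ?(ltW B0)//; lra.
rewrite -mulr_sumr; apply: (@le_trans _ _ (B `^ (t - 1) * B)).
  by rewrite ler_wpM2l ?powR_ge0.
by rewrite mulrC mulr_powRB1// ?(ltW B0)//; lra.
Qed.

End real_inequalities.

(** * Paley's inequality *)

Section paley.
Context d (X : measurableType d) (R : realType).
Variable mu : {sigma_finite_measure set X -> \bar R}.
Variable K : X -> X -> R.
Hypothesis mK : measurable_fun setT (fun z : X * X => K z.1 z.2).
Hypothesis K1 : forall x y, `|K x y| <= 1.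
Local Notation T := (kernel_op mu K).
Local Notation L1r u := (mu.-integrable setT (EFin \o (u : X -> R))).
Local Notation leb := (@lebesgue_measure R).
Variable A : R.
Hypothesis A0 : 0 <= A.
Hypothesis L2 : forall u, L1r u ->
  (\int[mu]_y (T u y ^+ 2)%:E <= A%:E * \int[mu]_x (u x ^+ 2)%:E)%E.
Variables (w : X -> R) (V : R).
Hypothesis mw : measurable_fun setT w.
Hypothesis w0 : forall x, 0 <= w x.
Hypothesis V0 : 0 <= V.
Hypothesis wV : forall r, 0 < r -> (mu [set x | (w x < r)%R] <= (V * r)%:E)%E.

Let powRN2 (x : R) : 0 <= x -> x `^ (- 2) * x ^+ 2 <= 1.
Proof.
rewrite le_eqVlt => /predU1P[<-|x0]; first by rewrite expr0n mulr0.
by rewrite -powR_mulrn ?(ltW x0)// -powRD ?(gt_eqF x0) ?implybT// addNr powRr0.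
Qed.

(** A weak-type estimate for [y |-> w y * T u y] and the measure [w^-2 mu].  The
    part of [u] above the level [t] has a bounded transform, so it matters only
    where [w] is large, and there [w^-2] has small mass; the part below is
    estimated in [L_2], where the two weights cancel. *)
Lemma paley_level (u : X -> R) (t : R) : L1r u -> 0 < t ->
  (\int[mu]_y (w y `^ (- 2) * (t < w y * `|T u y|)%R%:R)%:E <=
   (8 * V / t)%:E * \int[mu]_x (`|u x| * (t < `|u x|)%R%:R)%:E +
   (4 / t ^+ 2 * A)%:E * \int[mu]_x (u x ^+ 2 * (`|u x| <= t)%R%:R)%:E)%E.
Proof.
move=> iu t0; have mu_ := measurable_L1r iu.
have me : measurable_fun setT (fun x => `|u x| <= t) by mble.
have me' : measurable_fun setT (fun x => ~~ (`|u x| <= t)) by mble.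
have ib : L1r (fun x => u x * (~~ (`|u x| <= t))%:R) by exact: integrable_cut.
pose B := (\int[mu]_x (`|u x| * (t < `|u x|)%R%:R))%R.
have BE : (\int[mu]_x (`|u x| * (t < `|u x|)%R%:R)%:E = B%:E)%E.
  rewrite /B /Rintegral fineK//; apply: integrable_fin_num => //.
  apply: (integrable_dominated iu) => [|x]; first by mble.
  by case: (ltP t); rewrite ?mulr1 ?normr_id// mulr0 normr0.
have B0 : 0 <= B by apply: Rintegral_ge0 => x _; nng.
have bB y : `|T (fun x => u x * (~~ (`|u x| <= t))%:R) y| <= B.
  rewrite -lee_fin -BE; apply: (le_trans (kernel_op_le mK K1 y ib)).
  apply: le_integral_ge0 => x; first by nng.
  by rewrite lee_fin normrM ltNge [X in _ * X]ger0_norm.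
have mg : measurable_fun setT (T (fun x => u x * (`|u x| <= t)%R%:R)).
  by apply: measurable_kernel_op => //; mble.
apply: (@le_trans _ _ (\int[mu]_y ((t / 2 <= w y * B)%R%:R * w y `^ (- 2) +
    4 / t ^+ 2 * (T (fun x => u x * (`|u x| <= t)%R%:R) y) ^+ 2)%:E)%E).
  apply: le_integral_ge0 => y; first by nng.
  rewrite lee_fin; have w2 := powR_ge0 (w y) (- 2).
  have c0 : 0 <= 4 / t ^+ 2 * T (fun x => u x * (`|u x| <= t)%R%:R) y ^+ 2 by nng.
  have [tB|tB] := leP (t / 2) (w y * B).
    rewrite mul1r; apply: (@le_trans _ _ (w y `^ (- 2))); last by rewrite lerDl.
    by case: (_ < _)%R; rewrite ?mulr1 ?mulr0.
  rewrite mul0r add0r.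
  have h : (t < w y * `|T u y|)%R%:R <=
      4 / t ^+ 2 * (w y * T (fun x => u x * (`|u x| <= t)%R%:R) y) ^+ 2.
    rewrite -(ger0_norm (w0 y)) -normrM.
    apply: (indicator_le_sqr
      (b := w y * T (fun x => u x * (~~ (`|u x| <= t))%R%:R) y)) => //.
      rewrite ger0_norm// (kernel_op_cut mK K1 y me iu) mulrDr addrC.
      exact: ler_normD.
    rewrite normrM ger0_norm//; apply: le_trans (ltW tB).
    by rewrite ler_wpM2l.
  apply: (le_trans (ler_wpM2l w2 h)).
  rewrite [leLHS](_ : _ = (w y `^ (- 2) * w y ^+ 2) *
     (4 / t ^+ 2 * T (fun x => u x * (`|u x| <= t)%R%:R) y ^+ 2)); last by ring.
  by rewrite -[leRHS]mul1r; apply: ler_wpM2r => //; exact: powRN2.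
rewrite integralD_ge0; [|by mble|by mble|by move=> y; nng|by move=> y; nng].
apply: leeD.
  have := B0; rewrite BE le_eqVlt => /predU1P[<-|Bgt0].
    rewrite mule0 integral0_eq// => y _.
    by rewrite mulr0 leNgt divr_gt0// mul0r.
  under eq_integral do rewrite -ler_pdivrMr//.
  apply: (le_trans (weight_tail mw w0 V0 wV _ _)); [lra|by rewrite !divr_gt0|].
  rewrite -EFinM lee_fin (_ : 1 - 2 = -1); last by lra.
  rewrite powR_inv1; last by rewrite ltW ?divr_gt0.
  rewrite le_eqVlt; apply/orP; left; apply/eqP.
  by field; rewrite !gt_eqF.
rewrite EFinM -muleA integralZl_ge0; [|by mble|by nng|by move=> y; nng].
by apply: lee_wpmul2l; [nng|exact: cut_L2].
Qed.

(** Marcinkiewicz interpolation from [paley_level], the level at which [u] is cut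
    being the level of the distribution function. *)
Lemma paley (p : R) : 1 < p -> p < 2 ->
  exists2 C : R, 0 <= C & forall u, L1r u -> (\int[mu]_x (`|u x| `^ p)%:E <= 1)%E ->
    (\int[mu]_y (w y `^ (p - 2) * `|T u y| `^ p)%:E <= C%:E)%E.
Proof.
move=> p1 p2.
have p0 : 0 < p by lra.
have p10 : 0 < p - 1 by lra.
have p20 : 0 < 2 - p by lra.
pose c1 := 8 * V * p / (p - 1).
pose c2 := 4 * A * p / (2 - p).
have c10 : 0 <= c1 by rewrite /c1; nng.
have c20 : 0 <= c2 by rewrite /c2; nng.
exists (c1 + c2); first by nng.
move=> u iu up; have mu_ := measurable_L1r iu.
have mTu : measurable_fun setT (T u) by exact: measurable_kernel_op.
rewrite (_ : \int[mu]_y _ = \int[mu]_y (w y `^ (- 2) * (w y * `|T u y|) `^ p)%:E)%E; last first.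
  apply: eq_integral => y _; congr (_%:E); rewrite powRM// mulrA; congr (_ * _).
  have := w0 y; rewrite le_eqVlt => /predU1P[<-|wy].
    by rewrite !powR0 ?mul0r ?mulr0 //; apply/eqP; lra.
  by rewrite -powRD ?(gt_eqF wy) ?implybT// addrC.
have := @layer_cake _ _ _ mu (fun y => w y `^ (- 2)) (fun y => w y * `|T u y|) p p0.
move=> ->; [|by mble|by mble|by move=> y; nng|by move=> y; nng].
pose J1 t := (\int[mu]_x (c1 * `|u x| * (t < `|u x|)%R%:R)%:E)%E.
pose J2 t := (\int[mu]_x (c2 * u x ^+ 2 * ((0 < `|u x|) && (`|u x| <= t))%R%:R)%:E)%E.
pose f1 (t : measurableTypeR R) := (((0 < t)%R%:R * ((p - 1) * t `^ (p - 1 - 1)))%:E * J1 t)%E.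
pose f2 (t : measurableTypeR R) := (((0 < t)%R%:R * ((2 - p) * t `^ (- (2 - p) - 1)))%:E * J2 t)%E.
have f10 t : (0 <= f1 t)%E.
  by apply: mule_ge0; [nng|apply: integral_ge0 => x _; nng].
have f20 t : (0 <= f2 t)%E.
  by apply: mule_ge0; [nng|apply: integral_ge0 => x _; nng].
have mf1 : measurable_fun setT f1.
  apply: emeasurable_funM; first by mble.
  apply: (@measurable_fun_fubini_tonelli_G _ _ _ _ _ mu
    (fun z : X * measurableTypeR R => (c1 * `|u z.1| * (z.2 < `|u z.1|)%R%:R)%:E)).
    by mble.
  by move=> z; nng.
have mf2 : measurable_fun setT f2.
  apply: emeasurable_funM; first by mble.
  apply: (@measurable_fun_fubini_tonelli_G _ _ _ _ _ mu
    (fun z : X * measurableTypeR R => (c2 * u z.1 ^+ 2 * ((0 < `|u z.1|) && (`|u z.1| <= z.2))%R%:R)%:E)).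
    by mble.
  by move=> z; nng.
apply: (@le_trans _ _ (\int[leb]_t (f1 t + f2 t))%E).
  apply: le_integral_ge0 => t.
    by apply: mule_ge0; [nng|apply: integral_ge0 => y _; nng].
  rewrite /f1 /f2; case: (ltP 0 t) => t0; last by rewrite !mul0r !mul0e adde0.
  apply: (le_trans (lee_wpmul2l _ (paley_level iu t0))); first by nng.
  rewrite ge0_muleDr; last 2 first.
  - by apply: mule_ge0; [nng|apply: integral_ge0 => x _; nng].
  - by apply: mule_ge0; [nng|apply: integral_ge0 => x _; nng].
  rewrite /J1 /J2; under [X in (_ <= _ * X + _)%E]eq_integral do rewrite -mulrA.
  under [X in (_ <= _ + _ * X)%E]eq_integral do rewrite -mulrA.
  rewrite !integralZl_ge0; try by [mble|nng|move=> x; nng].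
  rewrite !muleA -!EFinM !mul1r; apply: leeD.
    rewrite le_eqVlt; apply/orP; left; apply/eqP; congr (_%:E * _)%E.
    have -> : t `^ (p - 1) = t `^ (p - 1 - 1) * t.
      rewrite -[X in _ = _ * X]powRr1 ?ltW// -powRD ?(gt_eqF t0) ?implybT//.
      by congr powR; lra.
    by rewrite /c1; field; rewrite !gt_eqF.
  rewrite (_ : _ * _ * _ = (2 - p) * t `^ (- (2 - p) - 1) * c2)%R; last first.
    have -> : t `^ (p - 1) = t `^ (- (2 - p) - 1) * t ^+ 2.
      rewrite -powR_mulrn ?ltW// -powRD ?(gt_eqF t0) ?implybT//.
      by congr powR; lra.
    by rewrite /c2; field; rewrite !gt_eqF.
  apply: lee_wpmul2l; first by nng.
  apply: le_integral_ge0 => x; first by nng.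
  rewrite lee_fin; have [->|u0] := eqVneq (u x) 0; first by rewrite expr0n !mul0r.
  by rewrite normr_gt0 u0.
rewrite (_ : (c1 + c2)%:E = c1%:E * 1 + c2%:E * 1)%E; last by rewrite !mule1.
rewrite ge0_integralD//; apply: leeD.
  have := @layer_cake _ _ _ mu (fun x => c1 * `|u x|) (fun x => `|u x|) _ p10.
  move=> <-; [|by mble|by mble|by move=> y; nng|by []].
  apply: le_trans (lee_wpmul2l _ up); last by nng.
  rewrite -integralZl_ge0; [|by mble|by nng|by move=> x; nng].
  apply: le_integral_ge0 => x; first by nng.
  by rewrite lee_fin -mulrA mulr_powRB1.
have := @layer_cakeN _ _ _ mu (fun x => c2 * u x ^+ 2) (fun x => `|u x|) _ p20.
move=> <-; [|by mble|by mble|by move=> y; nng|by []].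
apply: le_trans (lee_wpmul2l _ up); last by nng.
rewrite -integralZl_ge0; [|by mble|by nng|by move=> x; nng].
apply: le_integral_ge0 => x; first by nng.
rewrite lee_fin -mulrA ler_wpM2l//.
have [->|u0] := eqVneq (u x) 0; first by rewrite expr0n mul0r; nng.
rewrite -real_normK ?num_real// -powR_mulrn// -powRD ?normr_eq0 ?u0 ?implybT//.
by rewrite (_ : 2 + - (2 - p) = p)//; lra.
Qed.

(** * Unweighted input: between Hausdorff-Young and Paley *)

Local Notation pitt := (pitt mu K w).

Lemma pitt_scale (p s a g C : R) : pitt p s a g C ->
  forall c u, 0 < c -> L1r u ->
  (\int[mu]_x ((w x `^ g * `|u x|) `^ p)%:E <= (c `^ p)%:E)%E ->
  (\int[mu]_y ((w y `^ (- a) * `|T u y|) `^ s)%:E <= (c `^ s * C)%:E)%E.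
Proof.
move=> H c u c0 iu up; have mu_ := measurable_L1r iu.
have ci0 : 0 <= c^-1 by rewrite invr_ge0 ltW.
have iv : L1r (fun x => c^-1 * u x) by exact: (integrableZl measurableT _ iu).
have mTu : measurable_fun setT (T u) by exact: measurable_kernel_op.
have := H _ iv.
rewrite (_ : \int[mu]_x _ = (c^-1 `^ p)%:E * \int[mu]_x ((w x `^ g * `|u x|) `^ p)%:E)%E; last first.
  rewrite -integralZl_ge0; [|by mble|by nng|by move=> x; nng].
  apply: eq_integral => x _; congr (_%:E).
  by rewrite normrM (ger0_norm ci0) mulrCA [LHS]powRM; nng.
rewrite (_ : \int[mu]_y ((w y `^ (- a) * `|T (fun x => c^-1 * u x) y|) `^ s)%:E =
  (c^-1 `^ s)%:E * \int[mu]_y ((w y `^ (- a) * `|T u y|) `^ s)%:E)%E; last first.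
  rewrite -integralZl_ge0; [|by mble|by nng|by move=> x; nng].
  apply: eq_integral => x _; congr (_%:E); rewrite kernel_opZ//.
  by rewrite normrM (ger0_norm ci0) mulrCA [LHS]powRM; nng.
have cK (e : R) : c^-1 `^ e * c `^ e = 1.
  by rewrite -powRM ?(ltW c0)// mulVf ?gt_eqF// powR1.
have c1 : ((c^-1 `^ p)%:E * \int[mu]_x ((w x `^ g * `|u x|) `^ p)%:E <= 1)%E.
  apply: le_trans (lee_wpmul2l _ up) _; first by nng.
  by rewrite -EFinM cK.
move=> /(_ c1) h; have := lee_wpmul2l (_ : (0 <= (c `^ s)%:E)%E) h.
rewrite muleA -!EFinM -powRM ?(ltW c0)// mulfV ?gt_eqF// powR1 mul1e; apply.
by nng.
Qed.

(** For [p <= s <= p'] the integrand is a geometric mean of those of the two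
    extreme cases.  When [p = 2] they coincide and the [L_2] bound is used. *)
Lemma pitt_diag (p s : R) : 1 < p -> p <= s -> s <= p / (p - 1) ->
  exists2 C : R, 0 <= C & pitt p s (s^-1 - (1 - p^-1)) 0 C.
Proof.
move=> p1 ps sp'.
have p0 : 0 < p by lra.
have p10 : 0 < p - 1 by lra.
have s0 : 0 < s by lra.
have p2 : p <= 2.
  have : p * (p - 1) <= p by rewrite -ler_pdivlMr// (le_trans ps).
  by rewrite -[leRHS]mulr1 ler_pM2l//; lra.
have norm1 (u : X -> R) : (\int[mu]_x ((w x `^ 0 * `|u x|) `^ p)%:E =
    \int[mu]_x (`|u x| `^ p)%:E)%E.
  by apply: eq_integral => x _; rewrite powRr0 mul1r.
have [p2' |p2'] := ltP p 2; last first.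
  have pE : p = 2 by lra.
  have sE : s = 2.
    by move: sp' ps; rewrite ler_pdivlMr// pE; lra.
  exists A => // u iu; rewrite norm1 pE sE.
  rewrite (_ : - _ = 0); last by lra.
  under eq_integral do rewrite powR_mulrn// real_normK ?num_real//.
  move=> up; under eq_integral do rewrite powRr0 mul1r powR_mulrn// real_normK ?num_real//.
  by apply: (le_trans (L2 iu)); rewrite -[leRHS]mule1; apply: lee_wpmul2l.
have [C1 C10 HY] := hausdorff_young mK K1 A0 L2 p1 p2'.
have [C2 C20 PA] := paley p1 p2'.
exists (C2 + C1); first by nng.
move=> u iu; rewrite norm1 => up; have mu_ := measurable_L1r iu.
have mTu : measurable_fun setT (T u) by exact: measurable_kernel_op.
rewrite EFinD; apply: le_trans (leeD (PA u iu up) (HY u iu up)).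
rewrite -integralD_ge0; [|by mble|by mble|by move=> x; nng|by move=> x; nng].
apply: le_integral_ge0 => y; first by nng.
rewrite lee_fin powRM; [|by nng|by nng]; rewrite -powRrM.
set p' := p / (p - 1) in sp' *.
have [sE|sp'2] := eqVneq s p'.
  rewrite (_ : - _ * s = 0); last by rewrite sE /p'; field; rewrite !gt_eqF.
  by rewrite powRr0 mul1r sE lerDr; nng.
have p'p : 0 < p' - p.
  by rewrite subr_gt0 (le_lt_trans ps)// lt_neqAle sp'2.
have [Tu0|Tu0] := eqVneq (T u y) 0.
  by rewrite Tu0 normr0 powR0 ?gt_eqF// mulr0; nng.
have := w0 y; rewrite le_eqVlt => /predU1P[wy|wy].
  rewrite -wy powR0 ?mul0r; first by nng.
  apply: contra sp'2 => /eqP; rewrite mulNr mulrBl mulVf ?(gt_eqF s0)// => h.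
  apply/eqP; rewrite /p'; apply: (mulfI (_ : 1 - p^-1 != 0)).
    by rewrite subr_eq0 eq_sym invr_eq1 gt_eqF.
  rewrite (_ : (1 - p^-1) * (p / (p - 1)) = 1); last by field; rewrite !gt_eqF.
  by lra.
pose t := (s - p) / (p' - p).
have t0 : 0 <= t by apply: divr_ge0; [lra|exact: ltW].
have t1 : t <= 1 by rewrite /t ler_pdivrMr// mul1r lerD2r.
apply: le_trans (powR_interpolation _ _ t0 t1); [|by nng|by nng].
rewrite powRM; [|by nng|by nng]; rewrite -!powRrM -mulrA.
rewrite -powRD ?normr_eq0 ?(negbTE Tu0) ?implybT//.
rewrite le_eqVlt; apply/orP; left; apply/eqP.
have pp : p' - p = p * (2 - p) / (p - 1) by rewrite /p'; field; rewrite gt_eqF.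
have p20 : 0 < 2 - p by lra.
congr (_ `^ _ * _ `^ _).
  by rewrite /t pp /p'; field; rewrite !gt_eqF.
by rewrite /t; field; rewrite gt_eqF.
Qed.

End paley.

(** * Weighted input: dyadic shells *)

Section fatou_eventually.
Context d (X : measurableType d) (R : realType) (mu : {measure set X -> \bar R}).

Lemma fatou_eventually (f : nat -> X -> R) (g : X -> R) (C : \bar R) :
  (forall n, measurable_fun setT (f n)) -> (forall n x, 0 <= f n x) ->
  (forall x, 0 <= g x) ->
  (forall x, exists N, forall n, (N <= n)%N -> g x <= f n x) ->
  (forall n, (\int[mu]_x (f n x)%:E <= C)%E) -> (\int[mu]_x (g x)%:E <= C)%E.
Proof.
move=> mf f0 g0 gf fC.
apply: (@le_trans _ _ (\int[mu]_x limn_einf (fun n => (f n x)%:E))%E).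
  apply: le_integral_ge0 => x; first by nng.
  rewrite limn_einf_lim; apply: lime_ge; first exact: is_cvg_einfs.
  have [N gN] := gf x; exists N => // n /= Nn.
  by apply: le_ereal_inf_tmp => _ [m /= nm <-]; rewrite lee_fin gN// (leq_trans Nn).
apply: (le_trans (fatou mu measurableT _ _)).
- by move=> n; exact/measurable_EFinP.
- by move=> n x _; nng.
rewrite limn_einf_lim; apply: lime_le; first exact: is_cvg_einfs.
apply: nearW => n; apply: le_trans (fC n).
by apply: ereal_inf_lbound; exists n => /=.
Qed.

End fatou_eventually.

Section dyadic_weights.
Context (R : realType).

(** Differences of the bounded increasing function [z / (1 + z)] along a
    geometric progression: they telescope, yet decay only geometrically. *)
Lemma telescoping_weight (rho z : R) : 1 < rho -> 0 < z ->
  let c := rho * z / (1 + rho * z) - z / (1 + z) in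
  0 < c /\ c^-1 <= 4 * rho / (rho - 1) * (z + z^-1).
Proof.
move=> r1 z0 c; have r0 : 0 < rho by lra.
have rz0 : 0 < rho * z by exact: mulr_gt0.
have r10 : 0 < rho - 1 by lra.
have cE : c = (rho - 1) * z / ((1 + rho * z) * (1 + z)).
  by rewrite /c; field; rewrite !gt_eqF//; lra.
have c0 : 0 < c.
  by rewrite cE; apply: divr_gt0; apply: mulr_gt0 => //; lra.
split=> //.
have -> : c^-1 = (z^-1 + 1 + rho + rho * z) / (rho - 1).
  by rewrite cE; field; rewrite !gt_eqF//; lra.
rewrite mulrAC; apply: ler_wpM2r; first by rewrite invr_ge0 ltW.
have zi0 : 0 < z^-1 by rewrite invr_gt0.
have zz : z * z^-1 = 1 by rewrite mulfV ?gt_eqF.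
have z2 : 2 <= z + z^-1.
  rewrite -subr_ge0 (_ : _ - _ = (z - 1) ^+ 2 / z); last by field; rewrite gt_eqF.
  by nng.
by nra.
Qed.

End dyadic_weights.

Section pitt_shells.
Context d (X : measurableType d) (R : realType).
Variable mu : {sigma_finite_measure set X -> \bar R}.
Variable K : X -> X -> R.
Hypothesis mK : measurable_fun setT (fun z : X * X => K z.1 z.2).
Hypothesis K1 : forall x y, `|K x y| <= 1.
Local Notation T := (kernel_op mu K).
Local Notation L1r u := (mu.-integrable setT (EFin \o (u : X -> R))).
Variables (w : X -> R) (V : R).
Hypothesis mw : measurable_fun setT w.
Hypothesis w0 : forall x, 0 <= w x.
Hypothesis V0 : 0 <= V.
Hypothesis wV : forall r, 0 < r -> (mu [set x | (w x < r)%R] <= (V * r)%:E)%E.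
Local Notation pitt := (pitt mu K w).

(** Hoelder's inequality on a shell of volume [O(r)]: cutting [|v|] at the level
    [m] makes both parts of the same order. *)
Lemma annulus_L1 (p g r h : R) (v : X -> R) : 1 < p -> 0 <= g -> 0 < r -> 0 < h ->
  L1r v -> (forall x, v x != 0 -> r <= w x /\ w x < 2 * r) ->
  (\int[mu]_x ((w x `^ g * `|v x|) `^ p)%:E <= (h `^ p)%:E)%E ->
  (\int[mu]_x `|v x|%:E <= ((2 * V + 1) * h * r `^ (1 - p^-1 - g))%:E)%E.
Proof.
move=> p1 g0 r0 h0 iv sv vp; have mv := measurable_L1r iv.
have p0 : 0 < p by lra.
have p10 : 0 < p - 1 by lra.
have nz e : r `^ e != 0 by rewrite gt_eqF ?powR_gt0.
pose m := h * r `^ (- g - p^-1).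
have m0 : 0 < m by rewrite /m mulr_gt0 ?powR_gt0.
pose k := m `^ (p - 1) * r `^ (g * p).
have k0 : 0 < k by rewrite /k mulr_gt0 ?powR_gt0.
apply: (@le_trans _ _ (\int[mu]_x (m * (w x < 2 * r)%R%:R +
    k^-1 * (w x `^ g * `|v x|) `^ p)%:E)%E).
  apply: le_integral_ge0 => x; first by nng.
  rewrite lee_fin; have k2 : 0 <= k^-1 * (w x `^ g * `|v x|) `^ p by nng.
  have [->|vx] := eqVneq (v x) 0; first by rewrite normr0; nng.
  have [rw wr] := sv _ vx; rewrite wr mulr1.
  have [vm|/ltW mv'] := leP `|v x| m; first by lra.
  apply: (@le_trans _ _ (k^-1 * (w x `^ g * `|v x|) `^ p)); last by lra.
  rewrite mulrC ler_pdivlMr// powRM; [|by nng|by nng].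
  rewrite -powRrM -(mulr_powRB1 (normr_ge0 _) p0) /k.
  rewrite [leLHS](_ : _ = r `^ (g * p) * (`|v x| * m `^ (p - 1))); last by ring.
  apply: ler_pM; [by nng|by nng| |].
    by apply: ge0_ler_powR; rewrite ?nnegrE ?mulr_ge0 ?(ltW r0) ?(ltW p0).
  apply: ler_wpM2l => //.
  by apply: ge0_ler_powR; rewrite ?nnegrE ?(ltW m0) ?(ltW p10).
rewrite integralD_ge0; [|by mble|by mble|by move=> y; nng|by move=> y; nng].
rewrite !integralZl_ge0; try by [mble|nng|move=> x; nng].
rewrite integral_natmulb; last by mble.
apply: (@le_trans _ _ (m%:E * (V * (2 * r))%:E + k^-1%:E * (h `^ p)%:E)%E).
  apply: leeD; apply: lee_wpmul2l => //; do ?nng.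
  by apply: wV; lra.
rewrite -!EFinM -EFinD lee_fin le_eqVlt; apply/orP; left; apply/eqP.
have e1 : m * r = h * r `^ (1 - p^-1 - g).
  rewrite /m -mulrA; congr (_ * _); rewrite -[X in _ * X](powRr1 (ltW r0)).
  rewrite -powRD ?(gt_eqF r0) ?implybT//; congr powR; lra.
have e2 : k^-1 * h `^ p = h * r `^ (1 - p^-1 - g).
  apply: (mulfI (_ : k != 0)); first by rewrite gt_eqF.
  rewrite mulVKf ?gt_eqF// /k /m powRM ?(ltW h0) ?powR_ge0// -powRrM.
  rewrite [RHS](_ : _ = h * h `^ (p - 1) * (r `^ ((- g - p^-1) * (p - 1)) *
    r `^ (g * p) * r `^ (1 - p^-1 - g))); last by ring.
  rewrite (mulr_powRB1 (ltW h0) p0) -!powRD ?(gt_eqF r0) ?implybT//.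
  rewrite (_ : _ + _ = 0) ?powRr0 ?mulr1//.
  by field; rewrite gt_eqF.
by rewrite e2 -[RHS]mulrA -e1; ring.
Qed.

Variables p s g a e C0 : R.
Local Notation d0 := (s^-1 - (1 - p^-1)).
Hypotheses (p1 : 1 < p) (ps : p <= s) (g0 : 0 < g) (d00 : 0 <= d0).
Hypotheses (aE : a = d0 + g) (e0 : 0 < e) (eg : e <= g) (ea : (a + e) * s < 1).
Hypotheses (C00 : 0 <= C0) (H0 : pitt p s d0 0 C0).

Let s0 : 0 < s. Proof. by move: p1 ps; lra. Qed.
Let p0 : 0 < p. Proof. by move: p1; lra. Qed.
Let a0 : 0 < a. Proof. by rewrite aE; move: d00 g0; lra. Qed.

(** Below the critical level [w = 1/r] the trivial bound is used, above it the
    unweighted inequality; both have room for the factor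
    [(r w)^e + (r w)^-e]. *)
Lemma pitt_annulus : exists2 C : R, 0 <= C & forall (r h : R) (v : X -> R),
  0 < r -> 0 < h -> L1r v -> (forall x, v x != 0 -> r <= w x /\ w x < 2 * r) ->
  (\int[mu]_x ((w x `^ g * `|v x|) `^ p)%:E <= (h `^ p)%:E)%E ->
  (\int[mu]_y ((w y `^ (- a) * ((r * w y) `^ e + ((r * w y) `^ e)^-1) *
      `|T v y|) `^ s)%:E <= (C * h `^ s)%:E)%E.
Proof.
pose b := (a + e) * s.
have b0 : 0 < b by rewrite /b mulr_gt0// addr_gt0.
pose C1 := 2 * V * b * ((1 - b)^-1 + b^-1).
have C10 : 0 <= C1.
  have b1 : 0 <= 1 - b by rewrite subr_ge0 ltW.
  by rewrite /C1; nng.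
exists (2 `^ s * (C1 * (2 * V + 1) `^ s + C0)); first by nng.
move=> r h v r0 h0 iv sv vp; have mv := measurable_L1r iv.
have mTv : measurable_fun setT (T v) by exact: measurable_kernel_op.
pose B := (2 * V + 1) * h * r `^ (1 - p^-1 - g).
have B0 : 0 <= B by rewrite /B; nng.
have vB y : `|T v y| <= B.
  rewrite -lee_fin; apply: (le_trans (kernel_op_le mK K1 y iv)).
  by apply: annulus_L1 => //; exact: ltW.
have key y : (w y `^ (- a) * ((r * w y) `^ e + ((r * w y) `^ e)^-1) * `|T v y|) `^ s <=
    2 `^ s * ((r `^ (- e) * B) `^ s * ((w y <= r^-1)%R%:R * w y `^ (- b)) +
    (r `^ g) `^ s * (w y `^ (- d0) * `|T v y|) `^ s).
  have rhs0 : 0 <= (r `^ g) `^ s * (w y `^ (- d0) * `|T v y|) `^ s by nng.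
  have rhs1 : 0 <= (r `^ (- e) * B) `^ s * ((w y <= r^-1)%R%:R * w y `^ (- b)) by nng.
  have := w0 y; rewrite le_eqVlt => /predU1P[wy|wy].
    rewrite -[in leLHS]wy powR0 ?oppr_eq0 ?gt_eqF// !mul0r powR0 ?gt_eqF//.
    by apply: mulr_ge0; [nng|lra].
  have rw0 : 0 < r * w y by exact: mulr_gt0.
  set z := (r * w y) `^ e.
  have z0 : 0 < z by exact: powR_gt0.
  have zi : 0 < z^-1 by rewrite invr_gt0.
  have [wr|wr] := leP (w y) r^-1.
    have rw1 : r * w y <= 1 by rewrite -ler_pdivlMl// mulr1.
    have z1 : z <= 1.
      have <- : 1 `^ e = 1 by rewrite powR1.
      by apply: ge0_ler_powR; rewrite ?nnegrE ?(ltW e0) ?(ltW rw0).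
    have z2 : z + z^-1 <= 2 * z^-1.
      have : 1 <= z^-1 by rewrite invf_ge1.
      by lra.
    rewrite mul1r; apply: (@le_trans _ _ ((2 * (r `^ (- e) * B * w y `^ (- (a + e)))) `^ s)).
      apply: ge0_ler_powR; rewrite ?nnegrE ?(ltW s0)//; [by nng|by nng|].
      rewrite [leRHS](_ : _ = w y `^ (- a) * (2 * z^-1) * B); last first.
        rewrite /z -powRN powRM ?(ltW r0) ?(ltW wy)// opprD powRD ?(gt_eqF wy) ?implybT//.
        by ring.
      by apply: ler_pM; [nng|nng|apply: ler_wpM2l => //; nng|exact: vB].
    rewrite powRM; [|by nng|by nng]; apply: ler_wpM2l; first by nng.
    rewrite powRM; [|by nng|by nng]; rewrite -[in leLHS]powRrM mulNr -/b.
    by rewrite lerDl.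
  have rw1 : 1 <= r * w y by rewrite -ler_pdivrMl// mulr1 ltW.
  have z1 : 1 <= z.
    have <- : 1 `^ e = 1 by rewrite powR1.
    by apply: ge0_ler_powR; rewrite ?nnegrE ?(ltW e0) ?(ltW rw0).
  have z2 : z + z^-1 <= 2 * z.
    have : z^-1 <= 1 by rewrite invf_le1.
    by lra.
  rewrite mul0r mulr0 add0r -powRM; [|by nng|by nng].
  rewrite -powRM; [|by nng|by nng].
  apply: ge0_ler_powR; rewrite ?nnegrE ?(ltW s0)//; [by nng|by nng|].
  rewrite !mulrA; apply: ler_wpM2r; first by nng.
  apply: (@le_trans _ _ (w y `^ (- a) * (2 * z))); first by apply: ler_wpM2l => //; nng.
  rewrite aE opprD powRD ?(gt_eqF wy) ?implybT//.
  rewrite [leLHS](_ : _ = 2 * (w y `^ (- g) * z) * w y `^ (- d0)); last by ring.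
  apply: ler_wpM2r; first by nng.
  apply: ler_wpM2l => //; rewrite powRN ler_pdivrMl ?powR_gt0//.
  rewrite mulrC -powRM ?(ltW r0) ?(ltW wy)//.
  by apply: ler_powR.
have e1 : (\int[mu]_y ((w y <= r^-1)%R%:R * w y `^ (- b))%:E <=
   (C1 * (r^-1) `^ (1 - b))%:E)%E.
  by apply: weight_near0 => //; rewrite invr_gt0.
have e2 : (\int[mu]_y ((w y `^ (- d0) * `|T v y|) `^ s)%:E <=
    ((r `^ (- g) * h) `^ s * C0)%:E)%E.
  apply: (pitt_scale mK K1 mw H0) => //; first by rewrite mulr_gt0 ?powR_gt0.
  apply: (@le_trans _ _ ((r `^ (- g) `^ p)%:E *
      \int[mu]_x ((w x `^ g * `|v x|) `^ p)%:E)%E).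
    rewrite -integralZl_ge0; [|by mble|by nng|by move=> x; nng].
    apply: le_integral_ge0 => x; first by nng.
    rewrite lee_fin -powRM; [|by nng|by nng].
    apply: ge0_ler_powR; rewrite ?nnegrE ?(ltW p0)//; [by nng|by nng|].
    rewrite powRr0 mul1r mulrA; have [->|vx] := eqVneq (v x) 0.
      by rewrite normr0 mulr0.
    rewrite -[leLHS]mul1r; apply: ler_wpM2r => //.
    have [rw _] := sv _ vx.
    rewrite powRN ler_pdivlMl ?powR_gt0// mulr1.
    by apply: ge0_ler_powR; rewrite ?nnegrE ?(ltW g0) ?(ltW r0).
  apply: le_trans (lee_wpmul2l _ vp) _; first by nng.
  by rewrite -EFinM powRM ?powR_ge0 ?(ltW h0).
apply: (@le_trans _ _ (\int[mu]_y (2 `^ s *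
   ((r `^ (- e) * B) `^ s * ((w y <= r^-1)%R%:R * w y `^ (- b)) +
    (r `^ g) `^ s * (w y `^ (- d0) * `|T v y|) `^ s))%:E)%E).
  by apply: le_integral_ge0 => y; [nng; rewrite ltW|rewrite lee_fin key].
rewrite integralZl_ge0; [|by mble|by nng|by move=> y; nng].
rewrite integralD_ge0; [|by mble|by mble|by move=> y; nng|by move=> y; nng].
rewrite !integralZl_ge0; try by [mble|nng|move=> y; nng].
apply: (@le_trans _ _ ((2 `^ s)%:E * (((r `^ (- e) * B) `^ s)%:E * (C1 * r^-1 `^ (1 - b))%:E +
   ((r `^ g) `^ s)%:E * ((r `^ (- g) * h) `^ s * C0)%:E))%E).
  apply: lee_wpmul2l; first by nng.
  by apply: leeD; apply: lee_wpmul2l => //; nng.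
rewrite -!EFinM lee_fin le_eqVlt; apply/orP; left; apply/eqP.
rewrite -[RHS]mulrA; congr (_ * _); rewrite [RHS]mulrDl; congr (_ + _).
  rewrite /B !powRM; try by nng.
  rewrite -[r^-1]powR_inv1 ?(ltW r0)// -!powRrM.
  rewrite [LHS](_ : _ = C1 * (2 * V + 1) `^ s * h `^ s * (r `^ (- e * s) *
    r `^ ((1 - p^-1 - g) * s) * r `^ (-1 * (1 - b)))); last by ring.
  rewrite -!powRD ?(gt_eqF r0) ?implybT//.
  rewrite [X in r `^ X](_ : _ = 0) ?powRr0 ?mulr1//.
  by rewrite /b aE; field; rewrite !gt_eqF.
rewrite mulrA -powRM; [|by nng|by nng].
rewrite mulrA -powRD ?(gt_eqF r0) ?implybT// subrr powRr0 mul1r.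
exact: mulrC.
Qed.

Definition rad (L : R) (i : nat) := 2 ^+ i * L.
Definition shell (L : R) (i : nat) (x : X) := (rad L i <= w x) && (w x < rad L i.+1).
Definition shell_union (L : R) (M : nat) (x : X) := (L <= w x) && (w x < rad L M).

Let radS L i : rad L i.+1 = 2 * rad L i.
Proof. by rewrite /rad exprS mulrA. Qed.

Let rad_gt0 L i : 0 < L -> 0 < rad L i.
Proof. by move=> L0; rewrite /rad mulr_gt0// exprn_gt0. Qed.

Let rad_le L i : 0 < L -> L <= rad L i.
Proof.
by move=> L0; rewrite /rad ler_peMl ?(ltW L0)// exprn_ege1 ?ler1n.
Qed.

Let measurable_shell L i : measurable_fun setT (shell L i).
Proof. by rewrite /shell; mble. Qed.

Let measurable_shell_union L M : measurable_fun setT (shell_union L M).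
Proof. by rewrite /shell_union; mble. Qed.

Let kernel_op_shells L M u y : 0 < L -> L1r u ->
  `|T (fun x => u x * (shell_union L M x)%:R) y| <=
  \sum_(i < M) `|T (fun x => u x * (shell L i x)%:R) y|.
Proof.
move=> L0 iu; elim: M => [|M IH].
  rewrite big_ord0 (_ : (fun _ => _) = fun x => 0 * u x).
    by rewrite kernel_opZ// mul0r normr0.
  apply/funext => x; rewrite mul0r /shell_union /rad expr0 mul1r.
  by case: leP => _; rewrite ?andbF mulr0.
rewrite big_ord_recr/=.
rewrite (kernel_op_cut mK K1 (e := fun x => w x < rad L M)); last 2 first.
- by mble.
- exact: integrable_cut.
apply: (le_trans (ler_normD _ _)); apply: lerD.
  apply: le_trans IH; rewrite le_eqVlt; apply/orP; left; apply/eqP; congr (`|T _ y|).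
  apply/funext => x; rewrite -mulrA -natrM mulnb /shell_union; congr (_ * _%:R).
  have rM := rad_gt0 M L0.
  case: (ltP (w x) (rad L M)) => wr; last by rewrite !andbF.
  by rewrite radS (_ : w x < 2 * rad L M) ?andbT//; lra.
rewrite le_eqVlt; apply/orP; left; apply/eqP; congr (`|T _ y|).
apply/funext => x; rewrite -mulrA -natrM mulnb /shell_union /shell; congr (_ * _%:R).
case: (leP (rad L M) (w x)) => wr; last by rewrite andbF.
by rewrite (le_trans _ wr) ?rad_le//= andbT.
Qed.

Let shells_le1 L M x : 0 < L -> \sum_(i < M) (shell L i x)%:R <= 1 :> R.
Proof.
move=> L0; rewrite (eq_bigr (fun i : 'I_M => (w x < rad L i.+1)%R%:R - (w x < rad L i)%R%:R)).
  rewrite -(big_mkord xpredT (fun i => (w x < rad L i.+1)%R%:R - (w x < rad L i)%R%:R : R)).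
  rewrite telescope_sumr//.
  by case: (_ < _); case: (_ < _) => /=; lra.
move=> i _; rewrite /shell; have ri := rad_gt0 i L0.
case: (leP (rad L i) (w x)) => wr; first by rewrite subr0.
by rewrite radS (_ : w x < 2 * rad L i) ?subrr//; lra.
Qed.

(** The pieces on dyadic shells are reassembled by the telescoping weights,
    with a constant independent of the number of shells. *)
Lemma pitt_shells : exists2 C : R, 0 <= C & forall (L : R) (M : nat) (u : X -> R),
  0 < L -> L1r u -> (\int[mu]_x ((w x `^ g * `|u x|) `^ p)%:E <= 1)%E ->
  (\int[mu]_y ((w y `^ (- a) *
     `|T (fun x => u x * (shell_union L M x)%:R) y|) `^ s)%:E <= C%:E)%E.
Proof.
have [C1 C10 H1] := pitt_annulus.
pose rho := 2 `^ e; pose k := 4 * rho / (rho - 1).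
have rho1 : 1 < rho.
  apply: (@le_lt_trans _ _ (1 `^ e)); first by rewrite powR1.
  by apply: gt0_ltr_powR; rewrite ?nnegrE// ltr1n.
have rho10 : 0 <= rho - 1 by rewrite subr_ge0 ltW.
have k0 : 0 <= k by rewrite /k; nng.
exists (k `^ s * (C1 * 2 `^ (s / p))); first by nng.
move=> L M u L0 iu up; have mu_ := measurable_L1r iu.
pose v (i : nat) x := u x * (shell L i x)%:R.
have iv i : L1r (v i) by exact: integrable_cut.
have mv i : measurable_fun setT (v i) by exact: measurable_L1r (iv i).
have mTv i : measurable_fun setT (T (v i)) by exact: measurable_kernel_op.
pose al i := fine (\int[mu]_x ((w x `^ g * `|v i x|) `^ p)%:E).
have vE i x : (w x `^ g * `|v i x|) `^ p = (w x `^ g * `|u x|) `^ p * (shell L i x)%:R.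
  rewrite /v; case: (shell L i x); rewrite ?mulr1// mulr0 normr0 mulr0 mulr0.
  by rewrite powR0 ?gt_eqF.
have vu i : (\int[mu]_x ((w x `^ g * `|v i x|) `^ p)%:E <= 1)%E.
  apply: le_trans up; apply: le_integral_ge0 => x; first by nng.
  rewrite lee_fin vE -[leRHS]mulr1; apply: ler_wpM2l; first by nng.
  by case: shell.
have alE i : (\int[mu]_x ((w x `^ g * `|v i x|) `^ p)%:E = (al i)%:E)%E.
  rewrite /al fineK// ge0_fin_numE; last by apply: integral_ge0 => x _; nng.
  by apply: le_lt_trans (vu i) _; rewrite ltry.
have al0 i : 0 <= al i.
  by rewrite -lee_fin -alE; apply: integral_ge0 => x _; nng.
have alS : \sum_(i < M) al i <= 1.
  rewrite -lee_fin -sumEFin; under eq_bigr do rewrite -alE.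
  rewrite -ge0_integral_sum//; [|by move=> i; mble|by move=> i x _; nng].
  apply: le_trans up; apply: le_integral_ge0 => x.
    by rewrite sumEFin lee_fin; apply: sumr_ge0 => i _; nng.
  rewrite sumEFin lee_fin; under eq_bigr do rewrite vE.
  by rewrite -mulr_sumr -[leRHS]mulr1; apply: ler_wpM2l; [nng|exact: shells_le1].
pose h i := (al i + M.+1%:R^-1) `^ p^-1.
have M1 : 0 < M.+1%:R^-1 :> R by rewrite invr_gt0.
have h0 i : 0 < h i by apply: powR_gt0; rewrite ltr_wpDl.
have hp i : h i `^ p = al i + M.+1%:R^-1.
  by rewrite -powRrM mulVf ?gt_eqF// powRr1// addr_ge0// ltW.
have hS : \sum_(i < M) h i `^ s <= 2 `^ (s / p).
  have -> : \sum_(i < M) h i `^ s = \sum_(i < M) (al i + M.+1%:R^-1) `^ (s / p).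
    by apply: eq_bigr => i _; rewrite -powRrM mulrC.
  apply: powR_sum_le => //.
  - by rewrite ler_pdivlMr// mul1r.
  - by move=> i; rewrite addr_ge0// ltW.
  rewrite big_split/=; apply: (@le_trans _ _ (1 + 1)); last by lra.
  apply: lerD => //; rewrite sumr_const card_ord -[_ *+ M]mulr_natl.
  by rewrite ler_pdivrMr// mul1r ler_nat.
pose Phi i y := (rad L i * w y) `^ e + ((rad L i * w y) `^ e)^-1.
have Phi0 i y : 0 <= Phi i y by rewrite /Phi; nng.
have mPhi i : measurable_fun setT (Phi i).
  rewrite (_ : Phi i = fun y => (rad L i * w y) `^ e + (rad L i * w y) `^ (- e)).
    by mble.
  by apply/funext => y; rewrite powRN.
have mF i : measurable_fun setT (fun y => (w y `^ (- a) * Phi i y * `|T (v i) y|) `^ s).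
  by mble.
apply: (@le_trans _ _ (\int[mu]_y (k `^ s *
   (\sum_(i < M) (w y `^ (- a) * Phi i y * `|T (v i) y|) `^ s))%:E)%E).
  apply: le_integral_ge0 => y; first by nng.
  rewrite lee_fin; have := w0 y; rewrite le_eqVlt => /predU1P[wy|wy].
    rewrite -[in leLHS]wy powR0 ?oppr_eq0 ?gt_eqF// mul0r powR0 ?gt_eqF//.
    by apply: mulr_ge0; [nng|apply: sumr_ge0 => i _; nng].
  pose z i := (rad L i * w y) `^ e.
  have z0 i : 0 < z i by apply: powR_gt0; rewrite mulr_gt0// rad_gt0.
  have zS i : z i.+1 = rho * z i.
    by rewrite /z radS -mulrA powRM// mulr_ge0// ltW// rad_gt0.
  pose c (i : nat) := z i.+1 / (1 + z i.+1) - z i / (1 + z i).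
  have cP i : 0 < c i /\ (c i)^-1 <= k * (z i + (z i)^-1).
    by rewrite /c zS; exact: telescoping_weight.
  apply: (@le_trans _ _ ((\sum_(i < M) w y `^ (- a) * `|T (v i) y|) `^ s)).
    apply: ge0_ler_powR; rewrite ?nnegrE ?(ltW s0)//.
    - by nng.
    - by apply: sumr_ge0 => i _; nng.
    by rewrite -mulr_sumr; apply: ler_wpM2l; [nng|exact: kernel_op_shells].
  apply: (le_trans (powR_sum_weights (c := fun i : 'I_M => c i) s0 _ _ _)).
  - by move=> i; nng.
  - by move=> i; have [] := cP i.
  - rewrite -(big_mkord xpredT c) telescope_sumr//.
    have zM := z0 M; have z00 := z0 0%N.
    have : z M / (1 + z M) <= 1 by rewrite ler_pdivrMr ?mul1r; lra.
    have : 0 <= z 0%N / (1 + z 0%N) by apply: divr_ge0; lra.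
    by lra.
  rewrite mulr_sumr; apply: ler_sum => i _.
  rewrite -powRM; [|by nng|by nng].
  have [c0 cPhi] := cP i.
  apply: ge0_ler_powR; rewrite ?nnegrE ?(ltW s0)//; [by apply: divr_ge0; [nng|exact: ltW]|by nng|].
  rewrite [leRHS](_ : _ = w y `^ (- a) * `|T (v i) y| * (k * Phi i y)); last by ring.
  by apply: ler_wpM2l; [nng|exact: cPhi].
rewrite integralZl_ge0; [|by apply: measurable_sum => i|by nng|]; last first.
  by move=> y; apply: sumr_ge0 => i _; nng.
rewrite EFinM; apply: lee_wpmul2l; first by nng.
under eq_integral do rewrite -sumEFin.
rewrite ge0_integral_sum//; [|by move=> i; mble|by move=> i x _; nng].
apply: (@le_trans _ _ (\sum_(i < M) (C1 * h i `^ s)%:E)%E).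
  apply: lee_sum => i _; apply: H1 => //; first exact: rad_gt0.
    move=> x; rewrite /v; case: (boolP (shell L i x)) => [/andP[? ?] _|_].
      by rewrite -radS.
    by rewrite mulr0 eqxx.
  by rewrite alE hp lee_fin lerDl ltW.
rewrite sumEFin lee_fin -mulr_sumr; exact: ler_wpM2l.
Qed.

End pitt_shells.

Lemma measurable_setb d (X : measurableType d) (b : X -> bool) :
  measurable_fun setT b -> measurable [set x | b x].
Proof. by move=> mb; rewrite -[X in measurable X]setTI; exact: mb. Qed.

Section kernel_op_cvg.
Context d (X : measurableType d) (R : realType).
Variable mu : {sigma_finite_measure set X -> \bar R}.
Variable K : X -> X -> R.
Hypothesis mK : measurable_fun setT (fun z : X * X => K z.1 z.2).
Hypothesis K1 : forall x y, `|K x y| <= 1.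
Local Notation T := (kernel_op mu K).
Local Notation L1r u := (mu.-integrable setT (EFin \o (u : X -> R))).

Lemma kernel_op_cvg (u_ : nat -> X -> R) (u : X -> R) y : L1r u ->
  (forall n, measurable_fun setT (u_ n)) -> (forall n x, `|u_ n x| <= `|u x|) ->
  {ae mu, forall x, u_ n x @[n --> \oo] --> u x} ->
  T (u_ n) y @[n --> \oo] --> T u y.
Proof.
move=> iu mu_ uu uc; have mKy := measurable_kernel1 mK y.
have mu0 := measurable_L1r iu.
have iuK := integrable_kernel_op mK K1 y iu.
have mf_ n : measurable_fun setT (fun x => (u_ n x * K x y)%:E).
  by have := mu_ n => mn; mble.
have mf : measurable_fun setT (fun x => (u x * K x y)%:E) by mble.
have ig : mu.-integrable setT (fun x => `|u x|%:E).
  by apply: (integrable_dominated iu) => [|x]; [mble|rewrite normr_id].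
have f_f : {ae mu, forall x, [set: X] x ->
    (u_ n x * K x y)%:E @[n --> \oo] --> (u x * K x y)%:E}.
  by apply: filterS uc => x ucx _; apply: cvg_EFin; [exact: nearW|exact: cvgMl].
have f_g : {ae mu, forall x n, [set: X] x -> (`|(u_ n x * K x y)%:E| <= `|u x|%:E)%E}.
  apply: aeW => x n _; rewrite lee_fin normrM.
  by apply: (le_trans _ (uu n x)); rewrite ler_piMr.
have [_ _] := dominated_convergence measurableT mf_ mf f_f ig f_g.
rewrite (_ : (\int[mu]_x (u x * K x y)%:E)%E = (T u y)%:E).
  by move/fine_cvg.
by rewrite /kernel_op /Rintegral fineK//; exact: integrable_fin_num.
Qed.

End kernel_op_cvg.

Section pitt_dyadic.
Context d (X : measurableType d) (R : realType).
Variable mu : {sigma_finite_measure set X -> \bar R}.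
Variable K : X -> X -> R.
Hypothesis mK : measurable_fun setT (fun z : X * X => K z.1 z.2).
Hypothesis K1 : forall x y, `|K x y| <= 1.
Local Notation T := (kernel_op mu K).
Local Notation L1r u := (mu.-integrable setT (EFin \o (u : X -> R))).
Variables (w : X -> R) (V : R).
Hypothesis mw : measurable_fun setT w.
Hypothesis w0 : forall x, 0 <= w x.
Hypothesis V0 : 0 <= V.
Hypothesis wV : forall r, 0 < r -> (mu [set x | (w x < r)%R] <= (V * r)%:E)%E.
Local Notation pitt := (pitt mu K w).

Lemma weight_null : mu [set x | w x = 0] = 0.
Proof.
apply/eqP; rewrite -measure_le0; apply/lee_addgt0Pr => e e0.
rewrite add0e; have V10 : 0 < V + 1 by rewrite ltr_wpDl.
have c0 : 0 < e / (V + 1) by rewrite divr_gt0.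
apply: (@le_trans _ _ (mu [set x | w x < e / (V + 1)])).
  apply: le_measure; rewrite ?inE; last by move=> x /= ->.
    by rewrite -[X in measurable X]setTI; exact: (mw measurableT (measurable_set1 0)).
  by apply: measurable_setb; mble.
apply: (le_trans (wV c0)); rewrite lee_fin mulrCA ler_piMr ?(ltW e0)//.
by rewrite ler_pdivrMr ?mul1r ?lerDl.
Qed.

(** The shells [2^-k <= w < 2^k] exhaust the space up to the null set [w = 0];
    the bound for finitely many shells passes to the limit by Fatou's lemma. *)
Lemma pitt_dyadic (p s g C0 : R) (d0 := s^-1 - (1 - p^-1)) : 1 < p -> p <= s ->
  0 < g -> g < 1 - p^-1 -> 0 <= d0 -> 0 <= C0 -> pitt p s d0 0 C0 ->
  exists2 C : R, 0 <= C & pitt p s (d0 + g) g C.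
Proof.
move=> p1 ps g0 gp d00 C00 H0; set a := d0 + g.
have s0 : 0 < s by lra.
have as0 : 0 < s^-1 - a by rewrite /a /d0; lra.
pose e := Num.min g ((s^-1 - a) / 2).
have e0 : 0 < e by rewrite /e lt_min g0 divr_gt0.
have eg : e <= g by rewrite /e ge_min lexx.
have ea : (a + e) * s < 1.
  rewrite -ltr_pdivlMr// div1r.
  have : e <= (s^-1 - a) / 2 by rewrite /e ge_min lexx orbT.
  by lra.
have [C C1 H] := pitt_shells mK K1 mw w0 V0 wV p1 ps g0 d00 erefl e0 eg ea C00 H0.
exists (2 `^ s * C); first by nng.
move=> u iu up; have mu0 := measurable_L1r iu.
pose L (n : nat) : R := (2 ^+ n)^-1.
have L0 n : 0 < L n by rewrite invr_gt0 exprn_gt0.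
pose v n x := u x * (shell_union w (L n) (n + n) x)%:R.
have me n : measurable_fun setT (shell_union w (L n) (n + n)) by rewrite /shell_union; mble.
have iv n : L1r (v n) by exact: integrable_cut.
have mv n : measurable_fun setT (v n) by exact: measurable_L1r (iv n).
have mTv n : measurable_fun setT (T (v n)) by exact: measurable_kernel_op.
have vu n x : `|v n x| <= `|u x|.
  by rewrite /v; case: shell_union; rewrite ?mulr1// mulr0 normr0.
have Tv y : T (v n) y @[n --> \oo] --> T u y.
  apply: kernel_op_cvg => //; exists [set x | w x = 0]; split.
  - by rewrite -[X in measurable X]setTI; exact: (mw measurableT (measurable_set1 0)).
  - exact: weight_null.
  move=> x /= H1; apply: contrapT => /eqP wx; apply: H1.
  have wx0 : 0 < w x by rewrite lt_def wx w0.
  have N1 := truncnS_gt (w x + (w x)^-1).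
  apply: cvg_near_cst; exists (Num.truncn (w x + (w x)^-1)).+1 => // n /= Nn.
  have wn : w x + (w x)^-1 < 2 ^+ n.
    apply: (lt_trans N1); apply: (@le_lt_trans _ _ n%:R); first by rewrite ler_nat.
    by rewrite -natrX ltr_nat ltn_expl.
  have wi : 0 < (w x)^-1 by rewrite invr_gt0.
  rewrite /v (_ : shell_union _ _ _ _ = true) ?mulr1//; apply/andP; split.
    by rewrite /L -[leRHS]invrK lef_pV2 ?posrE ?exprn_gt0//; lra.
  by rewrite /rad /L exprD mulfK ?expf_neq0//; lra.
apply: (@fatou_eventually _ _ _ mu
  (fun n y => 2 `^ s * (w y `^ (- a) * `|T (v n) y|) `^ s)).
- by move=> n; have := mTv n => mn; mble.
- by move=> n x; nng.
- by move=> y; nng.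
- move=> y; have [->|Tu] := eqVneq (T u y) 0.
    by exists 0%N => n _; rewrite normr0 mulr0 powR0 ?gt_eqF//; nng.
  have Tu0 : 0 < `|T u y| / 2 by rewrite divr_gt0// normr_gt0.
  have /cvgrPdist_lt /(_ _ Tu0)[N _ HN] := Tv y; exists N => n /HN /=.
  move=> h; rewrite -powRM; [|by nng|by nng].
  apply: ge0_ler_powR; rewrite ?nnegrE ?(ltW s0)//; [by nng|by nng|].
  rewrite mulrCA; apply: ler_wpM2l; first by nng.
  have := ler_normD (T u y - T (v n) y) (T (v n) y); rewrite subrK.
  by lra.
- move=> n; have mn := mTv n.
  rewrite integralZl_ge0; [|by mble|by nng|by move=> y; nng].
  by rewrite EFinM; apply: lee_wpmul2l; [nng|exact: H].
Qed.

End pitt_dyadic.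

(** * Duality *)

Section pitt_dual.
Context d (X : measurableType d) (R : realType).
Variable mu : {sigma_finite_measure set X -> \bar R}.
Variable K : X -> X -> R.
Hypothesis mK : measurable_fun setT (fun z : X * X => K z.1 z.2).
Hypothesis K1 : forall x y, `|K x y| <= 1.
Hypothesis Ksym : forall x y, K x y = K y x.
Local Notation T := (kernel_op mu K).
Local Notation L1r u := (mu.-integrable setT (EFin \o (u : X -> R))).
Variables (w : X -> R) (V : R).
Hypothesis mw : measurable_fun setT w.
Hypothesis w0 : forall x, 0 <= w x.
Hypothesis V0 : 0 <= V.
Hypothesis wV : forall r, 0 < r -> (mu [set x | (w x < r)%R] <= (V * r)%:E)%E.
Local Notation pitt := (pitt mu K w).

Lemma kernel_op_self_adjoint (u v : X -> R) : L1r u -> L1r v ->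
  (\int[mu]_y (T u y * v y)%:E = \int[mu]_x (u x * T v x)%:E)%E.
Proof.
move=> iu iv; have mu0 := measurable_L1r iu; have mv := measurable_L1r iv.
pose f (z : X * X) := (u z.1 * K z.1 z.2 * v z.2)%:E.
have mf : measurable_fun setT f by rewrite /f; mble.
have If : (mu \x mu)%E.-integrable setT f.
  apply/(integrable12ltyP _ _ _).2 => //.
  apply: (@le_lt_trans _ _ (\int[mu]_x (`|u x|%:E * \int[mu]_y `|v y|%:E))%E).
    apply: le_integral_ge0 => x; first by apply: integral_ge0.
    rewrite -ge0_integralZl_EFin//; last by mble.
    apply: le_integral_ge0 => y; first by [].
    rewrite /f abse_EFin lee_fin !normrM; apply: ler_wpM2r => //.
    by rewrite ler_piMr.
  have fv : (\int[mu]_y `|v y|%:E \is a fin_num)%E.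
    by apply: integrable_fin_num => //; exact: (integrable_abse iv).
  have fu : (\int[mu]_y `|u y|%:E \is a fin_num)%E.
    by apply: integrable_fin_num => //; exact: (integrable_abse iu).
  rewrite ge0_integralZr//; [|by mble|by apply: integral_ge0].
  by rewrite ltey_eq fin_numM.
have := Fubini If; rewrite /f /=.
have -> : (\int[mu]_x \int[mu]_y (u x * K x y * v y)%:E = \int[mu]_x (u x * T v x)%:E)%E.
  apply: eq_integral => x _; rewrite /kernel_op /Rintegral.
  have iK := integrable_kernel_op mK K1 x iv.
  rewrite EFinM fineK; last exact: integrable_fin_num.
  rewrite -integralZl//; apply: eq_integral => y _.
  by rewrite -EFinM (Ksym x y) mulrAC mulrA.
move=> ->; apply: eq_integral => y _; rewrite /kernel_op /Rintegral.
have iK := integrable_kernel_op mK K1 y iu.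
rewrite EFinM fineK; last exact: integrable_fin_num.
by rewrite muleC -integralZl//; apply: eq_integral => x _; rewrite -EFinM mulrC.
Qed.

(** Young's inequality without its sharp constants: [y] is compared with
    [x^(p-1)]. *)
Lemma young_crude (x y p : R) : 1 < p -> 0 <= x -> 0 <= y ->
  x * y <= x `^ p + y `^ (p / (p - 1)).
Proof.
move=> p1 x0 y0; have p0 : 0 < p by lra.
have p10 : 0 < p - 1 by lra.
have [yx|/ltW yx] := leP y (x `^ (p - 1)).
  rewrite -(mulr_powRB1 x0 p0); apply: (@le_trans _ _ (x * x `^ (p - 1))).
    exact: ler_wpM2l.
  by rewrite lerDl powR_ge0.
apply: (@le_trans _ _ (y `^ (p / (p - 1)))); last by rewrite lerDr powR_ge0.
have xy : x <= y `^ ((p - 1)^-1).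
  rewrite -(powRr1 x0) -[X in x `^ X](mulfV (_ : p - 1 != 0)) ?gt_eqF//.
  rewrite powRrM; apply: ge0_ler_powR; rewrite ?nnegrE ?powR_ge0 ?invr_ge0 ?(ltW p10)//.
rewrite (_ : p / (p - 1) = 1 + (p - 1)^-1); last by field; rewrite gt_eqF.
rewrite powRD; last by rewrite gt_eqF// ltr_wpDr ?invr_ge0 ?(ltW p10).
by rewrite powRr1// mulrC; apply: ler_wpM2l.
Qed.

(** Test [F = w^-a T u] against its own extremiser [sg(F) |F|^(s-1)], cut off so as
    to be bounded with support of finite measure, then normalised; by symmetry of
    the kernel the pairing equals that of [u] with the transform of the test
    function, to which the dual inequality applies.  Young's inequality replaces
    that of Hoelder since everything is normalised. *)
Lemma pitt_dual (p s a g C : R) : 1 < p -> 1 < s -> 0 <= C ->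
  pitt (s / (s - 1)) (p / (p - 1)) g a C -> pitt p s a g ((1 + C) `^ s).
Proof.
move=> p1 s1 C0 H u iu up; have mu0 := measurable_L1r iu.
have mTu : measurable_fun setT (T u) by exact: measurable_kernel_op.
have s0 : 0 < s by lra.
have s10 : 0 < s - 1 by lra.
have wm y : w y `^ a * w y `^ (- a) <= 1.
  have := w0 y; rewrite le_eqVlt => /predU1P[<-|wy].
    have [->|a0] := eqVneq a 0; first by rewrite oppr0 !powRr0 mulr1.
    by rewrite powR0// mul0r.
  by rewrite -powRD ?subrr ?powRr0// (gt_eqF wy) implybT.
pose f y := w y `^ (- a) * `|T u y|.
have f0 y : 0 <= f y by rewrite /f; nng.
have mf : measurable_fun setT f by rewrite /f; mble.
pose e (k : nat) y := [&& w y < k%:R, w y `^ (- a) <= k%:R & f y <= k%:R].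
have me k : measurable_fun setT (e k) by rewrite /e; mble.
apply: (@fatou_eventually _ _ _ mu (fun k y => f y `^ s * (e k y)%:R)).
- by move=> k; have := me k => mek; mble.
- by move=> k y; nng.
- by move=> y; nng.
- move=> y; pose B := w y + w y `^ (- a) + f y.
  have wa : 0 <= w y `^ (- a) by nng.
  exists (Num.truncn B).+1 => k Bk; have Bk' : B < k%:R.
    by apply: (lt_le_trans (truncnS_gt _)); rewrite ler_nat.
  have := w0 y; have := f0 y => fy wy.
  rewrite (_ : e k y = true) ?mulr1//; apply/and3P; split; move: Bk'; rewrite /B; lra.
move=> k; have mek := me k.
pose v y := Num.sg (T u y) * (f y `^ (s - 1) * w y `^ (- a)) * (e k y)%:R.
have mv : measurable_fun setT v.
  rewrite /v; apply: measurable_funM; last by mble.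
  apply: measurable_funM; last by mble.
  rewrite (_ : (fun _ => _) = fun y => (0 < T u y)%R%:R - (T u y < 0)%R%:R).
    by mble.
  by apply/funext => y; case: sgrP => h; rewrite /= ?ltxx ?h ?(lt_gtF h) ?subr0 ?sub0r ?subrr.
have vE y : `|v y| <= f y `^ (s - 1) * w y `^ (- a) * (e k y)%:R.
  rewrite /v !normrM normr_nat; apply: ler_wpM2r => //.
  rewrite !(ger0_norm (powR_ge0 _ _)) -[leRHS]mul1r; apply: ler_wpM2r; first by nng.
  by rewrite normr_sg; case: (_ != 0).
have wk (c : R) : 0 <= c -> (\int[mu]_y (c * (w y < k%:R)%R%:R)%:E < +oo)%E.
  move=> c0; rewrite integralZl_ge0; [|by mble|by []|by move=> y; nng].
  rewrite integral_natmulb; last by mble.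
  case: (posnP k) => [->|k0].
    rewrite (_ : [set x | _] = set0) ?measure0 ?mule0 ?ltry//.
    by apply/seteqP; split => y //=; rewrite ltNge w0.
  apply: (@le_lt_trans _ _ (c%:E * (V * k%:R)%:E)%E); last by rewrite -EFinM ltry.
  by apply: lee_wpmul2l; [nng|apply: wV; rewrite ltr0n].
have iv : L1r v.
  apply/integrableP; split; first by mble.
  apply: le_lt_trans (wk (k%:R `^ (s - 1) * k%:R) _); last by nng.
  apply: le_integral_ge0 => y; first by [].
  rewrite lee_fin; apply: (le_trans (vE y)).
  case: (boolP (e k y)) => [/and3P[-> wak fk]|_]; last by rewrite mulr0; nng.
  rewrite !mulr1; apply: ler_pM; [by nng|by nng| |by []].
  by apply: ge0_ler_powR; rewrite ?nnegrE ?(ltW s10).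
pose I := fine (\int[mu]_y (f y `^ s * (e k y)%:R)%:E).
have IE : (\int[mu]_y (f y `^ s * (e k y)%:R)%:E = I%:E)%E.
  rewrite /I fineK// ge0_fin_numE; last by apply: integral_ge0 => y _; nng.
  apply: le_lt_trans (wk (k%:R `^ s) _); last by nng.
  apply: le_integral_ge0 => y; first by nng.
  rewrite lee_fin; case: (boolP (e k y)) => [/and3P[-> wak fk]|_]; last by rewrite mulr0; nng.
  by rewrite !mulr1; apply: ge0_ler_powR; rewrite ?nnegrE ?(ltW s0).
rewrite IE lee_fin.
have : 0 <= I by rewrite -lee_fin -IE; apply: integral_ge0 => y _; nng.
rewrite le_eqVlt => /predU1P[<-|I0]; first by nng.
pose c := I `^ ((s - 1) / s).
have c0 : 0 < c by exact: powR_gt0.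
have ci : 0 <= c^-1 by rewrite invr_ge0 ltW.
pose vt y := c^-1 * v y.
have ivt : L1r vt by exact: (integrableZl measurableT _ iv).
have mvt := measurable_L1r ivt.
have mTvt : measurable_fun setT (T vt) by exact: measurable_kernel_op.
have vt1 : (\int[mu]_y ((w y `^ a * `|vt y|) `^ (s / (s - 1)))%:E <= 1)%E.
  apply: (@le_trans _ _ (\int[mu]_y (I^-1 * (f y `^ s * (e k y)%:R))%:E)%E); last first.
    rewrite integralZl_ge0; [|by mble|by rewrite invr_ge0 ltW|by move=> y; nng].
    by rewrite IE -EFinM mulVf ?gt_eqF.
  apply: le_integral_ge0 => y; first by nng.
  rewrite lee_fin; apply: (@le_trans _ _ ((c^-1 * (f y `^ (s - 1) * (e k y)%:R)) `^ (s / (s - 1)))).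
    apply: ge0_ler_powR; rewrite ?nnegrE; [by apply: divr_ge0; exact: ltW|by nng|by nng|].
    rewrite /vt normrM (ger0_norm ci) mulrCA; apply: ler_wpM2l => //.
    apply: (le_trans (ler_wpM2l (powR_ge0 _ _) (vE y))).
    rewrite [leLHS](_ : _ = f y `^ (s - 1) * (e k y)%:R * (w y `^ a * w y `^ (- a))); last by ring.
    by rewrite -[leRHS]mulr1; apply: ler_wpM2l => //; nng.
  have sn : s != 0 by rewrite gt_eqF.
  have sn1 : s - 1 != 0 by rewrite gt_eqF.
  case: (e k y); last by rewrite !mulr0 powR0// mulf_neq0 ?invr_neq0.
  rewrite !mulr1 powRM; [|by []|by nng]; rewrite -powRrM.
  rewrite (_ : (s - 1) * (s / (s - 1)) = s); last by field.
  apply: ler_wpM2r; first by nng.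
  rewrite /c -powRN -powRrM (_ : _ * _ = -1); last by field; rewrite sn sn1.
  by rewrite powR_inv1// ltW.
have FvE : (\int[mu]_y (T u y * vt y)%:E = (c^-1 * I)%:E)%E.
  rewrite EFinM -IE -integralZl_ge0; [|by mble|by []|by move=> y; nng].
  apply: eq_integral => y _; congr (_%:E); rewrite /vt /v -(mulr_powRB1 (f0 y) s0).
  by rewrite [X in _ = _ * (X * _ * _)]/f (normrEsg (T u y)); ring.
have := kernel_op_self_adjoint iu ivt; rewrite FvE => FvE'.
have : ((c^-1 * I)%:E <= (1 + C)%:E)%E.
  rewrite FvE'.
  apply: (@le_trans _ _ (\int[mu]_x (`|u x| * `|T vt x|)%:E)%E).
    apply: le_trans (lee_abs _) _.
    have mprod : measurable_fun setT (fun x => (u x * T vt x)%:E) by mble.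
    apply: le_trans (le_abse_integral _ measurableT mprod) _.
    by apply: le_integral_ge0 => x //; rewrite abse_EFin normrM.
  apply: (@le_trans _ _ (\int[mu]_x ((w x `^ g * `|u x|) `^ p +
     (w x `^ (- g) * `|T vt x|) `^ (p / (p - 1)))%:E)%E).
    apply: ae_ge0_le_integral ; [by []|by move=> x _; nng|by mble|by move=> x _; nng|by mble|].
    exists [set x | w x = 0]; split.
    - by rewrite -[X in measurable X]setTI; exact: (mw measurableT (measurable_set1 0)).
    - exact: (weight_null mw V0 wV).
    move=> x /= H1; apply: contrapT => /eqP wx; apply: H1 => _.
    rewrite lee_fin.
    have wg : w x `^ g * w x `^ (- g) = 1.
      by rewrite -powRD ?subrr ?powRr0// (negbTE wx) implybT.
    apply: (le_trans _ (young_crude p1 _ _)); [|by nng|by nng].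
    rewrite mulrACA wg mul1r; exact: lexx.
  rewrite integralD_ge0; [|by mble|by mble|by move=> y; nng|by move=> y; nng].
  exact: (leeD up (H vt ivt vt1)).
rewrite lee_fin => IC.
have IE' : I = (c^-1 * I) `^ s.
  rewrite /c -powRN -[X in _ * X](powRr1 (ltW I0)) -powRD ?(gt_eqF I0) ?implybT//.
  rewrite -powRrM (_ : _ * s = 1) ?powRr1 ?(ltW I0)//.
  by field; rewrite gt_eqF.
rewrite IE'; apply: ge0_ler_powR; rewrite ?nnegrE ?(ltW s0)//.
  by apply: mulr_ge0 => //; exact: ltW.
by rewrite addr_ge0.
Qed.

End pitt_dual.

(** * Pitt's inequality *)

Section pitt_inequality.
Context d (X : measurableType d) (R : realType).
Variable mu : {sigma_finite_measure set X -> \bar R}.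
Variable K : X -> X -> R.
Hypothesis mK : measurable_fun setT (fun z : X * X => K z.1 z.2).
Hypothesis K1 : forall x y, `|K x y| <= 1.
Hypothesis Ksym : forall x y, K x y = K y x.
Local Notation T := (kernel_op mu K).
Local Notation L1r u := (mu.-integrable setT (EFin \o (u : X -> R))).
Variable A : R.
Hypothesis A0 : 0 <= A.
Hypothesis L2 : forall u, L1r u ->
  (\int[mu]_y (T u y ^+ 2)%:E <= A%:E * \int[mu]_x (u x ^+ 2)%:E)%E.
Variables (w : X -> R) (V : R).
Hypothesis mw : measurable_fun setT w.
Hypothesis w0 : forall x, 0 <= w x.
Hypothesis V0 : 0 <= V.
Hypothesis wV : forall r, 0 < r -> (mu [set x | (w x < r)%R] <= (V * r)%:E)%E.
Local Notation pitt := (pitt mu K w).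

Let pitt_low (p s g : R) : 1 < p -> p <= s -> s <= p / (p - 1) ->
  0 <= g -> g < 1 - p^-1 ->
  exists2 C : R, 0 <= C & pitt p s (s^-1 - (1 - p^-1) + g) g C.
Proof.
move=> p1 ps sp'; have [C C0 H] := pitt_diag mK K1 A0 L2 mw w0 V0 wV p1 ps sp'.
rewrite le_eqVlt => /predU1P[<- _|g0 gp]; first by exists C; rewrite ?addr0.
apply: (pitt_dyadic mK K1 mw w0 V0 wV p1 ps g0 gp _ C0 H).
have p0 : 0 < p by lra.
have s0 : 0 < s by lra.
rewrite (_ : 1 - p^-1 = (p / (p - 1))^-1).
  by rewrite subr_ge0 lef_pV2 ?posrE// divr_gt0//; lra.
by field; rewrite gt_eqF//=; lra.
Qed.

(** Either [s <= p'], or the dual pair of exponents [(s', p')] satisfies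
    [p' <= (s')' = s], which is the first case again. *)
Theorem pitt_inequality (p s a g : R) : 1 < p -> p <= s ->
  0 <= a -> a < s^-1 -> 0 <= g -> a = s^-1 - (1 - p^-1) + g ->
  exists2 C : R, 0 <= C & pitt p s a g C.
Proof.
move=> p1 ps a0 as1 g0 aE.
have [sp'|sp'] := leP s (p / (p - 1)).
  by rewrite aE; apply: pitt_low => //; lra.
have s1 : 1 < s by lra.
have p0 : p != 0 by apply/eqP; lra.
have s0 : s != 0 by apply/eqP; lra.
have p10 : 0 < p - 1 by lra.
have s10 : 0 < s - 1 by lra.
have s'i : (s / (s - 1))^-1 = 1 - s^-1.
  by field; rewrite s0 gt_eqF.
have p'i : (p / (p - 1))^-1 = 1 - p^-1.
  by field; rewrite p0 gt_eqF.
have [|||||C C0] := @pitt_low (s / (s - 1)) (p / (p - 1)) a.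
- by rewrite ltr_pdivlMr//; lra.
- by rewrite ler_pdivrMr// mulrAC ler_pdivlMr//; nra.
- rewrite (_ : s / (s - 1) - 1 = (s - 1)^-1); last by field; rewrite gt_eqF.
  by rewrite invrK divfK ?(ltW sp')// gt_eqF.
- by [].
- by rewrite s'i; lra.
rewrite p'i s'i (_ : _ + a = g); last by lra.
by move=> H; exists ((1 + C) `^ s); [nng|exact: (pitt_dual mK K1 Ksym mw w0 V0 wV p1 s1 C0 H)].
Qed.

End pitt_inequality.

(** * The L2 bound on the line *)

Section schur.
Context d (X : measurableType d) (R : realType).
Variable mu : {sigma_finite_measure set X -> \bar R}.

Let iterated_integralD (f g : X * X -> \bar R) :
  measurable_fun setT f -> measurable_fun setT g ->
  (forall z, 0 <= f z)%E -> (forall z, 0 <= g z)%E ->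
  (\int[mu]_x \int[mu]_y (f (x, y) + g (x, y)) =
   \int[mu]_x \int[mu]_y f (x, y) + \int[mu]_x \int[mu]_y g (x, y))%E.
Proof.
move=> mf mg f0 g0.
have mfg : measurable_fun setT (fun z => f z + g z)%E by exact: emeasurable_funD.
have fg0 z : (0 <= f z + g z)%E by rewrite adde_ge0.
rewrite -(fubini_tonelli1 _ mf f0) -(fubini_tonelli1 _ mg g0).
rewrite -ge0_integralD//.
by rewrite (fubini_tonelli1 _ mfg fg0).
Qed.

Let normM_le_sqr (a b : R) : `|a| * `|b| <= a ^+ 2 + b ^+ 2.
Proof.
rewrite -[a ^+ 2]real_normK ?num_real// -[b ^+ 2]real_normK ?num_real//.
by have := normr_ge0 a; have := normr_ge0 b; nra.
Qed.

(** Schur's test, through [|u x| |u y| <= u(x)^2 + u(y)^2]. *)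
Lemma schur (N : X -> X -> R) (A : R) (u : X -> R) : measurable_fun setT u ->
  measurable_fun setT (fun z : X * X => N z.1 z.2) ->
  (forall x y, 0 <= N x y) -> (forall x y, N x y = N y x) -> 0 <= A ->
  (forall x, (\int[mu]_y (N x y)%:E <= A%:E)%E) ->
  (\int[mu]_x \int[mu]_y (`|u x| * `|u y| * N x y)%:E <=
   (2 * A)%:E * \int[mu]_x (u x ^+ 2)%:E)%E.
Proof.
move=> mu0 mN N0 Nsym A0 NA.
pose f (z : X * X) := (u z.1 ^+ 2 * N z.1 z.2)%:E.
pose g (z : X * X) := (u z.2 ^+ 2 * N z.1 z.2)%:E.
have mf : measurable_fun setT f by rewrite /f; mble.
have mg : measurable_fun setT g by rewrite /g; mble.
have f0 z : (0 <= f z)%E by rewrite /f; nng.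
have g0 z : (0 <= g z)%E by rewrite /g; nng.
have fA : (\int[mu]_x \int[mu]_y f (x, y) <= A%:E * \int[mu]_x (u x ^+ 2)%:E)%E.
  rewrite -integralZl_ge0; [|by mble|by []|by move=> x; nng].
  apply: le_integral_ge0 => x; first by apply: integral_ge0.
  have mNx : measurable_fun setT (N x) by exact: (measurableT_comp mN (pair1_measurable x)).
  rewrite /f/= integralZl_ge0; [|by mble|by nng|by []].
  rewrite [A * _]mulrC [leRHS]EFinM; apply: lee_wpmul2l; first by nng.
  exact: NA.
have gf : (\int[mu]_x \int[mu]_y g (x, y) = \int[mu]_x \int[mu]_y f (x, y))%E.
  rewrite (fubini_tonelli _ mg g0); apply: eq_integral => x _; apply: eq_integral => y _.
  by rewrite /f /g/= Nsym.
have gA : (\int[mu]_x \int[mu]_y g (x, y) <= A%:E * \int[mu]_x (u x ^+ 2)%:E)%E.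
  by rewrite gf.
have A2 : ((2 * A)%:E * \int[mu]_x (u x ^+ 2)%:E =
    A%:E * \int[mu]_x (u x ^+ 2)%:E + A%:E * \int[mu]_x (u x ^+ 2)%:E)%E.
  by rewrite (_ : 2 * A = A + A); [rewrite EFinD ge0_muleDl; [|rewrite lee_fin|rewrite lee_fin]|ring].
rewrite A2; apply: (le_trans _ (leeD fA gA)).
rewrite -(iterated_integralD mf mg f0 g0).
apply: le_integral_ge0 => x.
  by apply: integral_ge0 => y _; rewrite lee_fin; apply: mulr_ge0 => //; exact: mulr_ge0.
apply: le_integral_ge0 => y.
  by rewrite lee_fin; apply: mulr_ge0 => //; exact: mulr_ge0.
rewrite /f /g -EFinD lee_fin -mulrDl; apply: ler_wpM2r; first exact: N0.
exact: normM_le_sqr.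
Qed.

End schur.

(** The quadratic form of the two operators, damped by [W], is the form of the
    kernel [M]; Schur's test bounds it as soon as [M] has bounded row sums. *)
Section damped_form.
Context d (X : measurableType d) (R : realType).
Variable mu : {sigma_finite_measure set X -> \bar R}.
Local Notation L1r u := (mu.-integrable setT (EFin \o (u : X -> R))).
Variables Kc Ks : X -> X -> R.
Hypothesis mKc : measurable_fun setT (fun z : X * X => Kc z.1 z.2).
Hypothesis mKs : measurable_fun setT (fun z : X * X => Ks z.1 z.2).
Hypothesis Kc1 : forall x y, `|Kc x y| <= 1.
Hypothesis Ks1 : forall x y, `|Ks x y| <= 1.
Hypothesis Kcsym : forall x y, Kc x y = Kc y x.
Hypothesis Kssym : forall x y, Ks x y = Ks y x.
Local Notation Tc := (kernel_op mu Kc).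
Local Notation Ts := (kernel_op mu Ks).
Variable W : X -> R.
Hypothesis iW : L1r W.
Hypothesis W0 : forall y, 0 <= W y.

Let M x x' := Tc (fun y => W y * Kc x y) x' + Ts (fun y => W y * Ks x y) x'.

Let kernel_op_bounded (K : X -> X -> R) u :
  measurable_fun setT (fun z : X * X => K z.1 z.2) -> (forall x y, `|K x y| <= 1) ->
  L1r u -> exists B : R, forall y, `|kernel_op mu K u y| <= B.
Proof.
move=> mK K1 iu; exists (fine (\int[mu]_x `|u x|%:E)) => y.
rewrite -lee_fin fineK; first exact: kernel_op_le.
by apply: integrable_fin_num => //; exact: (integrable_abse iu).
Qed.

(** Moving [K] to the other side twice writes the damped square norm of
    [kernel_op K u] as a quadratic form in [u], whose kernel is one summand of [M]. *)
Let damped_square (K : X -> X -> R) (u : X -> R) :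
  measurable_fun setT (fun z : X * X => K z.1 z.2) -> (forall x y, `|K x y| <= 1) ->
  (forall x y, K x y = K y x) -> L1r u ->
  (\int[mu]_y (W y * kernel_op mu K u y ^+ 2)%:E =
   \int[mu]_x (u x * kernel_op mu K (fun y => W y * kernel_op mu K u y) x)%:E)%E /\
  L1r (fun x => u x * kernel_op mu K (fun y => W y * kernel_op mu K u y) x) /\
  forall x, kernel_op mu K (fun y => W y * kernel_op mu K u y) x =
    \int[mu]_x' (u x' * kernel_op mu K (fun y => W y * K x y) x').
Proof.
move=> mK K1 Ksym iu; have mW := measurable_L1r iW.
have mu0 := measurable_L1r iu.
have mT : measurable_fun setT (kernel_op mu K u) by exact: measurable_kernel_op.
have iWT : L1r (fun y => W y * kernel_op mu K u y).
  have [B TB] := kernel_op_bounded mK K1 iu.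
  apply: (integrable_dominated (u := fun y => B * W y)); [|by mble|].
    exact: (integrableZl measurableT _ iW).
  move=> y; rewrite !normrM mulrC; apply: ler_wpM2r => //.
  by apply: le_trans (TB y) _; rewrite ler_norm.
split.
  rewrite -(kernel_op_self_adjoint mK K1 Ksym iu iWT).
  by apply: eq_integral => y _; congr (_%:E); ring.
split.
  have [B TB] := kernel_op_bounded mK K1 iWT.
  have mTW := measurable_kernel_op mu mK (measurable_L1r iWT).
  apply: (integrable_dominated (u := fun y => B * u y)); [|by mble|].
    exact: (integrableZl measurableT _ iu).
  move=> y; rewrite !normrM mulrC; apply: ler_wpM2r => //.
  by apply: le_trans (TB y) _; rewrite ler_norm.
move=> x; have mKx := measurable_kernel2 mK x.
have iWK : L1r (fun y => W y * K x y).
  apply: (integrable_dominated iW); [by mble|move=> y].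
  by rewrite normrM ler_piMr.
have := kernel_op_self_adjoint mK K1 Ksym iu iWK.
rewrite /Rintegral => <-; rewrite {1}/kernel_op /Rintegral; congr fine.
by apply: eq_integral => y _; congr (_%:E); rewrite (Ksym y x); ring.
Qed.

Lemma damped_form_le (N : X -> X -> R) (A : R) (u : X -> R) : L1r u ->
  measurable_fun setT (fun z : X * X => N z.1 z.2) ->
  (forall x y, N x y = N y x) -> 0 <= A ->
  (forall x y, `|M x y| <= N x y) ->
  (forall x, (\int[mu]_y (N x y)%:E <= A%:E)%E) ->
  (\int[mu]_y (W y * (Tc u y ^+ 2 + Ts u y ^+ 2))%:E <=
   (2 * A)%:E * \int[mu]_x (u x ^+ 2)%:E)%E.
Proof.
move=> iu mN Nsym A0 MN NA; have mu0 := measurable_L1r iu.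
have mW := measurable_L1r iW.
have N0 x y : 0 <= N x y by exact: le_trans (MN x y).
have mTc : measurable_fun setT (Tc u) by exact: measurable_kernel_op.
have mTs : measurable_fun setT (Ts u) by exact: measurable_kernel_op.
apply: le_trans (schur mu0 mN N0 Nsym A0 NA).
have [Ec [ic Hc]] := damped_square mKc Kc1 Kcsym iu.
have [Es [is_ Hs]] := damped_square mKs Ks1 Kssym iu.
have iM x : L1r (fun x' => u x' * Tc (fun y => W y * Kc x y) x') /\
    L1r (fun x' => u x' * Ts (fun y => W y * Ks x y) x').
  have mKcx := measurable_kernel2 mKc x; have mKsx := measurable_kernel2 mKs x.
  have iWc : L1r (fun y => W y * Kc x y).
    apply: (integrable_dominated iW); [by mble|move=> y].
    by rewrite normrM ler_piMr.
  have iWs : L1r (fun y => W y * Ks x y).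
    apply: (integrable_dominated iW); [by mble|move=> y].
    by rewrite normrM ler_piMr.
  have [B1 TB1] := kernel_op_bounded mKc Kc1 iWc.
  have [B2 TB2] := kernel_op_bounded mKs Ks1 iWs.
  have m1 := measurable_kernel_op mu mKc (measurable_L1r iWc).
  have m2 := measurable_kernel_op mu mKs (measurable_L1r iWs).
  split.
    apply: (integrable_dominated (u := fun y => B1 * u y)); [|by mble|].
      exact: (integrableZl measurableT _ iu).
    move=> y; rewrite !normrM mulrC; apply: ler_wpM2r => //.
    by apply: le_trans (TB1 y) _; rewrite ler_norm.
  apply: (integrable_dominated (u := fun y => B2 * u y)); [|by mble|].
    exact: (integrableZl measurableT _ iu).
  move=> y; rewrite !normrM mulrC; apply: ler_wpM2r => //.
  by apply: le_trans (TB2 y) _; rewrite ler_norm.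
under eq_integral do rewrite mulrDr.
rewrite integralD_ge0; [|by mble|by mble|by move=> y; nng|by move=> y; nng].
rewrite Ec Es -integralD_EFin//.
apply: le_trans (lee_abs _) _.
apply: le_trans (le_abse_integral _ measurableT _) _.
  by apply: measurable_int; exact: integrableD ic is_.
apply: le_integral_ge0 => x; first by [].
have mNx : measurable_fun setT (N x) by exact: (measurableT_comp mN (pair1_measurable x)).
under eq_integral do rewrite -mulrA.
rewrite integralZl_ge0; [|by mble|by []|by move=> y; nng].
rewrite /= -mulrDr normrM EFinM; apply: lee_wpmul2l => //.
have [i1 i2] := iM x.
rewrite Hc Hs -RintegralD//.
rewrite EFin_normr_Rintegral//; last exact: integrableD i1 i2.
apply: le_trans (le_abse_integral _ measurableT _) _.
  by apply: measurable_int; exact: integrableD i1 i2.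
apply: le_integral_ge0 => y; first by [].
by rewrite abse_EFin lee_fin -mulrDr normrM; apply: ler_wpM2l => //; exact: MN.
Qed.

End damped_form.

Section plancherel1.
Context (R : realType).
Local Notation leb := (@lebesgue_measure R).
Local Notation X := (measurableTypeR R).
Local Notation L1r u := (leb.-integrable setT (EFin \o (u : X -> R))).

Definition cos_kernel (x y : R) : R := cos (2 * pi * (x * y)).
Definition sin_kernel (x y : R) : R := sin (2 * pi * (x * y)).

Let tri (Y y : R) := ((0 <= y) && (y <= Y))%R%:R * (1 - y / Y).

(** The Fejer kernel: thanks to the factor [c^-2] it is integrable in [c], which
    is why the triangle is preferred to an indicator function as a damping. *)
Lemma integral_triangle_cos (c Y : R) : 0 < Y -> c != 0 ->
  (\int[leb]_y (tri Y y * cos (c * y)) = (1 - cos (c * Y)) / (c ^+ 2 * Y))%R.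
Proof.
move=> Y0 c0; have Yn0 : Y != 0 by rewrite gt_eqF.
pose lin : R -> R := c \*: id.
pose Phi : R -> R := (cst 1 - Y^-1 \*: id) * (c^-1 \*: (@sin R \o lin)) -
  (c ^+ 2 * Y)^-1 \*: (@cos R \o lin).
have dPhi (y : R) : is_derive y 1 Phi ((1 - y / Y) * cos (c * y)).
  apply: is_derive_eq; rewrite /lin /GRing.scale/= !fctE /GRing.scale/=; rewrite (_ : Y^-1 *: y = Y^-1 * y)//.
  by field; rewrite c0 Yn0.
have cPhi (y : R) : {for y, continuous Phi}.
  by apply: differentiable_continuous; apply/derivable1_diffP; exact: ex_derive.
rewrite /Rintegral.
rewrite (_ : \int[leb]_y _ = \int[leb]_(y in `[0%R, Y]) ((1 - y / Y) * cos (c * y))%:E)%E; last first.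
  rewrite [RHS]integral_mkcond; apply: eq_integral => y _.
  rewrite patchE /tri mem_setE in_itv/=; case: ifP => _; first by rewrite mul1r.
  by rewrite !mul0r.
have cf (y : R) : (1 - z / Y) * cos (c * z) @[z --> y] --> (1 - y / Y) * cos (c * y).
  apply: cvgM.
    by apply: cvgB; [exact: cvg_cst|apply: cvgMl; exact: cvg_id].
  apply: (@cvg_comp _ _ _ (fun z : R => c * z) (@cos R) _ (nbhs (c * y))).
    by apply: cvgMr; exact: cvg_id.
  exact: continuous_cos.
rewrite (@continuous_FTC2 _ _ Phi)//.
- rewrite -EFinB /= /Phi /lin !fctE.
  rewrite [LHS](_ : _ = (1 - Y^-1 * Y) * (c^-1 * sin (c * Y)) -
    (c ^+ 2 * Y)^-1 * cos (c * Y) - ((1 - Y^-1 * 0) * (c^-1 * sin (c * 0)) -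
    (c ^+ 2 * Y)^-1 * cos (c * 0)))//.
  rewrite mulVf// subrr mul0r !mulr0 cos0 sin0.
  by field; rewrite c0 Yn0.
- by apply: continuous_subspaceT => y; exact: cf.
- split.
  + by move=> y _; exact: ex_derive.
  + by apply: cvg_at_right_filter; exact: cPhi.
  + by apply: cvg_at_left_filter; exact: cPhi.
- by move=> y _; rewrite derive1E; exact: derive_val.
Qed.

Let mcos : measurable_fun setT (@cos R).
Proof. exact: continuous_measurable_fun (@continuous_cos R). Qed.

Let msin : measurable_fun setT (@sin R).
Proof. exact: continuous_measurable_fun (@continuous_sin R). Qed.

Lemma measurable_cos_kernel :
  measurable_fun setT (fun z : X * X => cos_kernel z.1 z.2).
Proof. by rewrite /cos_kernel; apply: (measurableT_comp mcos); mble. Qed.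

Lemma measurable_sin_kernel :
  measurable_fun setT (fun z : X * X => sin_kernel z.1 z.2).
Proof. by rewrite /sin_kernel; apply: (measurableT_comp msin); mble. Qed.

Lemma cos_kernel_le1 x y : `|cos_kernel x y| <= 1.
Proof. by rewrite ler_norml cos_geN1 cos_le1. Qed.

Lemma sin_kernel_le1 x y : `|sin_kernel x y| <= 1.
Proof. by rewrite ler_norml sin_geN1 sin_le1. Qed.

Lemma cos_kernel_sym x y : cos_kernel x y = cos_kernel y x.
Proof. by rewrite /cos_kernel (mulrC x). Qed.

Lemma sin_kernel_sym x y : sin_kernel x y = sin_kernel y x.
Proof. by rewrite /sin_kernel (mulrC x). Qed.

Local Notation Tc := (kernel_op leb cos_kernel).
Local Notation Ts := (kernel_op leb sin_kernel).

Let mtri Y : measurable_fun setT (tri Y : X -> R).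
Proof. by rewrite /tri; mble. Qed.

Let tri_ge0 Y y : 0 < Y -> 0 <= tri Y y.
Proof.
move=> Y0; rewrite /tri; case: (boolP (0 <= y <= Y)) => [/andP[y0 yY]|_].
  by rewrite mul1r subr_ge0 ler_pdivrMr// mul1r.
by rewrite mul0r.
Qed.

Let integral_tri Y : 0 < Y -> (\int[leb]_y (`|tri Y y|)%:E <= Y%:E)%E.
Proof.
move=> Y0; apply: (@le_trans _ _ (\int[leb]_y (((0 <= y) && (y <= Y))%R%:R)%:E)%E).
  apply: le_integral_ge0 => y; first by [].
  rewrite lee_fin ger0_norm ?tri_ge0// /tri.
  case: (boolP (0 <= y <= Y)) => [/andP[y0 yY]|_]; last by rewrite mul0r.
  by rewrite mul1r gerBl divr_ge0// ltW.
rewrite integral_natmulb; last by mble.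
rewrite (_ : [set x | _] = `[0, Y]%classic); last first.
  by apply/seteqP; split => y /=; rewrite in_itv.
apply: (@le_trans _ _ (lebesgue_measure (`[0%R, Y]%classic : set R))); first exact: lexx.
by rewrite lebesgue_measure_itv/= lte_fin Y0 sube0.
Qed.

Let tri_L1 Y : 0 < Y -> L1r (tri Y).
Proof.
move=> Y0; have mt := @mtri Y; apply/integrableP; split; first by mble.
exact: le_lt_trans (integral_tri Y0) (ltry _).
Qed.

Let distance_volume (x r : R) : 0 < r ->
  (leb [set y | (`|x - y| < r)%R] <= (2 * r)%:E)%E.
Proof.
move=> r0; rewrite (_ : [set y | _] = `]x - r, x + r[%classic); last first.
  by apply/seteqP; split => y /=; rewrite in_itv/= ltr_distlC.
apply: (@le_trans _ _ (lebesgue_measure (`]x - r, x + r[%classic : set R))); first exact: lexx.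
rewrite lebesgue_measure_itv/= lte_fin ltrD2l (_ : - r < r); last by lra.
by rewrite -EFinB lee_fin; lra.
Qed.

Let fejer (Y x y : R) : R :=
  Y * (`|x - y| < Y^-1)%R%:R + Y^-1 * ((Y^-1 <= `|x - y|)%R%:R * `|x - y| `^ (- 2)).

Let fejer_mass Y x : 0 < Y -> (\int[leb]_y (fejer Y x y)%:E <= 10%:E)%E.
Proof.
move=> Y0; have Yi : 0 < Y^-1 by rewrite invr_gt0.
have md : measurable_fun setT (fun y : X => `|x - y|) by mble.
rewrite /fejer integralD_ge0; [|by mble|by mble|by move=> y; nng|by move=> y; nng].
rewrite !integralZl_ge0; try by [mble|nng|move=> y; nng].
rewrite integral_natmulb; last by mble.
apply: (@le_trans _ _ (Y%:E * (2 * Y^-1)%:E +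
    Y^-1%:E * (2 * 2 * 2 / (2 - 1) * (Y^-1) `^ (1 - 2))%:E)%E).
  apply: leeD; apply: lee_wpmul2l; do ?by nng.
    exact: distance_volume.
  apply: weight_tail => //; last by lra.
  exact: distance_volume.
rewrite -!EFinM -EFinD lee_fin (_ : 1 - 2 = -1); last by lra.
rewrite powR_inv1 ?(ltW Yi)// le_eqVlt; apply/orP; left; apply/eqP.
by field; rewrite gt_eqF.
Qed.

Let triangle_kernel_le Y x x' : 0 < Y ->
  `|Tc (fun y => tri Y y * cos_kernel x y) x' +
    Ts (fun y => tri Y y * sin_kernel x y) x'| <= fejer Y x x'.
Proof.
move=> Y0; have Yi : 0 < Y^-1 by rewrite invr_gt0.
have mt := @mtri Y; have it := tri_L1 Y0.
have mcx := measurable_kernel2 measurable_cos_kernel x.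
have msx := measurable_kernel2 measurable_sin_kernel x.
have i1 : L1r (fun y => tri Y y * cos_kernel x y).
  apply: (integrable_dominated it); [by mble|move=> y].
  by rewrite normrM ler_piMr// cos_kernel_le1.
have i2 : L1r (fun y => tri Y y * sin_kernel x y).
  apply: (integrable_dominated it); [by mble|move=> y].
  by rewrite normrM ler_piMr// sin_kernel_le1.
have j1 := integrable_kernel_op measurable_cos_kernel cos_kernel_le1 x' i1.
have j2 := integrable_kernel_op measurable_sin_kernel sin_kernel_le1 x' i2.
rewrite /kernel_op -RintegralD//.
pose c := 2 * pi * (x - x').
rewrite (_ : \int[leb]_y _ = \int[leb]_y (tri Y y * cos (c * y)))%R; last first.
  apply: eq_Rintegral => y _; rewrite /cos_kernel /sin_kernel.
  rewrite (_ : c * y = 2 * pi * (x * y) - 2 * pi * (y * x')); last by rewrite /c; ring.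
  by rewrite cosB; ring.
rewrite /fejer; case: (ltP `|x - x'| Y^-1) => [d1|d1].
  rewrite mulr1 mul0r mulr0 addr0.
  have itc : L1r (fun y => tri Y y * cos (c * y)).
    apply: (integrable_dominated it).
      apply: measurable_funM => //; apply: (measurableT_comp mcos); by mble.
    by move=> y; rewrite /= normrM ler_piMr// ler_norml cos_geN1 cos_le1.
  rewrite -lee_fin EFin_normr_Rintegral//.
  apply: le_trans (le_abse_integral _ measurableT (measurable_int _ itc)) _.
  apply: le_trans (integral_tri Y0).
  apply: le_integral_ge0 => y; first by [].
  by rewrite lee_fin normrM ler_piMr// ler_norml cos_geN1 cos_le1.
rewrite mulr0 add0r mul1r.
have d0 : 0 < `|x - x'| by exact: lt_le_trans d1.
have c0 : c != 0.
  apply: mulf_neq0; last by rewrite -normr_eq0 gt_eqF.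
  by rewrite gt_eqF// mulr_gt0// pi_gt0.
rewrite integral_triangle_cos//.
have c2 : 2 * `|x - x'| ^+ 2 <= c ^+ 2.
  rewrite /c !exprMn real_normK ?num_real//; apply: ler_wpM2r; first by nng.
  by have := pi_ge2 R; nra.
have c20 : 0 < c ^+ 2 by rewrite exprn_even_gt0.
have cc1 := cos_le1 (c * Y); have cc2 := cos_geN1 (c * Y).
rewrite ger0_norm; last by apply: divr_ge0; [lra|apply: mulr_ge0; exact: ltW].
rewrite powRN powR_mulrn//.
rewrite ler_pdivrMr; last exact: mulr_gt0.
rewrite (_ : Y^-1 * _ * _ = c ^+ 2 / `|x - x'| ^+ 2); last first.
  by field; rewrite !gt_eqF.
apply: (@le_trans _ _ 2); first by lra.
by rewrite ler_pdivlMr ?exprn_gt0.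
Qed.

(** Schur's test gives the constant [2 * 10 = 20] for the form damped by a
    triangle on [[0, Y]].  The triangle is at least [1/2] on [[0, Y/2]], so
    [Y -> +oo] gives 40 on the half-line, and evenness gives 80. *)
Lemma plancherel_line (u : X -> R) : L1r u ->
  (\int[leb]_y (Tc u y ^+ 2 + Ts u y ^+ 2)%:E <= 80%:E * \int[leb]_x (u x ^+ 2)%:E)%E.
Proof.
move=> iu; have mu0 := measurable_L1r iu.
pose G y := Tc u y ^+ 2 + Ts u y ^+ 2.
have G0 y : 0 <= G y by rewrite /G; nng.
have mG : measurable_fun setT G.
  have m1 := measurable_kernel_op leb measurable_cos_kernel mu0.
  have m2 := measurable_kernel_op leb measurable_sin_kernel mu0.
  by rewrite /G; mble.
have damped Y : 0 < Y ->
    (\int[leb]_y (tri Y y * G y)%:E <= 20%:E * \int[leb]_x (u x ^+ 2)%:E)%E.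
  move=> Y0; rewrite (_ : 20 = 2 * 10) ; last by lra.
  apply: (@damped_form_le _ _ _ leb cos_kernel sin_kernel measurable_cos_kernel
    measurable_sin_kernel cos_kernel_le1 sin_kernel_le1 cos_kernel_sym
    sin_kernel_sym (tri Y) (tri_L1 Y0) _ (fejer Y) 10 u iu) => //.
  - by move=> y; exact: tri_ge0.
  - by rewrite /fejer; mble.
  - by move=> x y; rewrite /fejer distrC.
  - by move=> x y; exact: triangle_kernel_le.
  - by move=> x; exact: fejer_mass.
have tpos n y : 0 <= tri n.+1%:R y by apply: tri_ge0; rewrite ltr0Sn.
have half : (\int[leb]_y ((0 <= y)%R%:R * G y)%:E <= 40%:E * \int[leb]_x (u x ^+ 2)%:E)%E.
  apply: (@fatou_eventually _ _ _ leb (fun n y => 2 * (tri n.+1%:R y * G y))).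
  - by move=> n; have mt := @mtri n.+1%:R; mble.
  - by move=> n y; have t0 := tpos n y; nng.
  - by move=> y; nng.
  - move=> y; case: (leP 0 y) => y0; last first.
      by exists 0%N => n _; have t0 := tpos n y; rewrite mul0r; nng.
    exists (Num.truncn (2 * y)) => n ny.
    have yn : 2 * y <= n.+1%:R.
      by apply: (le_trans (ltW (truncnS_gt _))); rewrite ler_nat ltnS.
    have n0 : 0 < n.+1%:R :> R by rewrite ltr0Sn.
    rewrite mulrA; apply: ler_wpM2r => //; rewrite /tri y0 (_ : y <= n.+1%:R); last by lra.
    have yn2 : y / n.+1%:R <= 2^-1 by rewrite ler_pdivrMr//; lra.
    have two (z : R) : z <= 2^-1 -> 1 <= 2 * (1 - z) by lra.
    by rewrite /= mul1r; exact: two.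
  - move=> n; have mt := @mtri n.+1%:R; have t0 := tpos n.
    rewrite integralZl_ge0; [|by mble|by []|by move=> y; apply: mulr_ge0].
    rewrite (_ : 40 = 2 * 20); last by lra.
    by rewrite EFinM -muleA; apply: lee_wpmul2l; [nng|exact: damped].
have Geven y : G (- y) = G y.
  rewrite /G; congr (_ + _).
    congr (_ ^+ 2); apply: eq_Rintegral => x _.
    by rewrite /cos_kernel !mulrN cosN.
  rewrite -sqrrN; congr (_ ^+ 2); rewrite -mulN1r -kernel_opZ//; last 2 first.
  - exact: measurable_sin_kernel.
  - exact: sin_kernel_le1.
  by apply: eq_Rintegral => x _; rewrite /sin_kernel !mulrN sinN; ring.
have half' : (\int[leb]_y ((y <= 0)%R%:R * G y)%:E <= 40%:E * \int[leb]_x (u x ^+ 2)%:E)%E.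
  apply: le_trans half.
  have mEG : measurable_fun setT (EFin \o G) by mble.
  have := @ge0_integration_by_substitution0 R (EFin \o G) mEG G0.
  rewrite integral_mkcond [in RHS]integral_mkcond.
  rewrite (_ : (_ \_ `[0%R, +oo[)%E = fun y => ((0 <= y)%R%:R * G y)%:E); last first.
    apply/funext => y; rewrite patchE mem_setE in_itv/= andbT.
    by case: (0 <= y); rewrite ?mul1r ?mul0r.
  rewrite (_ : (_ \_ `]-oo, 0%R])%E = fun y => ((y <= 0)%R%:R * G y)%:E); last first.
    apply/funext => y; rewrite patchE mem_setE in_itv/= Geven.
    by case: (y <= 0); rewrite ?mul1r ?mul0r.
  by move=> ->.
apply: (@le_trans _ _ (\int[leb]_y ((0 <= y)%R%:R * G y + (y <= 0)%R%:R * G y)%:E)%E).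
  apply: le_integral_ge0 => y; first by nng.
  rewrite lee_fin -/(G y); case: (leP 0 y) => y0; first by rewrite mul1r lerDl; nng.
  by rewrite (ltW y0) mul0r mul1r add0r.
rewrite integralD_ge0; [|by mble|by mble|by move=> y; nng|by move=> y; nng].
rewrite (_ : 80 = 40 + 40); last by lra.
rewrite EFinD ge0_muleDl//; exact: leeD.
Qed.

End plancherel1.

(** * The L2 bound for product kernels *)

(** The measurability of the transform is included because [mu] need not be
    sigma-finite, so that it does not follow from that of the kernel. *)
Definition L2_bounded d (X : measurableType d) (R : realType)
    (mu : {measure set X -> \bar R}) (K : X -> X -> R) :=
  exists2 A : R, 0 <= A & forall u : X -> R, mu.-integrable setT (EFin \o u) ->
    measurable_fun setT (kernel_op mu K u) /\
    (\int[mu]_y (kernel_op mu K u y ^+ 2)%:E <= A%:E * \int[mu]_x (u x ^+ 2)%:E)%E.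

Section L2_bounded_sum.
Context d (X : measurableType d) (R : realType).
Variable mu : {measure set X -> \bar R}.
Variables K1 K2 : X -> X -> R.
Hypothesis mK1 : measurable_fun setT (fun z : X * X => K1 z.1 z.2).
Hypothesis mK2 : measurable_fun setT (fun z : X * X => K2 z.1 z.2).
Hypothesis K11 : forall x y, `|K1 x y| <= 1.
Hypothesis K21 : forall x y, `|K2 x y| <= 1.

Lemma L2_bounded_comb (c : R) : `|c| <= 1 -> L2_bounded mu K1 -> L2_bounded mu K2 ->
  L2_bounded mu (fun x y => K1 x y + c * K2 x y).
Proof.
move=> c1 [A1 A10 H1] [A2 A20 H2]; exists (2 * A1 + 2 * A2); first by nng.
move=> u iu; have mu0 := measurable_L1r iu.
have [m1 {}H1] := H1 u iu; have [m2 {}H2] := H2 u iu.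
have i1 y := integrable_kernel_op mK1 K11 y iu.
have i2 y := integrable_kernel_op mK2 K21 y iu.
have E y : kernel_op mu (fun x y => K1 x y + c * K2 x y) u y =
    kernel_op mu K1 u y + c * kernel_op mu K2 u y.
  rewrite /kernel_op -RintegralZl// -RintegralD//.
    by apply: eq_Rintegral => x _; ring.
  exact: (integrableZl measurableT _ (i2 y)).
split.
  by rewrite (_ : kernel_op _ _ u = fun y => kernel_op mu K1 u y + c * kernel_op mu K2 u y);
    [mble|exact/funext].
apply: (@le_trans _ _ (\int[mu]_y (2 * kernel_op mu K1 u y ^+ 2 +
    2 * kernel_op mu K2 u y ^+ 2)%:E)%E).
  apply: le_integral_ge0 => y; first by nng.
  rewrite lee_fin E; set a := kernel_op mu K1 u y; set b := kernel_op mu K2 u y.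
  have : (c * b) ^+ 2 <= b ^+ 2.
    rewrite exprMn -[leRHS]mul1r; apply: ler_wpM2r; first by nng.
    by rewrite -real_normK ?num_real// exprn_ile1.
  by have := sqr_ge0 (a - c * b); rewrite !sqrrD; nra.
rewrite integralD_ge0; [|by mble|by mble|by move=> y; nng|by move=> y; nng].
rewrite !integralZl_ge0; try by [mble|nng|move=> y; nng].
rewrite [(2 * A1 + _)%:E]EFinD ge0_muleDl; [|by nng|by nng].
by rewrite [(2 * A1)%:E]EFinM [(2 * A2)%:E]EFinM -!muleA; apply: leeD; apply: lee_wpmul2l; [nng|exact: H1|nng|exact: H2].
Qed.

End L2_bounded_sum.

Section L2_bounded_pushforward.
Context d d' (X : measurableType d) (Z : measurableType d') (R : realType).
Variable mu : {measure set X -> \bar R}.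
Variable nu : {measure set Z -> \bar R}.
Variable phi : X -> Z.
Hypothesis mphi : measurable_fun setT phi.
Hypothesis nuE : forall A, measurable A -> nu A = mu (phi @^-1` A).

Lemma ge0_integral_transport (f : Z -> R) : measurable_fun setT f ->
  (forall z, 0 <= f z) -> (\int[nu]_z (f z)%:E = \int[mu]_x (f (phi x))%:E)%E.
Proof.
move=> mf f0; rewrite (eq_measure_integral (pushforward mu phi)).
  rewrite ge0_integral_pushforward//; first by mble.
  by move=> z _; nng.
by move=> A mA _; rewrite nuE.
Qed.

Lemma integrable_transport (f : Z -> R) : nu.-integrable setT (EFin \o f) ->
  mu.-integrable setT (EFin \o (f \o phi)).
Proof.
move=> intf; have mf : measurable_fun setT f by move/measurable_int : (intf) => /measurable_EFinP.
apply/integrableP; split; first by apply/measurable_EFinP; exact: measurableT_comp.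
rewrite -(@ge0_integral_transport (fun z => `|f z|)); [|by mble|by []].
by have /integrableP[] := intf.
Qed.

Lemma Rintegral_transport (f : Z -> R) : nu.-integrable setT (EFin \o f) ->
  (\int[nu]_z f z = \int[mu]_x f (phi x))%R.
Proof.
move=> intf; rewrite /Rintegral; congr fine.
rewrite (eq_measure_integral (pushforward mu phi)); last first.
  by move=> A mA _; rewrite nuE.
have mf : measurable_fun setT (fun z => (f z)%:E) by exact: measurable_int intf.
rewrite integral_pushforward//; exact: integrable_transport.
Qed.

End L2_bounded_pushforward.

Section L2_bounded_transport.
Context d d' (X : measurableType d) (Z : measurableType d') (R : realType).
Variable mu : {measure set X -> \bar R}.
Variable nu : {sigma_finite_measure set Z -> \bar R}.
Variable phi : X -> Z.
Hypothesis mphi : measurable_fun setT phi.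
Hypothesis nuE : forall A, measurable A -> nu A = mu (phi @^-1` A).

Lemma L2_bounded_transport (K : Z -> Z -> R) :
  measurable_fun setT (fun z : Z * Z => K z.1 z.2) -> (forall x y, `|K x y| <= 1) ->
  L2_bounded mu (fun x y => K (phi x) (phi y)) -> L2_bounded nu K.
Proof.
move=> mK K1 [A A0 H]; exists A => // u iu; have mu0 := measurable_L1r iu.
have mT := measurable_kernel_op nu mK mu0; split => //.
rewrite !(ge0_integral_transport mphi nuE); try by [mble|move=> z; nng].
have [_] := H _ (integrable_transport mphi nuE iu).
rewrite (_ : \int[mu]_y _ = \int[mu]_y (kernel_op nu K u (phi y) ^+ 2)%:E)%E//.
apply: eq_integral => y _; congr ((_ ^+ 2)%:E).
rewrite /kernel_op (Rintegral_transport mphi nuE)//.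
exact: integrable_kernel_op.
Qed.

End L2_bounded_transport.

(** Iterating the bound in each variable; for almost every point the sections
    of an integrable function are integrable. *)
Section L2_bounded_tensor.
Context d d' (X : measurableType d) (Y : measurableType d') (R : realType).
Variable m1 : {sigma_finite_measure set X -> \bar R}.
Variable m2 : {sigma_finite_measure set Y -> \bar R}.
Variables (k : X -> X -> R) (K : Y -> Y -> R).
Hypothesis mk : measurable_fun setT (fun z : X * X => k z.1 z.2).
Hypothesis mK : measurable_fun setT (fun z : Y * Y => K z.1 z.2).
Hypothesis k1 : forall x y, `|k x y| <= 1.
Hypothesis K1 : forall x y, `|K x y| <= 1.

Let kK (z z' : X * Y) := k z.1 z'.1 * K z.2 z'.2.

Lemma measurable_tensor :
  measurable_fun setT (fun z : (X * Y) * (X * Y) => kK z.1 z.2).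
Proof.
apply: measurable_funM.
  apply: (measurableT_comp mk (g := fun z : (X * Y) * (X * Y) => (z.1.1, z.2.1))).
  apply: measurable_fun_pair; apply: (measurableT_comp measurable_fst); mble.
apply: (measurableT_comp mK (g := fun z : (X * Y) * (X * Y) => (z.1.2, z.2.2))).
apply: measurable_fun_pair; apply: (measurableT_comp measurable_snd); mble.
Qed.

Lemma L2_bounded_tensor : L2_bounded m1 k -> L2_bounded m2 K ->
  L2_bounded (m1 \x m2)%E kK.
Proof.
move=> [A1 A10 H1] [A2 A20 H2]; exists (A1 * A2); first by nng.
move=> u iu; have mu0 := measurable_L1r iu.
pose us x y := u (x, y).
have mus x : measurable_fun setT (us x) by exact: (measurableT_comp mu0 (pair1_measurable x)).
pose G x y' := kernel_op m2 K (us x) y'.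
have mG : measurable_fun setT (fun z : X * Y => G z.1 z.2).
  apply: (@measurable_Rintegral_param _ _ _ _ _ m2
    (fun z : (X * Y) * Y => u (z.1.1, z.2) * K z.2 z.1.2)).
  apply: measurable_funM.
    apply: (measurableT_comp mu0); apply: measurable_fun_pair; last by mble.
    by apply: (measurableT_comp measurable_fst); mble.
  apply: (measurableT_comp mK (g := fun z : (X * Y) * Y => (z.2, z.1.2))).
  apply: measurable_fun_pair; first by mble.
  by apply: (measurableT_comp measurable_snd); mble.
have us_int : {ae m1, forall x, m2.-integrable setT (EFin \o us x)}.
  exact: (ae_integrable1 iu).
have iG y' : m1.-integrable setT (EFin \o (G ^~ y')).
  have mGy : measurable_fun setT (G ^~ y') by exact: (measurableT_comp mG (pair2_measurable y')).
  apply/integrableP; split; first by mble.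
  apply: le_lt_trans ((integrable12ltyP _ _ _).1 iu); last by mble.
  apply: le_integral_ge0 => x; first by [].
  have [foo|] := ltP (\int[m2]_y `|(EFin \o u) (x, y)|)%E +oo%E; last first.
    by rewrite leye_eq => /eqP ->; rewrite leey.
  apply: kernel_op_le => //; apply/integrableP; split => //.
  exact/measurable_EFinP.
have TE : forall y0 y', kernel_op (m1 \x m2)%E kK u (y0, y') = kernel_op m1 k (G ^~ y') y0.
  move=> y0 y'; rewrite /kernel_op /Rintegral; congr fine.
  have iuk : (m1 \x m2)%E.-integrable setT (fun z => (u z * kK z (y0, y'))%:E).
    apply: (integrable_kernel_op measurable_tensor _ _ iu) => x y.
    by rewrite normrM mulr_ile1.
  rewrite -(integral12_prod_meas1 iuk).
  have iGk := integrable_kernel_op mk k1 y0 (iG y').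
  apply: ae_eq_integral => //.
  - exact: (measurable_fubini_F iuk).
  - exact: measurable_int iGk.
  apply: filterS us_int => x ix _; rewrite /fubini_F /kK/=.
  rewrite /G /kernel_op /Rintegral EFinM fineK; last first.
    by apply: integrable_fin_num => //; exact: (integrable_kernel_op mK K1 y' ix).
  rewrite muleC -integralZl//; last exact: (integrable_kernel_op mK K1 y' ix).
  by apply: eq_integral => y _; rewrite -EFinM /us; congr (_%:E); ring.
have mTu : measurable_fun setT (kernel_op (m1 \x m2)%E kK u).
  rewrite (_ : kernel_op _ _ _ = fun z => \int[m1]_x (G x z.2 * k x z.1)); last first.
    by apply/funext => -[y0 y']; exact: TE.
  apply: (@measurable_Rintegral_param _ _ _ _ _ m1
    (fun z : (X * Y) * X => G z.2 z.1.2 * k z.2 z.1.1)).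
  apply: measurable_funM.
    apply: (measurableT_comp mG (g := fun z : (X * Y) * X => (z.2, z.1.2))).
    apply: measurable_fun_pair; first by mble.
    by apply: (measurableT_comp measurable_snd); mble.
  apply: (measurableT_comp mk (g := fun z : (X * Y) * X => (z.2, z.1.1))).
  apply: measurable_fun_pair; first by mble.
  by apply: (measurableT_comp measurable_fst); mble.
split=> //; pose Tu := kernel_op (m1 \x m2)%E kK u.
rewrite -/Tu in mTu TE *; clearbody Tu.
have sq0 z : (0 <= (Tu z ^+ 2)%:E)%E by rewrite lee_fin sqr_ge0.
have msq : measurable_fun setT (fun z => (Tu z ^+ 2)%:E).
  by apply/measurable_EFinP; exact: measurable_funX.
have us0 z : (0 <= (u z ^+ 2)%:E)%E by nng.
have mus2 : measurable_fun setT (fun z => (u z ^+ 2)%:E) by mble.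
rewrite (fubini_tonelli2 _ msq sq0) (fubini_tonelli1 _ mus2 us0).
pose g (z : X * Y) := (G z.1 z.2 ^+ 2)%:E.
have mg : measurable_fun setT g.
  by apply/measurable_EFinP; apply: measurable_funX.
have g0 z : (0 <= g z)%E by rewrite /g; nng.
apply: (@le_trans _ _ (\int[m2]_y' (A1%:E * \int[m1]_x g (x, y')))%E).
  apply: le_integral_ge0 => y'; first by apply: integral_ge0.
  by rewrite /fubini_G; under eq_integral do rewrite TE; exact: (H1 _ (iG y')).2.
have mG2 : measurable_fun setT (fun y' => \int[m1]_x g (x, y'))%E.
  exact: (measurable_fun_fubini_tonelli_G _ mg g0).
have mF2 : measurable_fun setT (fun x => \int[m2]_y' g (x, y'))%E.
  exact: (measurable_fun_fubini_tonelli_F _ mg g0).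
have mU2 : measurable_fun setT (fun x => \int[m2]_y (u (x, y) ^+ 2)%:E)%E.
  exact: (measurable_fun_fubini_tonelli_F _ mus2 us0).
rewrite ge0_integralZl_EFin//; last by move=> y _; apply: integral_ge0.
rewrite EFinM -muleA; apply: lee_wpmul2l; first by nng.
rewrite -(fubini_tonelli _ mg g0).
rewrite -ge0_integralZl_EFin//; last by move=> x _; apply: integral_ge0 => y _; nng.
apply: ae_ge0_le_integral => //.
- by move=> x _; apply: integral_ge0.
- by move=> x _; apply: mule_ge0; [nng|apply: integral_ge0 => y _; nng].
- exact: measurable_funeM.
by apply: filterS us_int => x ix _; exact: (H2 (us x) ix).2.
Qed.

End L2_bounded_tensor.

(** * The L2 bound for the Fourier kernels of R^n *)

Section tuples.
Context (R : realType).
Local Notation Rn n := (n.-tuple (measurableTypeR R)).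
Local Notation mu n := (@lebesgue_tuple R n).

Definition cos_dot n (x y : Rn n) : R := cos (2 * pi * dotp x y).
Definition sin_dot n (x y : Rn n) : R := sin (2 * pi * dotp x y).

Lemma measurable_coord n (i : 'I_n) :
  measurable_fun setT (fun x : Rn n => (tnth x i : R)).
Proof. exact: measurable_tnth. Qed.

Lemma measurable_dotp n : measurable_fun setT (fun z : Rn n * Rn n => dotp z.1 z.2).
Proof.
apply: measurable_sum => i; apply: measurable_funM.
  exact: (measurableT_comp (measurable_coord i) measurable_fst).
exact: (measurableT_comp (measurable_coord i) measurable_snd).
Qed.

Lemma measurable_cos_dot n :
  measurable_fun setT (fun z : Rn n * Rn n => cos_dot z.1 z.2).
Proof.
apply: (measurableT_comp (continuous_measurable_fun (@continuous_cos R))).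
by apply: measurable_funM => //; exact: measurable_dotp.
Qed.

Lemma measurable_sin_dot n :
  measurable_fun setT (fun z : Rn n * Rn n => sin_dot z.1 z.2).
Proof.
apply: (measurableT_comp (continuous_measurable_fun (@continuous_sin R))).
by apply: measurable_funM => //; exact: measurable_dotp.
Qed.

Lemma cos_dot_le1 n (x y : Rn n) : `|cos_dot x y| <= 1.
Proof. by rewrite ler_norml cos_geN1 cos_le1. Qed.

Lemma sin_dot_le1 n (x y : Rn n) : `|sin_dot x y| <= 1.
Proof. by rewrite ler_norml sin_geN1 sin_le1. Qed.

Lemma dotpC n (x y : Rn n) : dotp x y = dotp y x.
Proof. by apply: eq_bigr => i _; rewrite mulrC. Qed.

Lemma dotp_cons n (z z' : measurableTypeR R * Rn n) :
  dotp (tuple_cons z) (tuple_cons z') = z.1 * z'.1 + dotp z.2 z'.2.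
Proof.
rewrite /dotp big_ord_recl; congr (_ + _); apply: eq_bigr => i _.
by rewrite !tnthS.
Qed.

(** By induction on [n]: the addition formulas for [cos] and [sin] write the
    kernels in dimension [n + 1] as combinations of two products of kernels in
    dimensions 1 and [n]. *)
Lemma L2_bounded_dot n :
  L2_bounded (mu n) (@cos_dot n) /\ L2_bounded (mu n) (@sin_dot n).
Proof.
elim: n => [|n [IHc IHs]].
  have K1 (K : Rn 0 -> Rn 0 -> R) : (forall x y, `|K x y| <= 1) -> L2_bounded (mu 0%N) K.
    move=> K1; exists 1 => // u iu; have mu0 := measurable_L1r iu.
    have m0 (f : Rn 0 -> R) : measurable_fun setT f ->
        (\int[mu 0%N]_y (f y)%:E = (f [tuple])%:E)%E.
      move=> mf; rewrite integral_dirac//; last by mble.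
      by rewrite diracE mem_set// mul1e.
    have mf (f : Rn 0 -> R) : measurable_fun setT f.
      rewrite (_ : f = cst (f [tuple])); first by mble.
      by apply/funext => y; rewrite /= (tuple0 y).
    split; first exact: mf.
    rewrite mul1e !m0// lee_fin /kernel_op /Rintegral m0//= exprMn.
    rewrite -[leRHS]mulr1; apply: ler_wpM2l; first by nng.
    by rewrite -real_normK ?num_real// exprn_ile1.
  by split; apply: K1; [exact: cos_dot_le1|exact: sin_dot_le1].
have kL2 (k : R -> R -> R) :
    measurable_fun setT (fun z : measurableTypeR R * measurableTypeR R => k z.1 z.2) ->
    (forall u y, kernel_op (@lebesgue_measure R) k u y ^+ 2 <=
    kernel_op (@lebesgue_measure R) (@cos_kernel R) u y ^+ 2 +
    kernel_op (@lebesgue_measure R) (@sin_kernel R) u y ^+ 2) ->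
    L2_bounded (@lebesgue_measure R) k.
  move=> mk H; exists 80; first by nng.
  move=> u iu; split; first exact: (measurable_kernel_op _ mk (measurable_L1r iu)).
  apply: le_trans (plancherel_line iu).
  by apply: le_integral_ge0 => y; [nng|rewrite lee_fin].
have Hc : L2_bounded (@lebesgue_measure R) (@cos_kernel R).
  by apply: kL2 => [|u y]; [exact: measurable_cos_kernel|rewrite lerDl sqr_ge0].
have Hs : L2_bounded (@lebesgue_measure R) (@sin_kernel R).
  by apply: kL2 => [|u y]; [exact: measurable_sin_kernel|rewrite lerDr sqr_ge0].
have cc := L2_bounded_tensor (@measurable_cos_kernel R) (@measurable_cos_dot n)
  (@cos_kernel_le1 R) (@cos_dot_le1 n) Hc IHc.
have ss := L2_bounded_tensor (@measurable_sin_kernel R) (@measurable_sin_dot n)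
  (@sin_kernel_le1 R) (@sin_dot_le1 n) Hs IHs.
have sc := L2_bounded_tensor (@measurable_sin_kernel R) (@measurable_cos_dot n)
  (@sin_kernel_le1 R) (@cos_dot_le1 n) Hs IHc.
have cs := L2_bounded_tensor (@measurable_cos_kernel R) (@measurable_sin_dot n)
  (@cos_kernel_le1 R) (@sin_dot_le1 n) Hc IHs.
have mul_le1 (a b : R) : `|a| <= 1 -> `|b| <= 1 -> `|a * b| <= 1.
  by move=> a1 b1; rewrite normrM mulr_ile1.
have mt := @measurable_tuple_cons _ (measurableTypeR R) n.
pose m12 := [the {measure set (measurableTypeR R * Rn n)%type -> \bar R} of
  (lebesgue_measure \x mu n)%E].
have nuE A : measurable A -> mu n.+1 A = m12 ((@tuple_cons _ _ n) @^-1` A) by [].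
have tr := L2_bounded_transport mt nuE.
split.
  apply: tr; [exact: measurable_cos_dot|exact: cos_dot_le1|].
  rewrite (_ : (fun x y => _) = fun z z' => cos_kernel z.1 z'.1 * cos_dot z.2 z'.2 +
      (-1) * (sin_kernel z.1 z'.1 * sin_dot z.2 z'.2)); last first.
    by apply/funext => z; apply/funext => z'; rewrite /cos_dot dotp_cons mulrDr cosD mulN1r.
  apply: (L2_bounded_comb (measurable_tensor (@measurable_cos_kernel R) (@measurable_cos_dot n))
    (measurable_tensor (@measurable_sin_kernel R) (@measurable_sin_dot n)) _ _ _ cc ss).
  - by move=> x y; apply: mul_le1; [exact: cos_kernel_le1|exact: cos_dot_le1].
  - by move=> x y; apply: mul_le1; [exact: sin_kernel_le1|exact: sin_dot_le1].
  - by rewrite normrN normr1.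
apply: tr; [exact: measurable_sin_dot|exact: sin_dot_le1|].
rewrite (_ : (fun x y => _) = fun z z' => sin_kernel z.1 z'.1 * cos_dot z.2 z'.2 +
    1 * (cos_kernel z.1 z'.1 * sin_dot z.2 z'.2)); last first.
  by apply/funext => z; apply/funext => z'; rewrite /sin_dot dotp_cons mulrDr sinD mul1r.
apply: (L2_bounded_comb (measurable_tensor (@measurable_sin_kernel R) (@measurable_cos_dot n))
  (measurable_tensor (@measurable_cos_kernel R) (@measurable_sin_dot n)) _ _ _ sc cs).
- by move=> x y; apply: mul_le1; [exact: sin_kernel_le1|exact: cos_dot_le1].
- by move=> x y; apply: mul_le1; [exact: cos_kernel_le1|exact: sin_dot_le1].
- by rewrite normr1.
Qed.

End tuples.

(** * Pitt's inequality for the Fourier transform *)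

Section volumes.
Context (R : realType) (n : nat).
Local Notation Rn := (n.-tuple (measurableTypeR R)).
Local Notation mu := (@lebesgue_tuple R n).

Lemma coord_le_enorm (x : Rn) i : `|tnth x i : R| <= enorm x.
Proof.
rewrite -sqrtr_sqr /enorm; apply: ler_wsqrtr.
rewrite /dotp (bigD1 i)//= -expr2 lerDl.
by apply: sumr_ge0 => j _; rewrite -expr2 sqr_ge0.
Qed.

Lemma measurable_enorm : measurable_fun setT (@enorm R n).
Proof.
apply: (measurableT_comp (continuous_measurable_fun (@sqrt_continuous R))).
exact: (measurableT_comp (@measurable_dotp R n) (measurable_fun_pair (@measurable_id _ _ _) (@measurable_id _ _ _))).
Qed.

Lemma measurable_eball (x : Rn) r : measurable (eball x r).
Proof.
apply: measurable_setb; apply: measurable_fun_ltr; last exact: measurable_cst.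
apply: (measurableT_comp (continuous_measurable_fun (@sqrt_continuous R))).
apply: measurable_sum => i; apply: measurable_funX; apply: measurable_funB => //.
exact: measurable_coord.
Qed.

Lemma measurable_box (A : 'I_n -> set (measurableTypeR R)) :
  (forall i, measurable (A i)) -> measurable [set y : Rn | forall i, A i (tnth y i)].
Proof.
move=> mA; rewrite (_ : [set _ | _] = \bigcap_(i in [set: 'I_n])
    ((fun t : Rn => tnth t i) @^-1` A i)).
  apply: fin_bigcap_measurable => [|i _]; first exact: finite_finset.
  by rewrite -[X in measurable X]setTI; exact: measurable_tnth.
by apply/seteqP; split => t /= At i; [move=> _; exact: At|exact: At].
Qed.

Lemma box_volume (a b : 'I_n -> R) : (forall i, a i <= b i) ->
  mu [set y | forall i, (`[a i, b i[%classic : set R) (tnth y i)] =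
  (\prod_(i < n) (b i - a i))%:E.
Proof.
move=> ab.
have mA (i : 'I_n) : measurable (`[a i, b i[%classic : set (measurableTypeR R)).
  exact: measurable_itv.
rewrite [LHS](lebesgue_tuple_box mA) -prodEFin; apply: eq_bigr => i _.
transitivity (lebesgue_measure (`[a i, b i[%classic : set R)); first by [].
rewrite lebesgue_measure_itv /= lte_fin -EFinB.
by case: ltgtP (ab i) => // ->; rewrite subrr.
Qed.

Lemma eball_volume (x : Rn) (r : R) : 0 < r -> (mu (eball x r) <= ((2 * r) ^+ n)%:E)%E.
Proof.
move=> r0; pose a i : R := tnth x i - r; pose b i : R := tnth x i + r.
have ab i : a i <= b i by rewrite /a /b; lra.
have -> : ((2 * r) ^+ n)%:E = mu [set y : Rn | forall i, (`[a i, b i[%classic : set R) (tnth y i)].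
  rewrite box_volume// (eq_bigr (fun=> 2 * r)) ?prodr_const ?card_ord// => i _.
  by rewrite /a /b; ring.
apply: le_measure; rewrite ?inE.
- exact: measurable_eball.
- exact: (@measurable_box (fun i => `[a i, b i[%classic) (fun i => measurable_itv _)).
move=> y /= yr i; have : `|(tnth y i : R) - tnth x i| < r.
  apply: le_lt_trans yr; rewrite -sqrtr_sqr; apply: ler_wsqrtr.
  by rewrite (bigD1 i)//= lerDl; apply: sumr_ge0 => j _; rewrite sqr_ge0.
rewrite ltr_norml in_itv/= /a /b => /andP[h1 h2].
by apply/andP; split; [apply: ltW|]; rewrite -?ltrBlDl// -subr_gt0; move: h1; rewrite -subr_gt0; lra.
Qed.

Lemma enorm_eball0 (y : Rn) r : (eball [tuple of nseq n (0 : R)] r) y = (enorm y < r) :> Prop.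
Proof.
rewrite /eball /enorm /dotp /=; congr (is_true (Num.sqrt _ < r)).
by apply: eq_bigr => i _; rewrite tnth_nseq subr0 expr2.
Qed.

Lemma enorm_volume (r : R) : (0 < n)%N -> 0 < r ->
  (mu [set x | (enorm x ^+ n < r)%R] <= (2 ^+ n * r)%:E)%E.
Proof.
move=> n0 r0; have nR : n%:R != 0 :> R by rewrite pnatr_eq0 -lt0n.
have p0 : 0 < r `^ n%:R^-1 by exact: powR_gt0.
have pn : (r `^ n%:R^-1) ^+ n = r.
  by rewrite -powR_mulrn ?powR_ge0// -powRrM mulVf// powRr1// ltW.
rewrite (_ : [set x | _] = eball [tuple of nseq n (0 : R)] (r `^ n%:R^-1)).
  by apply: le_trans (eball_volume _ p0) _; rewrite exprMn pn.
apply/funext => x; rewrite enorm_eball0 -[in LHS]pn /=.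
by rewrite ltr_pXn2r// nnegrE ?sqrtr_ge0 ?(ltW p0).
Qed.

End volumes.

Section fourier_components.
Context (R : realType) (n : nat).
Local Notation Rn := (n.-tuple (measurableTypeR R)).
Local Notation mu := (@lebesgue_tuple R n).
Local Notation normc := ComplexField.Normc.normc.
Local Notation Tc := (kernel_op mu (@cos_dot R n)).
Local Notation Ts := (kernel_op mu (@sin_dot R n)).

Lemma normc_Re_le (z : R[i]) : `|complex.Re z| <= normc z.
Proof.
by case: z => a b /=; rewrite -sqrtr_sqr; apply: ler_wsqrtr; rewrite lerDl sqr_ge0.
Qed.

Lemma normc_Im_le (z : R[i]) : `|complex.Im z| <= normc z.
Proof.
by case: z => a b /=; rewrite -sqrtr_sqr; apply: ler_wsqrtr; rewrite lerDr sqr_ge0.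
Qed.

Lemma normc_le_ReIm (z : R[i]) : normc z <= `|complex.Re z| + `|complex.Im z|.
Proof.
case: z => a b /=.
rewrite -[leRHS]ger0_norm ?addr_ge0// -[leRHS]sqrtr_sqr; apply: ler_wsqrtr.
rewrite sqrrD !real_normK ?num_real//.
by have := mulr_ge0 (normr_ge0 a) (normr_ge0 b); lra.
Qed.

Lemma fourier_components (f : Rn -> R[i]) (y : Rn) : L1 f ->
  let u x := complex.Re (f x) in let v x := complex.Im (f x) in
  complex.Re (fourier f y) = Tc u y + Ts v y /\
  complex.Im (fourier f y) = Tc v y - Ts u y.
Proof.
move=> [iu iv] u v.
have i1 := integrable_kernel_op (@measurable_cos_dot R n) (@cos_dot_le1 R n) y iu.
have i2 := integrable_kernel_op (@measurable_sin_dot R n) (@sin_dot_le1 R n) y iu.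
have i3 := integrable_kernel_op (@measurable_cos_dot R n) (@cos_dot_le1 R n) y iv.
have i4 := integrable_kernel_op (@measurable_sin_dot R n) (@sin_dot_le1 R n) y iv.
rewrite /fourier /Cintegral/=; split.
  rewrite /kernel_op -RintegralD//; apply: eq_Rintegral => x _.
  rewrite /u /v /cos_dot /sin_dot (dotpC x y) /Cexpi cosN sinN.
  by case: (f x) => a b /=; ring.
rewrite /kernel_op -RintegralB//; apply: eq_Rintegral => x _.
rewrite /u /v /cos_dot /sin_dot (dotpC x y) /Cexpi cosN sinN.
by case: (f x) => a b /=; ring.
Qed.

End fourier_components.

Lemma powR_sum4 (R : realType) (a b c d s : R) : 0 < s ->
  0 <= a -> 0 <= b -> 0 <= c -> 0 <= d ->
  (a + b + (c + d)) `^ s <= 4 `^ s * ((a `^ s + b `^ s) + (c `^ s + d `^ s)).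
Proof.
move=> s0 a0 b0 c0 d0.
pose t (i : 'I_4) : R := [:: a; b; c; d]`_i.
have t0 i : 0 <= t i by case: i => -[|[|[|[|]]]].
have sum1 : \sum_(i < 4) 4^-1 <= 1 :> R.
  by rewrite !big_ord_recr big_ord0 /=; lra.
have i4 (i : 'I_4) : 0 < 4^-1 :> R by rewrite invr_gt0.
have := powR_sum_weights s0 t0 i4 sum1.
rewrite !big_ord_recr !big_ord0 /= /t /= !add0r invrK -!addrA => h.
apply: (le_trans h); rewrite ![_ * 4]mulrC !(@powRM R 4); try by nng.
by rewrite le_eqVlt; apply/orP; left; apply/eqP; ring.
Qed.

Lemma integral_powR_sum4 d (X : measurableType d) (R : realType)
    (mu : {measure set X -> \bar R}) (W h t1 t2 t3 t4 : X -> R) (s B B' : R) :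
  0 < s -> measurable_fun setT W -> measurable_fun setT t1 ->
  measurable_fun setT t2 -> measurable_fun setT t3 -> measurable_fun setT t4 ->
  (forall y, 0 <= W y) -> (forall y, 0 <= h y) ->
  (forall y, h y <= `|t1 y| + `|t2 y| + (`|t3 y| + `|t4 y|)) ->
  (\int[mu]_y ((W y * `|t1 y|) `^ s)%:E <= B%:E)%E ->
  (\int[mu]_y ((W y * `|t2 y|) `^ s)%:E <= B%:E)%E ->
  (\int[mu]_y ((W y * `|t3 y|) `^ s)%:E <= B'%:E)%E ->
  (\int[mu]_y ((W y * `|t4 y|) `^ s)%:E <= B'%:E)%E ->
  (\int[mu]_y ((W y * h y) `^ s)%:E <= (4 `^ s * ((B + B) + (B' + B')))%:E)%E.
Proof.
move=> s0 mW m1 m2 m3 m4 W0 h0 ht E1 E2 E3 E4.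
apply: (@le_trans _ _ (\int[mu]_y (4 `^ s * (((W y * `|t1 y|) `^ s + (W y * `|t2 y|) `^ s) +
   ((W y * `|t3 y|) `^ s + (W y * `|t4 y|) `^ s)))%:E)%E).
  apply: le_integral_ge0 => y; first by nng.
  rewrite lee_fin; apply: le_trans (powR_sum4 s0 _ _ _ _); try by nng.
  apply: ge0_ler_powR; rewrite ?nnegrE ?(ltW s0)//; first by apply: mulr_ge0.
  - by nng.
  by rewrite -!mulrDr; apply: ler_wpM2l.
rewrite integralZl_ge0; [|by mble|by nng|by move=> y; nng].
rewrite !integralD_ge0; try by [mble|move=> y; nng].
rewrite (EFinM (4 `^ s)) (EFinD (B + B)) (EFinD B) (EFinD B').
apply: lee_wpmul2l; first by rewrite lee_fin powR_ge0.
exact: (leeD (leeD E1 E2) (leeD E3 E4)).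
Qed.

Section sufficiency.
Context (R : realType) (n : nat).
Local Notation Rn := (n.-tuple (measurableTypeR R)).
Local Notation mu := (@lebesgue_tuple R n).
Local Notation normc := ComplexField.Normc.normc.
Local Notation Tc := (kernel_op mu (@cos_dot R n)).
Local Notation Ts := (kernel_op mu (@sin_dot R n)).
Hypothesis n_gt0 : (0 < n)%N.

Let nR : n%:R != 0 :> R. Proof. by rewrite pnatr_eq0 -lt0n. Qed.
Let nR0 : 0 < n%:R :> R. Proof. by rewrite ltr0n. Qed.

Lemma enorm_ge0 (x : Rn) : 0 <= enorm x.
Proof. exact: sqrtr_ge0. Qed.

Let weightE (b : R) (x : Rn) : (enorm x ^+ n) `^ (b / n%:R) = enorm x `^ b.
Proof.
by rewrite -powR_mulrn ?enorm_ge0// -powRrM mulrC divfK.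
Qed.

Lemma measurable_fourier (f : Rn -> R[i]) : L1 f ->
  measurable_fun setT (fun y => complex.Re (fourier f y)) /\
  measurable_fun setT (fun y => complex.Im (fourier f y)).
Proof.
move=> Lf; have [iu iv] := Lf.
have mu0 := measurable_L1r iu; have mv0 := measurable_L1r iv.
have mcu := measurable_kernel_op mu (@measurable_cos_dot R n) mu0.
have mcv := measurable_kernel_op mu (@measurable_cos_dot R n) mv0.
have msu := measurable_kernel_op mu (@measurable_sin_dot R n) mu0.
have msv := measurable_kernel_op mu (@measurable_sin_dot R n) mv0.
split.
  rewrite (_ : (fun y => _) = fun y => Tc (fun x => complex.Re (f x)) y +
      Ts (fun x => complex.Im (f x)) y); first by mble.
  by apply/funext => y; have [] := fourier_components y Lf.
rewrite (_ : (fun y => _) = fun y => Tc (fun x => complex.Im (f x)) y -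
    Ts (fun x => complex.Re (f x)) y); first by mble.
by apply/funext => y; have [] := fourier_components y Lf.
Qed.

Lemma measurable_normc (g : Rn -> R[i]) :
  measurable_fun setT (fun x => complex.Re (g x)) ->
  measurable_fun setT (fun x => complex.Im (g x)) ->
  measurable_fun setT (fun x => normc (g x)).
Proof.
move=> mr mi.
rewrite (_ : (fun _ => _) = fun x => Num.sqrt (complex.Re (g x) ^+ 2 + complex.Im (g x) ^+ 2)).
  apply: (measurableT_comp (continuous_measurable_fun (@sqrt_continuous R))).
  by mble.
by apply/funext => x; case: (g x).
Qed.

Lemma normc_ge0 (z : R[i]) : 0 <= normc z.
Proof. by case: z => a b; exact: sqrtr_ge0. Qed.

(** The real and imaginary parts of [fhat] are combinations of the cosine and sine
    transforms of those of [f]; the weight [|x|^b] is [w^(b/n)] with [w = |x|^n],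
    whose sublevel sets have linear volume. *)
Lemma pitt_fourier (p s delta gamma : R) : 1 < p -> p <= s ->
  0 <= delta -> delta < n%:R / s -> 0 <= gamma ->
  delta = n%:R / s - n%:R * (1 - p^-1) + gamma ->
  exists2 C : R, 0 <= C & forall (f : Rn -> R[i]) (c : R), L1 f -> 0 < c ->
    (\int[mu]_x ((enorm x `^ gamma * normc (f x)) `^ p)%:E <= (c `^ p)%:E)%E ->
    (\int[mu]_y ((enorm y `^ (- delta) * normc (fourier f y)) `^ s)%:E <=
      (C * c `^ s)%:E)%E.
Proof.
move=> p1 ps d0 ds g0 dE.
have s0 : 0 < s by lra.
have p0 : 0 < p by lra.
pose w (x : Rn) := enorm x ^+ n.
have mw : measurable_fun setT w by apply: measurable_funX; exact: measurable_enorm.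
have w0 x : 0 <= w x by rewrite exprn_ge0// enorm_ge0.
have V0 : 0 <= 2 ^+ n :> R by rewrite exprn_ge0.
have wV r : 0 < r -> (mu [set x | (w x < r)%R] <= (2 ^+ n * r)%:E)%E.
  by move=> r0; exact: enorm_volume.
have a0 : 0 <= delta / n%:R by rewrite divr_ge0// ltW.
have as1 : delta / n%:R < s^-1 by rewrite ltr_pdivrMr// mulrC.
have b0 : 0 <= gamma / n%:R by rewrite divr_ge0// ltW.
have aE : delta / n%:R = s^-1 - (1 - p^-1) + gamma / n%:R.
  by rewrite dE; field; rewrite nR !gt_eqF.
have [[Ac Ac0 Lc] [As As0 Ls]] := L2_bounded_dot R n.
have [Cc Cc0 Hc] := pitt_inequality (@measurable_cos_dot R n) (@cos_dot_le1 R n)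
  (fun x y => congr1 (fun t => cos (2 * pi * t)) (dotpC x y))
  Ac0 (fun u iu => (Lc u iu).2) mw w0 V0 wV p1 ps a0 as1 b0 aE.
have [Cs Cs0 Hs] := pitt_inequality (@measurable_sin_dot R n) (@sin_dot_le1 R n)
  (fun x y => congr1 (fun t => sin (2 * pi * t)) (dotpC x y))
  As0 (fun u iu => (Ls u iu).2) mw w0 V0 wV p1 ps a0 as1 b0 aE.
exists (4 `^ s * (2 * Cc + 2 * Cs)); first by nng.
move=> f c Lf c0 fc; have [iu iv] := Lf.
set u := fun x => complex.Re (f x) in iu.
set v := fun x => complex.Im (f x) in iv.
have mu0 := measurable_L1r iu; have mv0 := measurable_L1r iv.
have mcu := measurable_kernel_op mu (@measurable_cos_dot R n) mu0.
have mcv := measurable_kernel_op mu (@measurable_cos_dot R n) mv0.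
have msu := measurable_kernel_op mu (@measurable_sin_dot R n) mu0.
have msv := measurable_kernel_op mu (@measurable_sin_dot R n) mv0.
have comp (h : Rn -> R) : (forall x, `|h x| <= normc (f x)) ->
    (\int[mu]_x ((w x `^ (gamma / n%:R) * `|h x|) `^ p)%:E <= (c `^ p)%:E)%E.
  move=> hf; apply: le_trans fc; apply: le_integral_ge0 => x; first by nng.
  rewrite lee_fin weightE; apply: ge0_ler_powR; rewrite ?nnegrE ?(ltW p0)//.
  - by nng.
  - by apply: mulr_ge0; [nng|exact: normc_ge0].
  by apply: ler_wpM2l; [nng|exact: hf].
have uf := comp u (fun x => normc_Re_le (f x)).
have vf := comp v (fun x => normc_Im_le (f x)).
have E1 := pitt_scale (@measurable_cos_dot R n) (@cos_dot_le1 R n) mw Hc c0 iu uf.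
have E2 := pitt_scale (@measurable_cos_dot R n) (@cos_dot_le1 R n) mw Hc c0 iv vf.
have E3 := pitt_scale (@measurable_sin_dot R n) (@sin_dot_le1 R n) mw Hs c0 iu uf.
have E4 := pitt_scale (@measurable_sin_dot R n) (@sin_dot_le1 R n) mw Hs c0 iv vf.
pose W (y : Rn) := w y `^ (- (delta / n%:R)).
have mW : measurable_fun setT W by rewrite /W; mble.
have W0 y : 0 <= W y by exact: powR_ge0.
have fy y : normc (fourier f y) <= `|Tc u y| + `|Tc v y| + (`|Ts u y| + `|Ts v y|).
  have [Re Im] := fourier_components y Lf.
  apply: (le_trans (normc_le_ReIm _)); rewrite Re Im.
  have := ler_normD (Tc u y) (Ts v y); have := ler_normB (Tc v y) (Ts u y).
  by rewrite -/u -/v; lra.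
have := integral_powR_sum4 s0 mW mcu mcv msu msv W0 (fun y => normc_ge0 (fourier f y))
  fy E1 E2 E3 E4.
have -> : W = fun y => enorm y `^ (- delta).
  by apply/funext => y; rewrite /W -mulNr weightE.
move=> /le_trans; apply; rewrite lee_fin le_eqVlt; apply/orP; left; apply/eqP; ring.
Qed.

End sufficiency.

(** * From Lebesgue to Morrey norms *)

Lemma le_poweR (R : realType) (r : R) (x y : \bar R) : 0 <= r -> (0 <= x)%E ->
  (x <= y)%E -> (x `^ r <= y `^ r)%E.
Proof.
move=> r0 x0 xy.
by apply: gt0_ler_poweR => //; rewrite in_itv/= leey andbT// (le_trans x0).
Qed.

Section norms.
Context (R : realType) (n : nat).
Local Notation Rn := (n.-tuple (measurableTypeR R)).
Local Notation mu := (@lebesgue_tuple R n).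
Local Notation normc := ComplexField.Normc.normc.

Lemma normc_weighted (a : R) (f : Rn -> R[i]) x :
  normc (weighted a f x) = enorm x `^ a * normc (f x).
Proof.
rewrite /weighted ComplexField.Normc.normcM; congr (_ * _).
by rewrite /= expr0n addr0 sqrtr_sqr ger0_norm// powR_ge0.
Qed.

Lemma Lp_normE (p : R) (D : set Rn) (g : Rn -> R[i]) : 0 < p ->
  Lp_norm p D g = ((\int[mu]_x ((normc (g x)) `^ p * (\1_D x))%:E) `^ p^-1)%E.
Proof.
move=> p0; rewrite /Lp_norm unlock /Lnorm; congr (_ `^ _)%E.
apply: eq_integral => x _; rewrite patchE indicE.
case: (x \in D) => /=; first by rewrite mulr1 ger0_norm ?normc_ge0.
by rewrite mulr0 normr0 powR0// gt_eqF.
Qed.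

Lemma Lp_norm_setT_le (p c : R) (g : Rn -> R[i]) : 0 < p -> 0 <= c ->
  (Lp_norm p setT g <= c%:E)%E -> (\int[mu]_x ((normc (g x)) `^ p)%:E <= (c `^ p)%:E)%E.
Proof.
move=> p0 c0; rewrite Lp_normE//.
rewrite (_ : \int[mu]_x _ = \int[mu]_x ((normc (g x)) `^ p)%:E)%E; last first.
  by apply: eq_integral => x _; rewrite indicT mulr1.
set I := (\int[mu]_x _)%E => h.
have I0 : (0 <= I)%E by apply: integral_ge0 => x _; rewrite lee_fin powR_ge0.
have -> : I = ((I `^ p^-1) `^ p)%E by rewrite -poweRrM mulVf ?gt_eqF// poweRe1.
rewrite -poweR_EFin; apply: le_poweR => //; first exact: ltW.
exact: poweR_ge0.
Qed.

Lemma Lp_norm_le (p M : R) (D : set Rn) (g : Rn -> R[i]) : 0 < p -> 0 <= M ->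
  (\int[mu]_x ((normc (g x)) `^ p * (\1_D x))%:E <= M%:E)%E ->
  (Lp_norm p D g <= (M `^ p^-1)%:E)%E.
Proof.
move=> p0 M0 h; rewrite Lp_normE// -poweR_EFin.
apply: le_poweR => //; first by rewrite invr_ge0 ltW.
by apply: integral_ge0 => x _; rewrite lee_fin mulr_ge0// powR_ge0.
Qed.

(** On a ball the [L_s] norm controls the [L_q] norm for [q <= s]: bound the
    integrand by [M^q] where it is small and by [M^(q-s) g^s] elsewhere. *)
Lemma Lp_norm_ball (q s c C r : R) (x : Rn) (g : Rn -> R[i]) :
  0 < q -> q <= s -> 0 < c -> 0 <= C -> 0 < r ->
  measurable_fun setT (fun y => normc (g y)) ->
  (\int[mu]_y ((normc (g y)) `^ s)%:E <= (C * c `^ s)%:E)%E ->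
  (Lp_norm q (eball x r) g <=
   ((2 ^+ n + C) `^ q^-1 * (c * r `^ (n%:R / q - n%:R / s)))%:E)%E.
Proof.
move=> q0 qs c0 C0 r0 mg gs.
have s0 : 0 < s by lra.
pose M := c * r `^ (- (n%:R / s)).
have M0 : 0 < M by rewrite mulr_gt0 ?powR_gt0.
have mB := measurable_eball x r.
have m1 : measurable_fun setT (\1_(eball x r) : Rn -> R) by exact: measurable_indic.
have k0 : 0 <= 2 ^+ n + C by rewrite addr_ge0// exprn_ge0.
have I : (\int[mu]_y ((normc (g y)) `^ q * (\1_(eball x r) y))%:E <=
    ((2 ^+ n + C) * (c * r `^ (n%:R / q - n%:R / s)) `^ q)%:E)%E.
  apply: (@le_trans _ _ (\int[mu]_y (M `^ q * \1_(eball x r) y +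
      M `^ (q - s) * normc (g y) `^ s)%:E)%E).
    apply: le_integral_ge0 => y; first by rewrite lee_fin mulr_ge0// powR_ge0.
    rewrite lee_fin; have gs0 : 0 <= M `^ (q - s) * normc (g y) `^ s by nng.
    rewrite indicE; case: (y \in eball x r); last by rewrite !mulr0 add0r.
    rewrite !mulr1; have g0 := normc_ge0 (g y).
    have [gM|Mg] := leP (normc (g y)) M.
      apply: (@le_trans _ _ (M `^ q)); last by rewrite lerDl.
      by apply: ge0_ler_powR; rewrite ?nnegrE ?(ltW q0) ?(ltW M0).
    apply: (@le_trans _ _ (M `^ (q - s) * normc (g y) `^ s)); last by rewrite lerDr powR_ge0.
    have gy : 0 < normc (g y) by exact: lt_trans Mg.
    rewrite -[X in X `^ q](mul1r) -(opprB s) powRN ler_pdivlMl ?powR_gt0//.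
    rewrite mul1r; apply: (@le_trans _ _ (normc (g y) `^ (s - q) * normc (g y) `^ q)).
      apply: ler_wpM2r; first by nng.
      by apply: ge0_ler_powR; rewrite ?nnegrE ?(ltW M0) ?(ltW gy) ?(ltW Mg)//; lra.
    by rewrite -powRD ?subrK// (gt_eqF gy) implybT.
  rewrite integralD_ge0; [|by mble|by mble|by move=> y; nng|by move=> y; nng].
  rewrite !integralZl_ge0; try by [mble|nng|move=> y; nng].
  rewrite integral_indic// setIT.
  apply: (@le_trans _ _ ((M `^ q)%:E * ((2 * r) ^+ n)%:E + (M `^ (q - s))%:E * (C * c `^ s)%:E)%E).
    by apply: leeD; apply: lee_wpmul2l => //; [nng|exact: eball_volume|nng].
  rewrite -!EFinM -EFinD lee_fin le_eqVlt; apply/orP; left; apply/eqP.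
  rewrite [RHS]mulrDl; congr (_ + _).
    rewrite /M !powRM ?powR_ge0 ?(ltW c0)// exprMn -!powRrM -(powR_mulrn n (ltW r0)).
    rewrite [LHS](_ : _ = 2 ^+ n * (c `^ q * (r `^ (- (n%:R / s) * q) * r `^ n%:R))); last by ring.
    rewrite -powRD ?(gt_eqF r0) ?implybT//; congr (_ * (_ * _ `^ _)).
    by field; rewrite !gt_eqF.
  rewrite /M !powRM ?powR_ge0 ?(ltW c0)// -!powRrM.
  rewrite [LHS](_ : _ = C * ((c `^ (q - s) * c `^ s) * r `^ (- (n%:R / s) * (q - s)))); last by ring.
  rewrite -powRD ?(gt_eqF c0) ?implybT// subrK; congr (_ * (_ * _ `^ _)).
  by field; rewrite !gt_eqF.
have c1 : 0 <= c * r `^ (n%:R / q - n%:R / s) by nng.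
apply: le_trans (Lp_norm_le q0 _ I) _; first by nng.
rewrite powRM//; last by nng.
by rewrite -powRrM mulfV ?gt_eqF// powRr1.
Qed.

End norms.

Theorem morrey_pitt (R : realType) (n : nat) (p q nu delta gamma : R)
    (n_gt0 : (0 < n)%N) (p_gt1 : 1 < p) (q_gt0 : 0 < q)
    (nu_ge0 : 0 <= nu) (nu_lt : nu < n%:R / q)
    (p_le : p <= n%:R * q / (n%:R - nu * q))
    (p' := p / (p - 1)) :
  Num.max 0 (n%:R * (1 / q - 1 / p') - nu) <= delta < n%:R / q - nu ->
  gamma = delta + n%:R * (1 / p' - 1 / q) + nu ->
  exists2 C : R, 0 < C &
     forall f : n.-tuple (measurableTypeR R) -> complex R, L1 f ->
       (morrey_norm q nu (weighted (- delta) (fourier f))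
         <= C%:E * Lp_norm p setT (weighted gamma f))%E.
Proof.
rewrite ge_max => /andP[/andP[d0 dp] dn] gE.
have nR : 0 < n%:R :> R by rewrite ltr0n.
have p0 : 0 < p by lra.
have nq : 0 < n%:R - nu * q by rewrite subr_gt0 -ltr_pdivlMr.
pose s := n%:R * q / (n%:R - nu * q).
have s0 : 0 < s by rewrite /s divr_gt0// mulr_gt0.
have nsE : n%:R / s = n%:R / q - nu.
  by rewrite /s; field; rewrite !gt_eqF.
have p'E : 1 / p' = 1 - p^-1.
  by rewrite /p'; field; rewrite !gt_eqF//; lra.
have qs : q <= s.
  rewrite /s ler_pdivlMr// mulrC ler_pM2r//.
  by rewrite gerBl mulr_ge0// ltW.
have [C C0 H] : exists2 C : R, 0 <= C & forall (f : n.-tuple (measurableTypeR R) -> R[i]) (c : R), L1 f -> 0 < c ->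
    (\int[lebesgue_tuple n]_x ((enorm x `^ gamma * ComplexField.Normc.normc (f x)) `^ p)%:E <= (c `^ p)%:E)%E ->
    (\int[lebesgue_tuple n]_y ((enorm y `^ (- delta) * ComplexField.Normc.normc (fourier f y)) `^ s)%:E <=
      (C * c `^ s)%:E)%E.
  apply: (@pitt_fourier R n n_gt0 p s delta gamma) => //.
  - by rewrite nsE.
  - by rewrite gE; move: dp; rewrite !mulrBr; lra.
  - by rewrite nsE gE p'E; ring.
have K0 : 0 < (2 ^+ n + C) `^ q^-1.
  by rewrite powR_gt0// ltr_wpDr// exprn_gt0.
exists ((2 ^+ n + C) `^ q^-1) => // f Lf.
have main c : 0 < c -> (Lp_norm p setT (weighted gamma f) <= c%:E)%E ->
    (morrey_norm q nu (weighted (- delta) (fourier f)) <= ((2 ^+ n + C) `^ q^-1 * c)%:E)%E.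
  move=> c0 fc; have := Lp_norm_setT_le p0 (ltW c0) fc.
  under eq_integral do rewrite normc_weighted.
  move=> /(H f c Lf c0) Hf.
  have [m1 m2] := measurable_fourier Lf.
  have mF : measurable_fun setT (fun y => ComplexField.Normc.normc (weighted (- delta) (fourier f) y)).
    rewrite (_ : (fun y => _) = fun y => enorm y `^ (- delta) * ComplexField.Normc.normc (fourier f y)).
      apply: measurable_funM; last exact: measurable_normc.
      exact: (measurableT_comp (measurable_powR _) (@measurable_enorm R n)).
    by apply/funext => y; rewrite normc_weighted.
  have {}Hf : (\int[lebesgue_tuple n]_y ((ComplexField.Normc.normc (weighted (- delta) (fourier f) y)) `^ s)%:E <= (C * c `^ s)%:E)%E.
    by under eq_integral do rewrite normc_weighted.
  apply: ge_ereal_sup => _ [r /= r0 <-].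
  have rnu : 0 <= r `^ (- nu) by exact: powR_ge0.
  apply: (@le_trans _ _ ((r `^ (- nu))%:E * ((2 ^+ n + C) `^ q^-1 * (c * r `^ nu))%:E)%E).
    apply: lee_wpmul2l => //; apply: ge_ereal_sup => _ [x _ <-].
    have nuE : nu = n%:R / q - n%:R / s by rewrite nsE; lra.
    by rewrite [X in r `^ X]nuE; exact: (Lp_norm_ball x q_gt0 qs c0 C0 r0 mF Hf).
  have rn : r `^ nu != 0 by rewrite gt_eqF// powR_gt0.
  by rewrite -EFinM lee_fin powRN mulrCA [c * _]mulrC mulKf.
(* [main] asks for a positive bound of the norm, which may be 0: hence [e] *)
have : (0 <= Lp_norm p setT (weighted gamma f))%E by exact: Lnorm_ge0.
case NE : (Lp_norm p setT (weighted gamma f)) => [N| |]//; last first.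
  by move=> _; rewrite gt0_muley; [exact: leey|rewrite lte_fin].
rewrite lee_fin => N0; rewrite -EFinM; apply/lee_addgt0Pr => e e0.
have c0 : 0 < N + e / (2 ^+ n + C) `^ q^-1 by rewrite ltr_wpDl// divr_gt0.
apply: (le_trans (main _ c0 _)); last first.
  by rewrite -EFinD lee_fin mulrDr mulrCA mulfV ?gt_eqF// mulr1.
by rewrite NE lee_fin lerDl divr_ge0// ltW.
Qed.

(** * Fourier transforms of modulated bumps *)

Lemma cos_ge_half (R : realType) (t : R) : `|t| <= 2^-1 -> 2^-1 <= cos t.
Proof.
move=> t2; have p2 := @pihalf_ge1 R.
have := @cos_ge0_pihalf R (t *+ 2); rewrite cos_mulr2n => h.
have {h} : 0 <= cos t ^+ 2 *+ 2 - 1.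
  by apply: h; move: t2; rewrite ler_norml => /andP[a b]; apply/andP; split; lra.
have ct : 0 <= cos t.
  by apply: cos_ge0_pihalf; move: t2; rewrite ler_norml => /andP[a b]; apply/andP; split; lra.
have := ler_wpM2l ct (cos_le1 t); rewrite mulr1 -expr2; lra.
Qed.

Section test_functions.
Context (R : realType) (n : nat).
Local Notation Rn := (n.-tuple (measurableTypeR R)).
Local Notation mu := (@lebesgue_tuple R n).
Local Notation normc := ComplexField.Normc.normc.
Local Notation L1r u := (mu.-integrable setT (EFin \o (u : Rn -> R))).

Definition diag (k : R) : Rn := [tuple of nseq n k].

Definition modulated (g : Rn -> R) (k : R) (x : Rn) : R[i] :=
  (g x)%:C%C * Cexpi (2 * pi * dotp x (diag k)).

Lemma measurable_phase (k : R) : measurable_fun setT (fun x : Rn => 2 * pi * dotp x (diag k)).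
Proof.
apply: measurable_funM => //; apply: measurable_sum => i.
by apply: measurable_funM => //; exact: measurable_coord.
Qed.

Lemma normc_modulated g k x : 0 <= g x -> normc (modulated g k x) = g x.
Proof.
move=> g0; rewrite /modulated ComplexField.Normc.normcM /=.
by rewrite expr0n addr0 sqrtr_sqr ger0_norm// cos2Dsin2 sqrtr1 mulr1.
Qed.

Lemma L1_modulated g k : L1r g -> L1 (modulated g k).
Proof.
move=> ig; have mg := measurable_L1r ig.
have mc := measurableT_comp (continuous_measurable_fun (@continuous_cos R)) (measurable_phase k).
have ms := measurableT_comp (continuous_measurable_fun (@continuous_sin R)) (measurable_phase k).
split.
  rewrite (_ : (fun x => _) = EFin \o fun x => g x * cos (2 * pi * dotp x (diag k))).
    apply: (integrable_dominated ig); first by apply: measurable_funM.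
    by move=> x; rewrite normrM ler_piMr// cos_max.
  by apply/funext => x /=; rewrite mul0r subr0.
rewrite (_ : (fun x => _) = EFin \o fun x => g x * sin (2 * pi * dotp x (diag k))).
  apply: (integrable_dominated ig); first by apply: measurable_funM.
  by move=> x; rewrite normrM ler_piMr// sin_max.
by apply/funext => x /=; rewrite mul0r addr0.
Qed.

Lemma normc_ge_rotated (z : R[i]) t :
  cos t * complex.Re z + sin t * complex.Im z <= normc z.
Proof.
case: z => a b /=; apply: (le_trans (ler_norm _)).
rewrite -sqrtr_sqr; apply: ler_wsqrtr.
rewrite -[leRHS]mul1r -(cos2Dsin2 t) -subr_ge0.
rewrite [leRHS](_ : _ = (cos t * b - sin t * a) ^+ 2) ?sqr_ge0//; ring.
Qed.

(** Multiply [fhat y] by the unit number of argument [t]: on the support of [g] the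
    phase of the integrand then stays within [1/2] of 0, where the cosine is at
    least [1/2].  The freedom in [t] is what makes bumps far from the origin
    harmless. *)
Lemma fourier_modulated_ge g k (y : Rn) (t : R) : L1r g -> (forall x, 0 <= g x) ->
  (forall x, g x != 0 -> `|2 * pi * (dotp x (diag k) - dotp x y) - t| <= 2^-1) ->
  2^-1 * (\int[mu]_x g x)%R <= normc (fourier (modulated g k) y).
Proof.
move=> ig g0 small; have mg := measurable_L1r ig.
have my : measurable_fun setT (fun x : Rn => 2 * pi * (dotp x (diag k) - dotp x y)).
  apply: measurable_funM => //; apply: measurable_funB; apply: measurable_sum => i.
    by apply: measurable_funM => //; exact: measurable_coord.
  by apply: measurable_funM => //; exact: measurable_coord.
have mc := measurableT_comp (continuous_measurable_fun (@continuous_cos R)) my.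
have ms := measurableT_comp (continuous_measurable_fun (@continuous_sin R)) my.
pose u (x : Rn) := g x * cos (2 * pi * (dotp x (diag k) - dotp x y)).
pose v (x : Rn) := g x * sin (2 * pi * (dotp x (diag k) - dotp x y)).
have iu : L1r u.
  apply: (integrable_dominated ig); first by apply: measurable_funM.
  by move=> x; rewrite normrM ler_piMr// cos_max.
have iv : L1r v.
  apply: (integrable_dominated ig); first by apply: measurable_funM.
  by move=> x; rewrite normrM ler_piMr// sin_max.
apply: le_trans (normc_ge_rotated _ t).
have -> : complex.Re (fourier (modulated g k) y) = (\int[mu]_x u x)%R.
  apply: eq_Rintegral => x _; rewrite /u /modulated /= cosN sinN mulrBr cosB.
  by ring.
have -> : complex.Im (fourier (modulated g k) y) = (\int[mu]_x v x)%R.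
  apply: eq_Rintegral => x _; rewrite /v /modulated /= cosN sinN mulrBr sinB.
  by ring.
have icu : L1r (fun x => cos t * u x).
  by apply: (integrable_dominated iu); [apply: measurable_funM => //; exact: (measurable_L1r iu)|move=> x; rewrite normrM ler_piMl// cos_max].
have isv : L1r (fun x => sin t * v x).
  by apply: (integrable_dominated iv); [apply: measurable_funM => //; exact: (measurable_L1r iv)|move=> x; rewrite normrM ler_piMl// sin_max].
have mcu := measurable_L1r icu; have msv := measurable_L1r isv.
rewrite -!RintegralZl// -RintegralD//.
apply: le_Rintegral => //.
- apply: (integrable_dominated ig); first by apply: measurable_funM.
  by move=> x; rewrite normrM ler_piMl// ger0_norm ?invr_ge0// invf_le1// ler1n.
- by apply: (integrableD _ icu isv).
move=> x _; rewrite /u /v.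
have [->|gx] := eqVneq (g x) 0; first by rewrite !mul0r !mulr0 addr0.
rewrite [leRHS](_ : _ = g x * cos (2 * pi * (dotp x (diag k) - dotp x y) - t)).
  by rewrite mulrC; apply: ler_wpM2l => //; apply: cos_ge_half; exact: small.
by rewrite cosB; ring.
Qed.

End test_functions.

(** * Lower bounds on cubes *)

Section cubes.
Context (R : realType) (n : nat).
Local Notation Rn := (n.-tuple (measurableTypeR R)).
Local Notation mu := (@lebesgue_tuple R n).
Local Notation normc := ComplexField.Normc.normc.
Hypothesis n_gt0 : (0 < n)%N.

Definition cube (a b : R) : set Rn :=
  [set x | forall i, (`[a, b[%classic : set R) (tnth x i)].

Lemma in_cube a b x i : cube a b x -> a <= (tnth x i : R) < b.
Proof. by move=> /(_ i); rewrite /= in_itv. Qed.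

Lemma measurable_cube a b : measurable (cube a b).
Proof.
exact: (@measurable_box R n (fun=> `[a, b[%classic) (fun=> measurable_itv _)).
Qed.

Lemma cube_volume a b : a <= b -> mu (cube a b) = ((b - a) ^+ n)%:E.
Proof.
by move=> ab; rewrite [LHS](@box_volume R n (fun=> a) (fun=> b))// prodr_const card_ord.
Qed.

Lemma cube_enorm a b x : 0 < a -> cube a b x -> a <= enorm x <= n%:R * b.
Proof.
move=> a0 xab; apply/andP; split.
  have /andP[ax _] := in_cube (Ordinal n_gt0) xab.
  by apply: (le_trans ax); apply: le_trans (coord_le_enorm _ (Ordinal n_gt0)); exact: ler_norm.
have n1 : 1 <= n%:R :> R by rewrite ler1n.
have b0 : 0 < b.
  by have /andP[ax xb] := in_cube (Ordinal n_gt0) xab; lra.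
have nb0 : 0 <= n%:R * b by rewrite mulr_ge0// ltW.
rewrite -[leRHS]ger0_norm// -sqrtr_sqr; apply: ler_wsqrtr.
apply: (@le_trans _ _ (\sum_(i < n) b ^+ 2)).
  apply: ler_sum => i _; have /andP[ax xb] := in_cube i xab.
  by rewrite expr2; apply: ler_pM => //; lra.
rewrite sumr_const card_ord exprMn -[leLHS]mulr_natl; apply: ler_wpM2r; first exact: sqr_ge0.
by rewrite expr2 ler_peMl.
Qed.

Lemma powR_comparable (K a s e : R) : 0 < a -> 1 <= K -> a <= s <= K * a ->
  K `^ (- `|e|) * a `^ e <= s `^ e <= K `^ `|e| * a `^ e.
Proof.
move=> a0 K1 /andP[as1 sK].
have s0 : 0 < s by lra.
have K0 : 0 < K by lra.
have Ke : 1 <= K `^ `|e| by rewrite -[leLHS](powRr0 K) ler_powR.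
have Kn : K `^ (- `|e|) <= 1 by rewrite powRN invf_le1// powR_gt0.
have ae := powR_ge0 a e.
have [e0|e0] := leP 0 e.
  have h1 : a `^ e <= s `^ e by apply: ge0_ler_powR; rewrite ?nnegrE ?(ltW a0) ?(ltW s0).
  apply/andP; split; first by apply: le_trans h1; rewrite ler_piMl.
  rewrite ger0_norm// -powRM ?(ltW a0) ?(ltW K0)//.
  by apply: ge0_ler_powR; rewrite ?nnegrE ?(ltW s0) ?mulr_ge0 ?(ltW a0) ?(ltW K0).
have h1 : s `^ e <= a `^ e.
  rewrite -[e]opprK !(powRN _ (- e)) lef_pV2 ?posrE ?powR_gt0//.
  by apply: ge0_ler_powR; rewrite ?nnegrE ?(ltW a0) ?(ltW s0)//; lra.
apply/andP; split; last by apply: (le_trans h1); rewrite ler_peMl.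
rewrite ltr0_norm// opprK -powRM ?(ltW a0) ?(ltW K0)//.
rewrite -[e]opprK !(powRN _ (- e)) lef_pV2 ?posrE ?powR_gt0 ?mulr_gt0//.
by apply: ge0_ler_powR; rewrite ?nnegrE ?(ltW s0) ?mulr_ge0 ?(ltW a0) ?(ltW K0)//; lra.
Qed.

Lemma cube_weight a b e x : 0 < a -> b <= 2 * a -> cube a b x ->
  (2 * n%:R) `^ (- `|e|) * a `^ e <= enorm x `^ e <= (2 * n%:R) `^ `|e| * a `^ e.
Proof.
move=> a0 b2 xab; have /andP[ax xb] := cube_enorm a0 xab.
have n1 : 1 <= n%:R :> R by rewrite ler1n.
apply: powR_comparable => //; first by lra.
rewrite ax; apply: (le_trans xb).
by rewrite [leRHS](_ : _ = n%:R * (2 * a)); [rewrite ler_wpM2l|ring].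
Qed.

Lemma cube_eball a b : a < b -> cube a b `<=` eball (diag n a) (2 * n%:R * (b - a)).
Proof.
move=> ab y yab; rewrite /eball /=.
have n1 : 1 <= n%:R :> R by rewrite ler1n.
have ba : 0 < b - a by rewrite subr_gt0.
have h : 0 < n%:R * (b - a) by rewrite mulr_gt0// (lt_le_trans ltr01).
apply: (@le_lt_trans _ _ (n%:R * (b - a))); last first.
  by rewrite -mulrA; lra.
rewrite -[leRHS]ger0_norm ?(ltW h)// -sqrtr_sqr; apply: ler_wsqrtr.
apply: (@le_trans _ _ (\sum_(i < n) (b - a) ^+ 2)).
  apply: ler_sum => i _; have /andP[ax xb] := in_cube i yab.
  by rewrite tnth_nseq !expr2; apply: ler_pM => //; lra.
rewrite sumr_const card_ord exprMn -[leLHS]mulr_natl; apply: ler_wpM2r; first exact: sqr_ge0.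
by rewrite expr2 ler_peMl.
Qed.

Lemma morrey_norm_ge (q nu m V r : R) (z : Rn) (E : set Rn) (F : Rn -> R[i]) :
  0 < q -> 0 < r -> 0 <= m -> 0 <= V -> measurable E -> mu E = V%:E ->
  E `<=` eball z r -> (forall y, E y -> m <= normc (F y)) ->
  ((r `^ (- nu) * (m * V `^ q^-1))%:E <= morrey_norm q nu F)%E.
Proof.
move=> q0 r0 m0 V0 mE EV Er mF.
apply: (@le_trans _ _ ((r `^ (- nu))%:E * Lp_norm q (eball z r) F)%E); last first.
  apply: (@le_trans _ _ ((r `^ (- nu))%:E *
      ereal_sup [set Lp_norm q (eball x r) F | x in [set: Rn]])%E).
    apply: lee_wpmul2l; first by rewrite lee_fin powR_ge0.
    by apply: ereal_sup_ubound; exists z.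
  by apply: ereal_sup_ubound; exists r.
rewrite EFinM; apply: lee_wpmul2l; first by rewrite lee_fin powR_ge0.
rewrite Lp_normE//.
have -> : (m * V `^ q^-1)%:E = ((m `^ q * V)%:E `^ q^-1)%E.
  by rewrite poweR_EFin powRM ?powR_ge0// -powRrM mulfV ?gt_eqF// powRr1.
apply: le_poweR; first by rewrite invr_ge0 ltW.
  by rewrite lee_fin mulr_ge0// powR_ge0.
have mI : measurable_fun setT (\1_E : Rn -> R) by exact: measurable_indic.
apply: (@le_trans _ _ (\int[mu]_x (m `^ q * \1_E x)%:E)%E).
  rewrite integralZl_ge0//; last exact: powR_ge0.
  by rewrite integral_indic// setIT EFinM -EV.
apply: le_integral_ge0 => x; first by rewrite lee_fin mulr_ge0 ?powR_ge0.
rewrite lee_fin !indicE.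
have [xE|xE] := boolP (x \in E); last by rewrite mulr0 mulr_ge0 ?powR_ge0.
rewrite (_ : x \in eball z r) ?mulr1; last by rewrite inE; apply: Er; exact: set_mem.
by apply: ge0_ler_powR; rewrite ?nnegrE ?(ltW q0) ?normc_ge0//; apply: mF; exact: set_mem.
Qed.

Lemma phase_small (v k A B a b : R) (x y : Rn) : 0 <= A ->
  (forall i, `|(tnth x i : R) - v| <= A) -> k <= a -> b <= k + B -> cube a b y ->
  16 * n%:R * A * B <= 1 ->
  `|2 * pi * (dotp x (diag n k) - dotp x y) -
    2 * pi * (\sum_(i < n) v * (k - (tnth y i : R)))| <= 2^-1.
Proof.
move=> A0 xA ka bB yab AB.
have n1 : 1 <= n%:R :> R by rewrite ler1n.
have B0 : 0 <= B.
  by have /andP[ax xb] := in_cube (Ordinal n_gt0) yab; lra.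
rewrite -mulrBr -sumrB -sumrB normrM ger0_norm ?mulr_ge0 ?pi_ge0//.
apply: (@le_trans _ _ (2 * pi * (n%:R * (A * B)))).
  apply: ler_wpM2l; first by rewrite mulr_ge0// pi_ge0.
  apply: (le_trans (ler_norm_sum _ _ _)).
  apply: (@le_trans _ _ (\sum_(i < n) A * B)); last first.
    by rewrite sumr_const card_ord -[leLHS]mulr_natl.
  apply: ler_sum => i _; rewrite tnth_nseq -mulrBr -mulrBl normrM.
  apply: ler_pM => //.
  by have /andP[ax xb] := in_cube i yab; rewrite ler_norml; apply/andP; split; lra.
have p4 : pi < 4 :> R by have := @pihalf_lt2 R; lra.
have nAB : 0 <= n%:R * (A * B) by rewrite !mulr_ge0.
apply: (@le_trans _ _ (2 * 4 * (n%:R * (A * B)))).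
  by apply: ler_wpM2r => //; lra.
move: AB; rewrite -!mulrA; lra.
Qed.

(** The Fourier transform of a bump of width [A] is at least half its integral
    on the dual scale around the modulation frequency. *)
Lemma morrey_fourier_ge (q nu delta v k A B a b : R) (g : Rn -> R) :
  0 < q -> 0 < a -> a < b -> b <= 2 * a -> 0 <= A -> k <= a -> b <= k + B ->
  16 * n%:R * A * B <= 1 ->
  mu.-integrable setT (EFin \o g) -> (forall x, 0 <= g x) ->
  (forall x, g x != 0 -> forall i, `|(tnth x i : R) - v| <= A) ->
  (((2 * n%:R * (b - a)) `^ (- nu) *
    (((2 * n%:R) `^ (- `|delta|) * a `^ (- delta)) * (2^-1 * (\int[mu]_x g x)%R) *
     ((b - a) ^+ n) `^ q^-1))%:E
   <= morrey_norm q nu (weighted (- delta) (fourier (modulated g k))))%E.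
Proof.
move=> q0 a0 ab b2 A0 ka bB AB ig g0 gA.
have n0 : 0 < n%:R :> R by rewrite ltr0n.
have ba : 0 < b - a by rewrite subr_gt0.
have I0 : 0 <= (\int[mu]_x g x)%R by apply: Rintegral_ge0.
have h0 : 0 <= 2^-1 * (\int[mu]_x g x)%R by rewrite mulr_ge0// invr_ge0.
apply: (@morrey_norm_ge q nu _ _ _ (diag n a) (cube a b)) => //.
- by rewrite !mulr_gt0.
- by rewrite !mulr_ge0 ?powR_ge0.
- by rewrite exprn_ge0// ltW.
- exact: measurable_cube.
- by apply: cube_volume; exact: ltW.
- exact: cube_eball.
move=> y yab; rewrite normc_weighted; apply: ler_pM => //.
- by rewrite mulr_ge0 ?powR_ge0.
- by have /andP[] := cube_weight (- delta) a0 b2 yab; rewrite normrN.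
apply: fourier_modulated_ge => // x gx.
by apply: (phase_small (A := A) (B := B) _ _ ka bB yab AB) => //; exact: gA.
Qed.

End cubes.

(** * Step functions on cubes *)

Section step_functions.
Context (R : realType) (n : nat).
Local Notation Rn := (n.-tuple (measurableTypeR R)).
Local Notation mu := (@lebesgue_tuple R n).
Hypothesis n_gt0 : (0 < n)%N.
Variables (N : nat) (a b : 'I_N -> R).
Hypothesis ab : forall j, a j < b j.
Local Notation Q j := (@cube R n (a j) (b j)).
Hypothesis disjQ : forall i j x, Q i x -> Q j x -> i = j.

Definition step (c : 'I_N -> R) (x : Rn) : R := \sum_(j < N) c j * \1_(Q j) x.

Lemma step_in c x j : Q j x -> step c x = c j.
Proof.
move=> Qx; rewrite /step (bigD1 j)//= big1 => [|i ij].
  by rewrite indicE mem_set// mulr1 addr0.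
rewrite indicE memNset ?mulr0// => Qi.
by move/eqP: ij; apply; exact: disjQ Qi Qx.
Qed.

Lemma step_out c x : (forall j, ~ Q j x) -> step c x = 0.
Proof. by move=> Qx; apply: big1 => j _; rewrite indicE memNset// mulr0. Qed.

Lemma step_ge0 c x : (forall j, 0 <= c j) -> 0 <= step c x.
Proof. by move=> c0; apply: sumr_ge0 => j _; rewrite mulr_ge0. Qed.

Lemma measurable_step c : measurable_fun setT (step c).
Proof.
apply: measurable_sum => j; apply: measurable_funM => //.
by apply: measurable_indic; exact: measurable_cube.
Qed.

Lemma integral_step c : (forall j, 0 <= c j) ->
  (\int[mu]_x (step c x)%:E = (\sum_(j < N) c j * (b j - a j) ^+ n)%:E)%E.
Proof.
move=> c0.
under eq_integral do rewrite /step -sumEFin.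
rewrite ge0_integral_sum//; last first.
- by move=> j x _; rewrite lee_fin mulr_ge0.
- move=> j; apply/measurable_EFinP; apply: measurable_funM => //.
  by apply: measurable_indic; exact: measurable_cube.
rewrite -sumEFin; apply: eq_bigr => j _.
have mI : measurable_fun setT (\1_(Q j) : Rn -> R).
  by apply: measurable_indic; exact: measurable_cube.
rewrite integralZl_ge0// integral_indic ?setIT//; last exact: measurable_cube.
by rewrite [RHS]EFinM; congr (_ * _)%E; apply: cube_volume; exact: ltW.
Qed.

Lemma integrable_step c : (forall j, 0 <= c j) ->
  mu.-integrable setT (EFin \o step c).
Proof.
move=> c0; apply/integrableP; split; first by apply/measurable_EFinP; exact: measurable_step.
have -> : (\int[mu]_x `|(EFin \o step c) x| = \int[mu]_x (step c x)%:E)%E.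
  by apply: eq_integral => x _ /=; rewrite ger0_norm// step_ge0.
by rewrite integral_step// ltry.
Qed.

Lemma weighted_step_norm (p gamma k : R) c : 0 < p -> (forall j, 0 <= c j) ->
  (forall j, 0 < a j) -> (forall j, b j <= 2 * a j) ->
  (Lp_norm p setT (weighted gamma (modulated (step c) k)) <=
   ((\sum_(j < N) ((2 * n%:R) `^ `|gamma| * a j `^ gamma * c j) `^ p *
      (b j - a j) ^+ n) `^ p^-1)%:E)%E.
Proof.
move=> p0 c0 a0 b2.
pose d j := ((2 * n%:R) `^ `|gamma| * a j `^ gamma * c j) `^ p.
have d0 j : 0 <= d j by exact: powR_ge0.
apply: Lp_norm_le => //.
  by apply: sumr_ge0 => j _; apply: mulr_ge0; [exact: powR_ge0|rewrite exprn_ge0// subr_ge0 ltW].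
rewrite -(integral_step d0); apply: le_integral_ge0 => x.
  by rewrite lee_fin mulr_ge0// powR_ge0.
rewrite lee_fin indicT mulr1 normc_weighted normc_modulated ?step_ge0//.
have [[j Qx]|Qx] := pselect (exists j, Q j x); last first.
  rewrite !step_out ?mulr0 ?powR0 ?gt_eqF// => j Qj; apply: Qx; by exists j.
rewrite !(step_in _ Qx); apply: ge0_ler_powR; rewrite ?nnegrE ?(ltW p0) ?mulr_ge0 ?powR_ge0//.
by apply: ler_wpM2r => //; have /andP[] := cube_weight n_gt0 gamma (a0 j) (b2 j) Qx.
Qed.

Lemma pitt_step (p q nu delta gamma C : R) (c : 'I_N -> R) (v k A B l h : R) :
  0 < p -> 0 < q -> 0 < C ->
  (forall f : Rn -> R[i], L1 f ->
    (morrey_norm q nu (weighted (- delta) (fourier f)) <=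
     C%:E * Lp_norm p setT (weighted gamma f))%E) ->
  (forall j, 0 <= c j) -> (forall j, 0 < a j) -> (forall j, b j <= 2 * a j) ->
  0 < l -> l < h -> h <= 2 * l -> 0 <= A -> k <= l -> h <= k + B ->
  16 * n%:R * A * B <= 1 ->
  (forall j, v - A <= a j) -> (forall j, b j <= v + A) ->
  (2 * n%:R * (h - l)) `^ (- nu) *
    (((2 * n%:R) `^ (- `|delta|) * l `^ (- delta)) *
      (2^-1 * \sum_(j < N) c j * (b j - a j) ^+ n) * ((h - l) ^+ n) `^ q^-1)
  <= C * (\sum_(j < N) ((2 * n%:R) `^ `|gamma| * a j `^ gamma * c j) `^ p *
      (b j - a j) ^+ n) `^ p^-1.
Proof.
move=> p0 q0 C0 H c0 a0 b2 l0 lh h2 A0 kl hB AB va vb.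
have ig := integrable_step c0.
have gA x : step c x != 0 -> forall i, `|(tnth x i : R) - v| <= A.
  move=> gx i; have [[j Qx]|Qx] := pselect (exists j, Q j x); last first.
    by move/eqP: gx; case; apply: step_out => j Qj; apply: Qx; exists j.
  have /andP[ax xb] := in_cube i Qx; have h1 := va j; have h2' := vb j.
  by rewrite ler_norml; apply/andP; split; lra.
have Ig : (\int[mu]_x step c x)%R = \sum_(j < N) c j * (b j - a j) ^+ n.
  by rewrite /Rintegral integral_step.
have := morrey_fourier_ge n_gt0 nu delta q0 l0 lh h2 A0 kl hB AB ig
  (fun x => step_ge0 x c0) gA.
rewrite Ig => h1; rewrite -lee_fin; apply: (le_trans h1).
apply: (le_trans (H _ (L1_modulated k ig))).
rewrite EFinM; apply: lee_wpmul2l; first by rewrite lee_fin ltW.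
exact: weighted_step_norm.
Qed.

End step_functions.

(** * Necessity of the conditions on the exponents *)

Lemma bounded_powR_le0 (R : realType) (e K : R) :
  (forall t, 1 <= t -> t `^ e <= K) -> e <= 0.
Proof.
move=> H; rewrite leNgt; apply/negP => e0.
have K1 : 1 <= K by have := H 1 (lexx 1); rewrite powR1.
have K0 : 0 < K + 1 by lra.
have := H ((K + 1) `^ e^-1); rewrite -powRrM mulVf ?gt_eqF// powRr1 ?(ltW K0)//.
move=> /(_ _); suff h : 1 <= (K + 1) `^ e^-1 by move=> /(_ h); lra.
by rewrite -[leLHS](powRr0 (K + 1)) ler_powR// ?invr_ge0 ?(ltW e0)//; lra.
Qed.

Lemma bounded_powR_eq0 (R : realType) (e K : R) :
  (forall t, 0 < t -> t `^ e <= K) -> e = 0.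
Proof.
move=> H; apply/eqP; rewrite eq_le; apply/andP; split.
  by apply: (@bounded_powR_le0 R e K) => t t1; apply: H; lra.
rewrite -oppr_le0; apply: (@bounded_powR_le0 R _ K) => t t1.
have t0 : 0 < t by lra.
rewrite powRN -powR_inv1 ?powR_ge0// -powRrM mulrC powRrM powR_inv1 ?(ltW t0)//.
by apply: H; rewrite invr_gt0.
Qed.

Lemma powR_antitone (R : realType) (a x y : R) : 0 < a -> a <= 1 -> x <= y ->
  a `^ y <= a `^ x.
Proof.
move=> a0 a1 xy; have : 1 <= a^-1 by rewrite invf_ge1.
move=> /ler_powR /(_ (- y) (- x)); rewrite lerN2 => /(_ xy).
by rewrite -powR_inv1 ?(ltW a0)// -!powRrM !mulN1r !opprK.
Qed.

Section necessity.
Context (R : realType) (n : nat).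
Local Notation Rn := (n.-tuple (measurableTypeR R)).
Variables (p q nu delta gamma C : R).
Hypothesis n_gt0 : (0 < n)%N.
Hypothesis p1 : 1 < p.
Hypothesis q0 : 0 < q.
Hypothesis C0 : 0 < C.
Hypothesis H : forall f : Rn -> R[i], L1 f ->
  (morrey_norm q nu (weighted (- delta) (fourier f)) <=
   C%:E * Lp_norm p setT (weighted gamma f))%E.

Let p0 : 0 < p. Proof. by move: p1; lra. Qed.
Let n1 : 1 <= n%:R :> R. Proof. by rewrite ler1n. Qed.
Let D0 : 0 < 2 * n%:R :> R. Proof. by move: n1; lra. Qed.

Let K := C * (2 * n%:R) `^ `|gamma| * 2 * (2 * n%:R) `^ `|delta| * (2 * n%:R) `^ nu.

Let K0 : 0 < K. Proof. by rewrite !mulr_gt0 ?powR_gt0. Qed.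

Let powR_expn (x r : R) : 0 < x -> (x ^+ n) `^ r^-1 = x `^ (n%:R / r).
Proof. by move=> x0; rewrite -powR_mulrn ?(ltW x0)// -powRrM. Qed.

(** The inequality tested on the indicator function of one cube of side [b - a]
    at distance about [a] from the origin, evaluated on a frequency cube of side
    [h - l] at distance about [l]. *)
Lemma pitt_cube (a b k B l h : R) : 0 < a -> a < b -> b <= 2 * a ->
  0 < l -> l < h -> h <= 2 * l -> k <= l -> h <= k + B ->
  16 * n%:R * (b - a) * B <= 1 ->
  l `^ (- delta) * (h - l) `^ (n%:R / q - nu) * (b - a) ^+ n <=
  K * (a `^ gamma * (b - a) `^ (n%:R / p)).
Proof.
move=> a0 ab b2 l0 lh h2 kl hB AB.
have ba : 0 < b - a by lra.
have hl : 0 < h - l by lra.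
have disj (i j : 'I_1) (x : Rn) : cube a b x -> cube a b x -> i = j.
  by rewrite !ord1.
have := @pitt_step R n n_gt0 1%N (fun=> a) (fun=> b) (fun=> ab) disj p q nu delta
  gamma C (fun=> 1) a k (b - a) B l h p0 q0 C0 H (fun=> ler01) (fun=> a0) (fun=> b2)
  l0 lh h2 (ltW ba) kl hB AB.
have va : a - (b - a) <= a by lra.
have vb : b <= a + (b - a) by lra.
move=> /(_ (fun=> va) (fun=> vb)); rewrite !big_ord1 mul1r mulr1.
rewrite [X in _ <= C * X]powRM ?powR_ge0 ?exprn_ge0 ?(ltW ba)// -powRrM mulfV ?gt_eqF// powRr1; last first.
  by rewrite mulr_ge0 ?powR_ge0.
rewrite !powR_expn// !powRN (@powRM _ (2 * n%:R)) ?(ltW D0) ?(ltW hl)//.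
set d := _ `^ `|delta|; set g := _ `^ `|gamma|; set w := (2 * n%:R) `^ nu.
have d0 : 0 < d by rewrite powR_gt0.
have w0 : 0 < w by rewrite powR_gt0.
have hnu : 0 < (h - l) `^ nu by rewrite powR_gt0.
rewrite powRD ?(gt_eqF hl) ?implybT// powRN => h1.
have k0 : 0 <= 2 * d * w by rewrite !mulr_ge0// ltW.
have := ler_wpM2l k0 h1.
rewrite [leLHS](_ : _ = (l `^ delta)^-1 * ((h - l) `^ (n%:R / q) * ((h - l) `^ nu)^-1) * (b - a) ^+ n).
  move=> /le_trans; apply; rewrite /K -/d -/g -/w le_eqVlt; apply/orP; left; apply/eqP; ring.
by field; rewrite !gt_eqF// powR_gt0.
Qed.

Let c : R := (32 * n%:R)^-1.
Let c0 : 0 < c.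
Proof. by rewrite invr_gt0 mulr_gt0// (lt_le_trans ltr01 n1). Qed.

(** Both sides are powers of the side of the cube [[t, 2t)^n], and an inequality
    between powers that holds for all [t > 0] forces equal exponents. *)
Lemma scaling_exponent : gamma = delta + n%:R * (1 - p^-1 - q^-1) + nu.
Proof.
have nR : n%:R != 0 :> R by rewrite gt_eqF// (lt_le_trans ltr01 n1).
pose x := n%:R / q - nu - delta.
have cx : 0 < c `^ x by exact: powR_gt0.
suff : n%:R - x - gamma - n%:R / p = 0.
  by rewrite /x !mulrBr mulr1; lra.
apply: (@bounded_powR_eq0 R _ (K / c `^ x)) => t t0.
have l0 : 0 < c / t by rewrite divr_gt0.
have := @pitt_cube t (2 * t) 0 (2 * (c / t)) (c / t) (2 * (c / t)) t0.
have h1 : t < 2 * t by lra.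
have h2 : c / t < 2 * (c / t) by lra.
have h3 : 0 <= c / t by lra.
have h4 : 2 * (c / t) <= 0 + 2 * (c / t) by lra.
have h5 : 16 * n%:R * (2 * t - t) * (2 * (c / t)) <= 1.
  by rewrite le_eqVlt; apply/orP; left; apply/eqP; rewrite /c; field; rewrite nR gt_eqF.
move=> /(_ h1 (lexx _) l0 h2 (lexx _) h3 h4 h5).
rewrite (_ : 2 * t - t = t); last by ring.
rewrite (_ : 2 * (c / t) - c / t = c / t); last by ring.
rewrite -powRD ?(gt_eqF l0) ?implybT// (_ : - delta + _ = x); last by rewrite /x; ring.
rewrite powRM ?(ltW c0) ?invr_ge0 ?(ltW t0)// -(powR_inv1 (ltW t0)) -powRrM.
rewrite -powR_mulrn ?(ltW t0)// -mulrA -!powRD ?(gt_eqF t0) ?implybT//.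
move=> h; rewrite ler_pdivlMr// mulrC.
rewrite (_ : n%:R - x - gamma - n%:R / p = (-1 * x + n%:R) + - (gamma + n%:R / p)); last by ring.
by rewrite [t `^ _]powRD ?(gt_eqF t0) ?implybT// powRN mulrA ler_pdivrMr ?powR_gt0.
Qed.

(** A fixed bump modulated to a frequency at distance [L]: only [|y|^-delta]
    depends on [L]. *)
Lemma modulation_exponent : 0 <= delta.
Proof.
have nR : n%:R != 0 :> R by rewrite gt_eqF// (lt_le_trans ltr01 n1).
clear c0 c; pose c : R := (16 * n%:R)^-1.
have c1 : 0 < c by rewrite invr_gt0 mulr_gt0// (lt_le_trans ltr01 n1).
have c2 : c <= 1 by rewrite invf_le1 ?mulr_gt0 ?(lt_le_trans ltr01 n1)//; move: n1; lra.
rewrite -oppr_le0; pose x := n%:R / q - nu.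
have cx : 0 < c `^ x by exact: powR_gt0.
apply: (@bounded_powR_le0 R _ (K / c `^ x)) => L L1.
have L0 : 0 < L by lra.
have := @pitt_cube 1 2 L c L (L + c) ltr01.
have h1 : 1 < 2 :> R by lra.
have h1' : 2 <= 2 * 1 :> R by lra.
have h2 : L < L + c by lra.
have h3 : L + c <= 2 * L by lra.
have h5 : 16 * n%:R * (2 - 1) * c <= 1.
  by rewrite le_eqVlt; apply/orP; left; apply/eqP; rewrite /c; field; rewrite nR.
move=> /(_ h1 h1' L0 h2 h3 (lexx _) (lexx _) h5).
rewrite (_ : 2 - 1 = 1 :> R); last by ring.
rewrite (_ : L + c - L = c); last by ring.
by rewrite !powR1 expr1n !mulr1 -/x ler_pdivlMr.
Qed.

(** A fixed bump moved to distance [L]: [|fhat|] does not change, and only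
    [|x|^gamma] depends on [L]. *)
Lemma translation_exponent : 0 <= gamma.
Proof.
have nR : n%:R != 0 :> R by rewrite gt_eqF// (lt_le_trans ltr01 n1).
rewrite -oppr_le0; pose x := c `^ (- delta) * c `^ (n%:R / q - nu).
have x0 : 0 < x by rewrite mulr_gt0// powR_gt0.
apply: (@bounded_powR_le0 R _ (K / x)) => L L1.
have L0 : 0 < L by lra.
have := @pitt_cube L (L + 1) 0 (2 * c) c (2 * c) L0.
have h1 : L < L + 1 by lra.
have h1' : L + 1 <= 2 * L by lra.
have h2 : c < 2 * c by move: c0; lra.
have h3 : 0 <= c by move: c0; lra.
have h4 : 2 * c <= 0 + 2 * c by lra.
have h5 : 16 * n%:R * (L + 1 - L) * (2 * c) <= 1.
  by rewrite le_eqVlt; apply/orP; left; apply/eqP; rewrite /c; field; rewrite nR.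
move=> /(_ h1 h1' c0 h2 (lexx _) h3 h4 h5).
rewrite (_ : L + 1 - L = 1 :> R); last by ring.
rewrite (_ : 2 * c - c = c); last by ring.
rewrite powR1 expr1n !mulr1 -/x => h.
by rewrite powRN ler_pdivlMr// ler_pdivrMl ?powR_gt0// mulrC.
Qed.

(** Take the cubes of the points whose coordinates lie between [2^-(j+1)] and
    [2^-j], for [j < N], each with the constant that gives it integral 1.  If [delta >= n/q - nu], then [gamma >= n/p'] by
    [scaling_exponent], so that each cube contributes a bounded amount to the
    [p]-th power of the weighted norm; hence [N = O(N^(1/p))], which fails for
    large [N] as [p > 1]. *)
Lemma dyadic_exponent : delta < n%:R / q - nu.
Proof.
have nR : n%:R != 0 :> R by rewrite gt_eqF// (lt_le_trans ltr01 n1).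
rewrite ltNge; apply/negP => dn.
have gE : n%:R - n%:R / p <= gamma.
  by rewrite scaling_exponent !mulrBr mulr1; lra.
(* [2^-j - 2^-(j+1) = 2^-(j+1)]: the side of a cube is also its left endpoint *)
pose a (j : nat) : R := 2^-1 ^+ j.+1.
have a0 j : 0 < a j by rewrite exprn_gt0// invr_gt0.
have a1 j : a j <= 2^-1 by rewrite /a exprS ler_piMr// exprn_ile1// invf_le1// ler1n.
have aa j : 2 * a j - a j = a j by ring.
pose D := (2 * n%:R) `^ `|gamma| : R.
have D1 : 0 <= D by exact: powR_ge0.
pose x := (2 * n%:R * c) `^ (- nu) * ((2 * n%:R) `^ (- `|delta|) * c `^ (- delta)) * 2^-1 *
  (c ^+ n) `^ q^-1.
have x0 : 0 < x.
  by do !apply: mulr_gt0; rewrite ?invr_gt0 // powR_gt0 ?exprn_gt0 //; apply: mulr_gt0.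
have bound (N : nat) : (0 < N)%N -> N%:R `^ (1 - p^-1) <= C * D / x.
  move=> N0; have NR : 0 < N%:R :> R by rewrite ltr0n.
  have disj (i j : 'I_N) (y : Rn) : cube (a i) (2 * a i) y -> cube (a j) (2 * a j) y -> i = j.
    move=> yi yj; have /andP[i1 i2] := in_cube (Ordinal n_gt0) yi.
    have /andP[j1 j2] := in_cube (Ordinal n_gt0) yj.
    have lt_aux (i' j' : nat) (s : R) : a i' <= s -> s < 2 * a j' -> (j' <= i')%N.
      move=> s1 s2; rewrite leqNgt; apply/negP => ij.
      have : 2 * a j' <= a i'.
        rewrite /a exprS mulrA mulfV// mul1r -(subnKC ij) exprD ler_piMr ?exprn_ge0//.
        by rewrite exprn_ile1// ?invr_ge0// invf_le1// ler1n.
      by lra.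
    apply: val_inj; apply/eqP; rewrite eqn_leq.
    by rewrite (lt_aux _ _ _ i1 j2) (lt_aux _ _ _ j1 i2).
  have ab (j : 'I_N) : a j < 2 * a j by have := a0 j; lra.
  have cj (j : 'I_N) : 0 <= (a j ^+ n)^-1 by rewrite invr_ge0 exprn_ge0// ltW.
  have h2 : c < 2 * c by move: c0; lra.
  have h3 : 0 <= c by move: c0; lra.
  have h4 : 2 * c <= 0 + 2 * c by lra.
  have h5 : 16 * n%:R * 1 * (2 * c) <= 1.
    by rewrite le_eqVlt; apply/orP; left; apply/eqP; rewrite /c; field; rewrite nR.
  have va (j : 'I_N) : 0 - 1 <= a j by have := a0 j; lra.
  have vb (j : 'I_N) : 2 * a j <= 0 + 1 by have := a1 j; lra.
  have := @pitt_step R n n_gt0 N (fun j => a j) (fun j => 2 * a j) ab disj p q nu delta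
    gamma C (fun j => (a j ^+ n)^-1) 0 0 1 (2 * c) c (2 * c) p0 q0 C0 H cj
    (fun j => a0 j) (fun j => lexx _) c0 h2 (lexx _) ler01 h3 h4 h5 va vb.
  rewrite (eq_bigr (fun=> 1)) => [|j _]; last first.
    by rewrite aa mulVf// expf_neq0// gt_eqF.
  rewrite sumr_const card_ord (_ : 2 * c - c = c); last by ring.
  set S := \sum_(j < N) _ => h.
  have S1 : S <= N%:R * D `^ p.
    rewrite -[N in N%:R]card_ord mulr_natl -sumr_const; apply: ler_sum => j _.
    rewrite aa.
    apply: (@le_trans _ _ ((D * a j `^ (n%:R - n%:R / p) * (a j ^+ n)^-1) `^ p * a j ^+ n)).
      apply: ler_wpM2r; first by rewrite exprn_ge0// ltW.
      apply: ge0_ler_powR; rewrite ?nnegrE ?(ltW p0)// ?mulr_ge0 ?powR_ge0//.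
      apply: ler_wpM2r => //; apply: ler_wpM2l => //.
      by apply: powR_antitone => //; have := a1 j; lra.
    rewrite -powR_mulrn ?(ltW (a0 j))// powRD ?(gt_eqF (a0 j)) ?implybT//.
    have an : a j `^ n%:R != 0 by rewrite gt_eqF// powR_gt0.
    rewrite [X in X `^ p](_ : _ = D * a j `^ (- (n%:R / p))); last by field.
    rewrite powRM ?powR_ge0// -powRrM -mulrA -powRD ?(gt_eqF (a0 j)) ?implybT//.
    rewrite (_ : _ + n%:R = 0) ?powRr0 ?mulr1//.
    by field; rewrite gt_eqF.
  have S2 : S `^ p^-1 <= N%:R `^ p^-1 * D.
    apply: (@le_trans _ _ ((N%:R * D `^ p) `^ p^-1)).
      apply: ge0_ler_powR; rewrite ?nnegrE ?invr_ge0 ?(ltW p0)//.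
        by apply: sumr_ge0 => j _; rewrite mulr_ge0 ?powR_ge0// exprn_ge0// aa ltW.
      by rewrite mulr_ge0 ?powR_ge0.
    by rewrite powRM ?powR_ge0// -powRrM mulfV ?gt_eqF// powRr1.
  rewrite powRD ?(gt_eqF NR) ?implybT// powRr1// powRN ler_pdivlMr//.
  rewrite mulrAC ler_pdivrMr ?powR_gt0//.
  have := le_trans h (ler_wpM2l (ltW C0) S2).
  move=> h6; apply: le_trans (le_trans _ h6) _.
    by rewrite /x le_eqVlt; apply/orP; left; apply/eqP; ring.
  by rewrite le_eqVlt; apply/orP; left; apply/eqP; ring.
suff : 1 - p^-1 <= 0 by rewrite subr_le0 leNgt invf_lt1 ?p1.
have p1' : 0 <= 1 - p^-1 by rewrite subr_ge0 invf_le1 ?ltW.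
apply: (@bounded_powR_le0 R _ (C * D / x)) => t t1.
have t0 : 0 <= t by lra.
have tN := archi_boundP t0.
apply: le_trans (bound (Num.bound t) _); last first.
  by rewrite -(@ltr0n R); lra.
by apply: ge0_ler_powR; rewrite ?nnegrE ?(ltW tN).
Qed.

End necessity.

Theorem theorem5p1 (R : realType) (n : nat) (p q nu delta gamma : R)
    (n_gt0 : (0 < n)%N) (p_gt1 : 1 < p) (q_gt0 : 0 < q)
    (nu_ge0 : 0 <= nu) (nu_lt : nu < n%:R / q)
    (p_le : p <= n%:R * q / (n%:R - nu * q)) :
  let p' := p / (p - 1) in
  (exists2 C : R, 0 < C &
     forall f : n.-tuple (measurableTypeR R) -> complex R, L1 f ->
       (morrey_norm q nu (weighted (- delta) (fourier f))
         <= C%:E * Lp_norm p setT (weighted gamma f))%E)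
  <->
  (Num.max 0 (n%:R * (1 / q - 1 / p') - nu) <= delta < n%:R / q - nu /\
   gamma = delta + n%:R * (1 / p' - 1 / q) + nu).
Proof.
move=> p'; split=> [[C C0 H]|[hd hg]]; last exact: morrey_pitt.
have p'E : 1 / p' = 1 - p^-1.
  by rewrite /p'; field; rewrite !gt_eqF//; lra.
have gE : gamma = delta + n%:R * (1 / p' - 1 / q) + nu.
  by rewrite (scaling_exponent n_gt0 p_gt1 q_gt0 C0 H) p'E; ring.
have g0 := translation_exponent n_gt0 p_gt1 q_gt0 C0 H.
split=> //; rewrite (dyadic_exponent n_gt0 p_gt1 q_gt0 C0 H) andbT ge_max.
rewrite (modulation_exponent n_gt0 p_gt1 q_gt0 C0 H) /=.
by move: g0; rewrite gE !mulrBr; lra.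
Qed.
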